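(* Let $A$ be a Hermitian unital Banach $\ast$-algebra and $\psi:A\to\mathbb{C}$ a positive normalized linear functional. Let $f$ be analytic in an open subset $G$ of $\mathbb{C}$, let $I\subset G$ be a real interval, and suppose $f$ is convex (in the usual sense, as a real-valued function) on $I$. Let $m<M$ be real numbers with $[m,M]\subset I$, and let $c\in A$ be a selfadjoint element with $\sigma(c)\subseteq[m,M]$. For $t\in(m,M)$ put $$\Theta_f(t;m,M)=\frac{f(M)-f(t)}{M-t}-\frac{f(t)-f(m)}{t-m}.$$ If $\psi(c)\in(m,M)$, then (1) $$0\le \psi(f(c))-f(\psi(c))\le \frac{(M-\psi(c))(\psi(c)-m)}{M-m}\sup_{t\in(m,M)}\Theta_f(t;m,M),$$ the right-hand side of this is less than or equal to each of the two quantities $$\frac14(M-m)\sup_{t\in(m,M)}\Theta_f(t;m,M)\quad\text{and}\quad (M-\psi(c))(\psi(c)-m)\frac{f'(M)-f'(m)}{M-m},$$ and each of these two quantities is less than or equal to $\frac14(M-m)\left[f'(M)-f'(m)\right]$; (2) $$0\le \psi(f(c))-f(\psi(c))\le \frac14(M-m)\,\Theta_f(\psi(c);m,M)\le \frac14(M-m)\sup_{t\in(m,M)}\Theta_f(t;m,M)\le\frac14(M-m)\left[f'(M)-f'(m)\right].$$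
   Context: A unital Banach $\ast$-algebra $A$ (complex, with unit $1$) is called Hermitian if every selfadjoint element $a$ ($a^\ast=a$) has real spectrum $\sigma(a)\subset\mathbb{R}$. An element $a\in A$ is nonnegative, written $a\ge 0$, if $a^\ast=a$ and $\sigma(a)\subset[0,\infty)$. A linear functional $\psi:A\to\mathbb{C}$ is positive if $\psi(a)\ge0$ whenever $a\ge0$, and normalized if $\psi(1)=1$. For $f$ analytic on an open set $G\supset\sigma(c)$, $f(c)\in A$ is defined by the holomorphic functional calculus, $f(c)=\frac{1}{2\pi i}\int_\gamma f(z)(z-c)^{-1}dz$, where $\gamma$ is a closed rectifiable curve in $G$ with $\sigma(c)$ in its inside; the result does not depend on the choice of $\gamma$. *)

(* Defs.v *)
From HB Require Import structures.
From mathcomp Require Import all_boot all_order all_algebra.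
From mathcomp Require Import complex.
From mathcomp Require Import all_classical all_reals all_analysis.

Set Implicit Arguments.
Unset Strict Implicit.
Unset Printing Implicit Defensive.

Import Order.TTheory GRing.Theory Num.Theory.
Import numFieldNormedType.Exports.

Local Open Scope classical_set_scope.
Local Open Scope complex_scope.
Local Open Scope ring_scope.

(* The topology and the norm of the numeric field R[i], which the library
   only attaches to its alias R[i]^o. *)
HB.instance Definition _ (R : realType) := NormedModule.copy R[i] R[i]^o.

(* The product and the unit are fields of their own because the library's
   hierarchy has no join of normed modules and rings other than numeric
   domains.  The involution is not assumed to be isometric or even continuous,
   and the norm of the unit is not normalized, so every usual convention is
   covered. *)
HB.mixin Record isBanachStarAlgebra (K : numClosedFieldType) A
    & CompleteNormedModule K A := {
  bone : A;
  bmul : A -> A -> A;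
  star : A -> A;
  bmulA : associative bmul;
  bmul1a : left_id bone bmul;
  bmula1 : right_id bone bmul;
  bmulDl : left_distributive bmul +%R;
  bmulDr : right_distributive bmul +%R;
  bmulZl : forall (k : K) (a b : A), bmul (k *: a) b = k *: bmul a b;
  bmulZr : forall (k : K) (a b : A), bmul a (k *: b) = k *: bmul a b;
  norm_bmul : forall a b : A, `|bmul a b| <= `|a| * `|b|;
  starK : involutive star;
  starD : {morph star : a b / a + b};
  starZ : forall (k : K) (a : A), star (k *: a) = Num.conj k *: star a;
  starM : forall a b : A, star (bmul a b) = bmul (star b) (star a)
}.

#[short(type="banachStarAlgType")]
HB.structure Definition BanachStarAlgebra (K : numClosedFieldType) :=
  {A of CompleteNormedModule K A & isBanachStarAlgebra K A}.

Arguments bone {K s}.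

Section spectrum.
Context {K : numClosedFieldType} {A : banachStarAlgType K}.
Implicit Types a b : A.

Definition is_inverse a b : Prop := bmul a b = bone /\ bmul b a = bone.

Definition invertible a : Prop := exists b, is_inverse a b.

(* the inverse of a if a is invertible, and 0 otherwise *)
Definition binv a : A := xget 0 [set b | is_inverse a b].

Definition spectrum a : set K := [set z | ~ invertible (z *: bone - a)].

End spectrum.

Definition selfadjoint (K : numClosedFieldType) (A : banachStarAlgType K)
  (a : A) : Prop := star a = a.

Definition hermitian_algebra (K : numClosedFieldType) (A : banachStarAlgType K) : Prop :=
  forall a : A, selfadjoint a -> spectrum a `<=` [set z | z \is Num.real].

(* In K, 0 <= z means that z is real and nonnegative. *)
Definition nonnegative (K : numClosedFieldType) (A : banachStarAlgType K)
  (a : A) : Prop := selfadjoint a /\ spectrum a `<=` [set z | 0 <= z].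

Definition positive_functional (K : numClosedFieldType)
    (A : banachStarAlgType K) (psi : {scalar A}) : Prop :=
  forall a : A, nonnegative a -> 0 <= psi a.

Definition analytic_on (R : realType) (G : set R[i]) (f : R[i] -> R[i]) : Prop :=
  forall z, G z -> derivable f z 1.

Section curves.
Context {R : realType}.
Implicit Types (g : R -> R[i]) (s : seq R).

(* Curves are parametrized by [0, 1].  As in itv_partition, the list s stands
   for the subdivision 0 :: s, and node s i is its i-th point. *)
Definition node s : nat -> R := nth 1 (0 :: s).

Definition rectifiable g : Prop :=
  exists L : R, forall s, itv_partition 0 1 s ->
    \sum_(0 <= k < size s) `|g (node s k.+1) - g (node s k)| <= L%:C.

Definition closed_rectifiable_curve g : Prop :=
  [/\ {within `[0, 1], continuous g}, g 0 = g 1 & rectifiable g].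

(* y is the limit of the Riemann-Stieltjes sums of h along g when the mesh of
   the tagged subdivision tends to 0. *)
Definition is_contour_integral (V : normedModType R[i]) g (h : R[i] -> V)
    (y : V) : Prop :=
  forall e : R, 0 < e -> exists2 d : R, 0 < d &
    forall s (tag : nat -> R), itv_partition 0 1 s ->
      (forall k, (k < size s)%N -> node s k.+1 - node s k < d /\
                                   node s k <= tag k <= node s k.+1) ->
      `|\sum_(0 <= k < size s)
          (g (node s k.+1) - g (node s k)) *: h (g (tag k)) - y| < e%:C.

(* The junk value 0 is only taken when the limit does not exist. *)
Definition contour_integral (V : normedModType R[i]) g (h : R[i] -> V) : V :=
  xget 0 [set y | is_contour_integral g h y].

Definition two_pi_i : R[i] := (2 * pi)%:C * 'i.

Definition trace_of g : set R[i] := g @` `[0, 1].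

Definition winding_number g (w : R[i]) : R[i] :=
  two_pi_i^-1 * contour_integral g (fun z => (z - w)^-1).

Definition inside g : set R[i] :=
  [set w | ~ trace_of g w /\ winding_number g w = 1].

Definition outside g : set R[i] :=
  [set w | ~ trace_of g w /\ winding_number g w = 0].

(* The contours allowed in the functional calculus for a function analytic in
   G and an element with spectrum S.  That g does not wind around points of
   the complement of G is part of the meaning of "inside" in this context: it
   is what makes the integral independent of g when G has holes. *)
Definition contour_around (G S : set R[i]) g : Prop :=
  [/\ closed_rectifiable_curve g, trace_of g `<=` G,
      S `<=` inside g & ~` G `<=` outside g].

(* f(c), computed along the contour g *)
Definition holomorphic_calculus (A : banachStarAlgType R[i])
    (f : R[i] -> R[i]) g (c : A) : A :=
  two_pi_i^-1 *: contour_integral g (fun z => f z *: binv (z *: bone - c)).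

End curves.

Definition Theta (K : fieldType) (f : K -> K) (t m M : K) : K :=
  (f M - f t) / (M - t) - (f t - f m) / (t - m).

(* On (m, M) the function Theta is real-valued and bounded under the
   hypotheses of use, so Re loses nothing and sup is a true supremum. *)
Definition sup_Theta (R : realType) (f : R[i] -> R[i]) (m M : R) : R :=
  sup [set complex.Re (Theta f t%:C m%:C M%:C) | t in `]m, M[].

(* Main.v *)
Require Import Defs.
From HB Require Import structures.
From mathcomp Require Import all_boot all_order all_algebra.
From mathcomp Require Import complex.
From mathcomp Require Import all_classical all_reals all_analysis.
From mathcomp Require Import ring lra zify.

Set Implicit Arguments.
Unset Strict Implicit.
Unset Printing Implicit Defensive.

Import Order.TTheory GRing.Theory Num.Theory.
Import numFieldNormedType.Exports.

Local Open Scope classical_set_scope.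
Local Open Scope complex_scope.
Local Open Scope ring_scope.

(** A convex f lies above its tangent at psi(c) and below its chord over [m, M].
    If psi preserves such inequalities with affine functions on the spectrum,
    the tangent gives f(psi c) <= psi(f(c)), and the chord bounds psi(f(c)) from
    above by its own value at psi(c).  The distance from f(psi c) to the chord
    is (M - psi c)(psi c - m)/(M - m) times Theta_f(psi c; m, M), and the bounds
    of the theorem are then compared by elementary estimates for convex
    functions (gap_chain).

    The heart of the matter is calculus_positive: if a + b t + k f(t) is
    nonnegative on the spectrum of c, then a + b psi(c) + k psi(f(c)) is
    nonnegative.  Two difficulties have to be overcome.

    The first is that the involution, and with it psi, may be discontinuous, so
    psi cannot be interchanged with the contour integral.  If x commutes with
    its involute x', however, the norm of x bounds the spectral radius of x',
    and hence that of (x + x')/2.  As the algebra is Hermitian,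
    1 - (x + x')/2 is nonnegative when the norm of x is less than 1, and psi is
    bounded on such elements (functional_bound).  The spectral radius enters in
    the form of power_bounded: if 1 - z y is invertible for all z in the closed
    unit disc, the powers y^(2^p) are eventually bounded by 1.  This follows
    from the identity 1/(1-w^2) = (1/(1-w) + 1/(1+w))/2 and the uniform
    continuity of the resolvent.

    The Riemann sums of the integral for f(c) are values at c of rational
    functions.  Their spectra are controlled by factorization
    (rational_spectrum), so psi is nonnegative up to a small error on a sum that
    is nonnegative up to a small error on the spectrum (rational_lower).  The
    error between f(c) and a Riemann sum commutes with everything that commutes
    with c, in particular with its involute, and functional_bound applies.

    The second difficulty is that the rational functions have to converge to f
    uniformly on the spectrum.  For this the Cauchy formula is needed for an
    arbitrary closed rectifiable curve that winds once around each point of the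
    spectrum and does not wind around any point outside G (cauchy_formula).
    Goursat's argument (goursat), also in the presence of one point where the
    function is merely continuous (bdry_int0), provides primitives on squares.
    An integral along the curve is then a sum of increments of primitives, and
    can be pushed onto a fine lattice, where a discrete form of Green's theorem
    (lattice_path) turns it into a combination of integrals over the boundaries
    of cells.  For cells well inside G these vanish.  The coefficient of any
    other cell is found by integrating 1/(z - w), with w the centre of the cell:
    up to a nonzero factor it is the winding number around w, which equals that
    around a nearby point outside G, namely 0 (cauchy_homologous). *)

(** * Norms with real values and induction over segments *)

Section real_norm.
Context {R : realType}.

(** The norm of a space over R[i] takes values in R[i]; this is the same number
    in R, where it can be compared with reals. *)
Definition nr {V : normedModType R[i]} (x : V) : R := complex.Re `|x|.

Lemma nrE (V : normedModType R[i]) (x : V) : `|x| = (nr x)%:C.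
Proof. by rewrite /nr RRe_real // normr_real. Qed.

Lemma nr_lt (V : normedModType R[i]) (x : V) (e : R) : (`|x| < e%:C) = (nr x < e).
Proof. by rewrite nrE ltcR. Qed.

Lemma nr_le (V : normedModType R[i]) (x : V) (e : R) : (`|x| <= e%:C) = (nr x <= e).
Proof. by rewrite nrE lecR. Qed.

Lemma nr_ge0 (V : normedModType R[i]) (x : V) : 0 <= nr x.
Proof. by rewrite -lecR -nrE normr_ge0. Qed.

Lemma nr_triangle (V : normedModType R[i]) (x y : V) : nr (x + y) <= nr x + nr y.
Proof. by rewrite -lecR rmorphD /= -!nrE ler_normD. Qed.

Lemma nrN (V : normedModType R[i]) (x : V) : nr (- x) = nr x.
Proof. by rewrite /nr normrN. Qed.

Lemma nrB (V : normedModType R[i]) (x y : V) : nr (x - y) <= nr x + nr y.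
Proof. by rewrite (le_trans (nr_triangle _ _)) // nrN. Qed.

Lemma nr_sym (V : normedModType R[i]) (x y : V) : nr (x - y) = nr (y - x).
Proof. by rewrite -nrN opprB. Qed.

Lemma nr_dist (V : normedModType R[i]) (z x y : V) : nr (x - y) <= nr (x - z) + nr (z - y).
Proof. by rewrite -[x - y](subrKA z) nr_triangle. Qed.

Lemma nr0 (V : normedModType R[i]) : nr (0 : V) = 0.
Proof. by rewrite /nr normr0. Qed.

Lemma nr_eq0 (V : normedModType R[i]) (x : V) : (nr x == 0) = (x == 0).
Proof. by rewrite -[RHS]normr_eq0 nrE; apply/eqP/eqP => [->|[]]. Qed.

Lemma nr_gt0 (V : normedModType R[i]) (x : V) : (0 < nr x) = (x != 0).
Proof. by rewrite lt_def nr_ge0 andbT nr_eq0. Qed.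

Lemma nr_sub_eq0 (V : normedModType R[i]) (x y : V) :
  (forall e : R, 0 < e -> nr (x - y) <= e) -> x = y.
Proof.
move=> H; apply/eqP; rewrite -subr_eq0 -nr_eq0 eq_le nr_ge0 andbT.
by apply/ler_addgt0Pr => e e0; rewrite add0r; apply: H.
Qed.

Lemma nrM (x y : R[i]) : nr (x * y) = nr x * nr y.
Proof.
have /complexI : (nr (x * y))%:C = (nr x * nr y)%:C; last by [].
by rewrite rmorphM /= -!nrE normrM.
Qed.

Lemma nrZ (V : normedModType R[i]) (k : R[i]) (x : V) : nr (k *: x) = nr k * nr x.
Proof.
have /complexI : (nr (k *: x))%:C = (nr k * nr x)%:C; last by [].
by rewrite rmorphM /= -!nrE normrZ.
Qed.

Lemma nrV (x : R[i]) : nr x^-1 = (nr x)^-1.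
Proof.
have /complexI : (nr x^-1)%:C = ((nr x)^-1)%:C; last by [].
by rewrite fmorphV /= -!nrE normfV.
Qed.

Lemma nr1 : nr (1 : R[i]) = 1.
Proof. by rewrite /nr normr1. Qed.

Lemma nrR (x : R) : nr (x%:C : R[i]) = `|x|.
Proof.
have /complexI : (nr (x%:C : R[i]))%:C = `|x|%:C; last by [].
by rewrite -nrE normc_def /= expr0n addr0 sqrtr_sqr.
Qed.

Lemma nr_two : nr (2 : R[i]) = 2.
Proof. by rewrite -[2]/(2%:R) -(rmorph_nat (real_complex R)) nrR ger0_norm. Qed.

Lemma nr_sum (V : normedModType R[i]) (n : nat) (F : nat -> V) :
  nr (\sum_(0 <= k < n) F k) <= \sum_(0 <= k < n) nr (F k).
Proof.
elim: n => [|n IH]; first by rewrite !big_geq // nr0.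
by rewrite !big_nat_recr //= (le_trans (nr_triangle _ _)) // lerD2r.
Qed.

Lemma nr_Re (z : R[i]) : `|complex.Re z| <= nr z.
Proof. by rewrite -lecR -nrE normc_ge_Re. Qed.

Lemma nr_i : nr ('i%C : R[i]) = 1.
Proof.
have /complexI : (nr ('i%C : R[i]))%:C = 1%:C; last by [].
by rewrite -nrE normc_def /= expr0n add0r expr1n sqrtr1.
Qed.

Lemma nr_Im (z : R[i]) : `|complex.Im z| <= nr z.
Proof.
have -> : nr z = nr (z * 'i%C) by rewrite nrM nr_i mulr1.
by rewrite -(normrN (complex.Im z)) -ReiNIm nr_Re.
Qed.

Lemma nr_ReIm (z : R[i]) : nr z <= `|complex.Re z| + `|complex.Im z|.
Proof.
by rewrite {1}[z]complexE (le_trans (nr_triangle _ _)) // nrM !nrR nr_i mul1r lexx.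
Qed.

Lemma complex_ext (z w : R[i]) :
  complex.Re z = complex.Re w -> complex.Im z = complex.Im w -> z = w.
Proof. by case: z w => [a b] [c d] /= -> ->. Qed.

Lemma eq_leW (x y : R) : x = y -> x <= y.
Proof. by move=> ->. Qed.

End real_norm.

Section derivatives.
Context {R : realType}.

(** Uniform estimates are needed throughout, so continuity and complex
    differentiability are used in this epsilon-delta form. *)
Definition ccont (V : normedModType R[i]) (F : R[i] -> V) (z : R[i]) : Prop :=
  forall e : R, 0 < e -> exists2 d : R, 0 < d &
    forall w, nr (w - z) < d -> nr (F w - F z) <= e.

Definition cderiv (F : R[i] -> R[i]) (z d : R[i]) : Prop :=
  forall e : R, 0 < e -> exists2 r : R, 0 < r &
    forall w, nr (w - z) < r -> nr (F w - F z - d * (w - z)) <= e * nr (w - z).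

Lemma cderiv_cst (z k : R[i]) : cderiv (fun _ => k) z 0.
Proof. by move=> e e0; exists 1 => // w _; rewrite mul0r !subrr nr0 mulr_ge0 ?nr_ge0 // ltW. Qed.

End derivatives.

Section cousin.
Context {R : realType}.

(** Cousin's lemma: a property of subintervals that holds near every point and
    passes to adjacent intervals holds globally.  It replaces the compactness of
    segments in all that follows. *)
Lemma cousin (P : R -> R -> Prop) (a b : R) : a <= b ->
  (forall x, a <= x <= b -> exists2 d : R, 0 < d &
     forall y z, a <= y -> y <= x -> x <= z -> z <= b -> x - d < y -> z < x + d -> P y z) ->
  (forall y x z, a <= y -> y <= x -> x <= z -> z <= b -> P y x -> P x z -> P y z) ->
  P a b.
Proof.
move=> ab loc join.
pose S := [set x | a <= x <= b /\ P a x].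
have Sa : S a.
  have [|d d0 Pd] := loc a; first by rewrite lexx ab.
  by split; [rewrite lexx ab | apply: Pd => //; lra].
have Sub : ubound S b by move=> x [/andP[]].
have supS : has_sup S by split; [exists a | exists b].
have hub : has_ubound S by exists b.
set s := sup S.
have as_ : a <= s by apply: ub_le_sup.
have sb : s <= b by apply: ge_sup => //; exists a.
have [d d0 Pd] := loc s (introT andP (conj as_ sb)).
have [x Sx sx] := sup_adherent d0 supS.
have xs : x <= s by apply: ub_le_sup.
case: (Sx) => /andP[ax xb] Pax; rewrite -/s in sx.
have [y [sy yb ysd ylt]] : exists y, [/\ s <= y, y <= b, y < s + d & y < b -> s < y].
  have [bs|sb2] := leP b (s + d / 2).
    by exists b; split => //; rewrite ?ltxx // (le_lt_trans bs) //; lra.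
  by exists (s + d / 2); split; lra.
have Sy : S y.
  split; first by rewrite yb (le_trans as_ sy).
  by apply: (join a x y) => //; [exact: le_trans sy | exact: Pd].
have ys : y <= s by apply: ub_le_sup.
suff <- : y = b by case: Sy.
by apply/eqP; rewrite eq_le yb /= leNgt; apply/negP => /ylt; rewrite ltNge ys.
Qed.

(** The bound K + e on short difference quotients is additive over adjacent
    intervals, so it passes from points to the whole segment.  No derivative of
    W is mentioned, which lets W be the difference between a primitive along a
    segment and an explicit comparison function. *)
Lemma mean_value_ineq (V : normedModType R[i]) (W : R -> V) (a b K : R) :
  a <= b ->
  (forall x, a <= x <= b -> forall e : R, 0 < e -> exists2 d : R, 0 < d &
     forall y, a <= y <= b -> `|y - x| < d -> nr (W y - W x) <= (K + e) * `|y - x|) ->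
  nr (W b - W a) <= K * (b - a).
Proof.
move=> ab lipW; apply/ler_addgt0Pr => e0 e0_gt0.
have [e e_gt0 ee0] : exists2 e, 0 < e & e * (b - a) <= e0.
  exists (e0 / (b - a + 1)); first by rewrite divr_gt0 //; lra.
  rewrite -mulrA ger_pMr // mulrC ler_pdivrMr; lra.
apply: (@le_trans _ _ ((K + e) * (b - a))); last by rewrite mulrDl lerD2l.
apply: (@cousin (fun y z => nr (W z - W y) <= (K + e) * (z - y))) => //.
- move=> x xab; have [d d0 Wd] := lipW x xab e e_gt0; exists d => // y z ay yx xz zb dy dz.
  have yab : a <= y <= b by rewrite ay (le_trans yx (le_trans xz zb)).
  have zab : a <= z <= b by rewrite zb (le_trans ay (le_trans yx xz)).
  have := Wd y yab; rewrite distrC ger0_norm ?subr_ge0 // nr_sym => Wy.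
  have := Wd z zab; rewrite ger0_norm ?subr_ge0 // => Wz.
  have {}Wy := Wy ltac:(lra); have {}Wz := Wz ltac:(lra).
  by have := nr_dist (W x) (W z) (W y); nra.
- move=> y x z _ _ _ _ Pyx Pxz.
  by have := nr_dist (W x) (W z) (W y); nra.
Qed.

Lemma lebesgue_number (Q : R -> R -> Prop) (a b : R) : a <= b ->
  (forall x, a <= x <= b -> exists2 d : R, 0 < d &
     forall y z, a <= y <= b -> a <= z <= b -> `|y - x| < d -> `|z - x| < d -> Q y z) ->
  exists2 d : R, 0 < d &
     forall y z, a <= y <= b -> a <= z <= b -> `|y - z| < d -> Q y z.
Proof.
move=> ab loc.
apply: (@cousin (fun u v => exists2 d : R, 0 < d &
  forall y z, u <= y <= v -> u <= z <= v -> `|y - z| < d -> Q y z)) => //.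
- move=> x xab; have [d d0 Qd] := loc x xab; exists d => // u v au ux xv vb du dv.
  exists d => // y z /andP[uy yv] /andP[uz zv] _.
  by apply: Qd; rewrite ?ltr_norml; lra.
- move=> u x v au ux xv vb [d1 d10 Q1] [d2 d20 Q2].
  have [|d d0 Qd] := loc x; first by rewrite (le_trans au ux) (le_trans xv vb).
  exists (Num.min d (Num.min d1 d2)); first by rewrite !lt_min d0 d10 d20.
  move=> y z /andP[uy yv] /andP[uz zv]; rewrite !lt_min => /and3P[yzd yzd1 yzd2].
  move: yzd; rewrite ltr_norml => /andP[yzd1' yzd2'].
  have [yx|xy] := leP y x; have [zx|xz] := leP z x.
  + by apply: Q1 => //; rewrite ?uy ?uz.
  + by apply: Qd; rewrite ?ltr_norml; lra.
  + by apply: Qd; rewrite ?ltr_norml; lra.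
  + by apply: Q2 => //; rewrite ?(ltW xy) ?(ltW xz).
Qed.

Lemma uniform_radius (Q : R -> R -> Prop) (a b : R) : a <= b ->
  (forall s d d', 0 < d -> d <= d' -> Q s d' -> Q s d) ->
  (forall x, a <= x <= b -> exists2 r : R, 0 < r & exists2 d : R, 0 < d &
     forall s, a <= s <= b -> `|s - x| < r -> Q s d) ->
  exists2 d : R, 0 < d & forall s, a <= s <= b -> Q s d.
Proof.
move=> ab mono loc.
apply: (@cousin (fun u v => exists2 d : R, 0 < d & forall s, u <= s <= v -> Q s d)) => //.
- move=> x xab; have [r r0 [d d0 Qd]] := loc x xab; exists r => // u v au ux xv vb ru rv.
  by exists d => // s sab; apply: Qd; rewrite ?ltr_norml; lra.
- move=> u x v _ _ _ _ [d1 d10 Q1] [d2 d20 Q2]; have d0 : 0 < Num.min d1 d2 by rewrite lt_min d10.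
  exists (Num.min d1 d2) => //.
  move=> s /andP[us sv]; have [sx|xs] := leP s x.
    by apply: mono d0 _ (Q1 s _); rewrite ?us // ge_min lexx.
  by apply: mono d0 _ (Q2 s _); rewrite ?(ltW xs) // ge_min lexx orbT.
Qed.

Lemma locally_bounded_bounded (F : R -> R) (a b : R) : a <= b ->
  (forall x, a <= x <= b -> exists2 d : R, 0 < d & exists K,
     forall y, a <= y <= b -> `|y - x| < d -> F y <= K) ->
  exists K : R, forall y, a <= y <= b -> F y <= K.
Proof.
move=> ab loc.
have [|x xab|d d0 Fd] := uniform_radius (Q := fun s d => F s <= d^-1) ab; last by exists d^-1.
  by move=> s d d' d0 dd /le_trans; apply; rewrite lef_pV2 ?posrE // (lt_le_trans d0).
have [r r0 [K FK]] := loc x xab; exists r => //; exists (Num.max K 1)^-1.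
  by rewrite invr_gt0 lt_max ltr01 orbT.
by move=> s ss sx; rewrite invrK le_max FK.
Qed.

End cousin.

(** * Primitives on rectangles and squares *)

Section antiderivative.
Context {R : realType}.

Lemma derive1_eps (U : R -> R) (x d : R) : derivable U x 1 -> derive1 U x = d ->
  forall e : R, 0 < e -> exists2 r : R, 0 < r &
    forall y, `|y - x| < r -> `|U y - U x - (y - x) * d| <= e * `|y - x|.
Proof.
move=> dU Ud e e0.
rewrite derive1E in Ud; have := cvg_toP dU Ud.
move=> /cvgrPdist_le/(_ e e0); rewrite /dnbhs near_withinE => /nbhs_ballP[r /= r0 Hr].
exists r => // y yx.
have [->|ynx] := eqVneq y x; first by rewrite !subrr mul0r subr0 normr0 mulr0.
have := Hr (y - x); rewrite /ball /= sub0r normrN => /(_ yx).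
rewrite subr_eq0 => /(_ ynx); rewrite -[X in `|d - X| <= _]/((y - x)^-1 * _) [(y - x) *: 1]mulr1 subrK => He.
have ynx0 : y - x != 0 by rewrite subr_eq0.
have -> : U y - U x - (y - x) * d = - ((y - x) * (d - (y - x)^-1 * (U y - U x))).
  by field.
by rewrite normrN normrM mulrC ler_pM2r // normr_gt0.
Qed.

Lemma real_antiderivative (u : R -> R) (a b : R) : a < b ->
  (forall x, a <= x <= b -> forall e : R, 0 < e -> exists2 d : R, 0 < d &
     forall y, `|y - x| < d -> `|u y - u x| <= e) ->
  exists U : R -> R, forall x, a < x < b -> forall e : R, 0 < e ->
    exists2 r : R, 0 < r &
      forall y, `|y - x| < r -> `|U y - U x - (y - x) * u x| <= e * `|y - x|.
Proof.
move=> ab cu.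
have cu' x : a <= x <= b -> {for x, continuous u}.
  move=> xab; apply/cvgrPdist_le => e e0.
  have [d d0 ud] := cu x xab e e0.
  apply/nbhs_ballP; exists d => // y; rewrite /ball /= => yd.
  by rewrite distrC ud // distrC.
have iu : lebesgue_measure.-integrable `[a, b] (EFin \o u).
  apply: continuous_compact_integrable; first exact: segment_compact.
  apply: continuous_in_subspaceT => x; rewrite inE /= in_itv /= => xab.
  exact: cu'.
exists (fun y => (\int[lebesgue_measure]_(t in `[a, y]) u t)%R) => x /andP[ax xb].
have [|dU Ux] := continuous_FTC1_closed xb iu ax; first by apply: cu'; rewrite !ltW.
exact: derive1_eps.
Qed.

Lemma antiderivative (u : R -> R[i]) (a b : R) : a < b ->
  (forall x, a <= x <= b -> forall e : R, 0 < e -> exists2 d : R, 0 < d &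
     forall y, `|y - x| < d -> nr (u y - u x) <= e) ->
  exists U : R -> R[i], forall x, a < x < b -> forall e : R, 0 < e ->
    exists2 r : R, 0 < r &
      forall y, `|y - x| < r -> nr (U y - U x - (y - x)%:C * u x) <= e * `|y - x|.
Proof.
move=> ab cu.
have [] := @real_antiderivative (fun x => complex.Re (u x)) a b ab.
  move=> x xab e e0; have [d d0 ud] := cu x xab e e0; exists d => // y /ud.
  by apply: le_trans; rewrite -raddfB nr_Re.
move=> U1 HU1.
have [] := @real_antiderivative (fun x => complex.Im (u x)) a b ab.
  move=> x xab e e0; have [d d0 ud] := cu x xab e e0; exists d => // y /ud.
  by apply: le_trans; rewrite -raddfB nr_Im.
move=> U2 HU2.
exists (fun x => Complex (U1 x) (U2 x)) => x xab e e0.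
have e20 : 0 < e / 2 by lra.
have [r1 r10 H1] := HU1 x xab _ e20; have [r2 r20 H2] := HU2 x xab _ e20.
exists (Num.min r1 r2); first by rewrite lt_min r10 r20.
move=> y; rewrite lt_min => /andP[/H1 {}H1 /H2 {}H2].
apply: (le_trans (nr_ReIm _)).
have -> : e = e / 2 + e / 2 by lra.
rewrite mulrDl; apply: lerD.
  by move: H1; case: (u x) => p q /=; rewrite mul0r subr0.
by move: H2; case: (u x) => p q /=; rewrite mul0r addr0.
Qed.

End antiderivative.

Section goursat.
Context {R : realType}.
Implicit Types (F A : R[i] -> R[i]) (z p q : R[i]).

Definition rderiv (U : R -> R[i]) (x : R) (d : R[i]) : Prop :=
  forall e : R, 0 < e -> exists2 r : R, 0 < r &
    forall y, `|y - x| < r -> nr (U y - U x - (y - x)%:C * d) <= e * `|y - x|.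

(** The increment of the antiderivative U, times u, stands for the integral of F
    along the edge parametrized by c.  The mean value inequality applies to its
    difference with A along the edge, whose derivative is u (F - A'). *)
Lemma edge_estimate F A (A' : R[i] -> R[i]) (c : R -> R[i]) (u : R[i]) (U : R -> R[i])
    (s1 s2 K : R) :
  (forall s t, c t - c s = (t - s)%:C * u) -> nr u = 1 -> s1 <= s2 ->
  (forall s, s1 <= s <= s2 -> rderiv U s (F (c s))) ->
  (forall z, cderiv A z (A' z)) ->
  (forall s, s1 <= s <= s2 -> nr (F (c s) - A' (c s)) <= K) ->
  nr (u * (U s2 - U s1) - (A (c s2) - A (c s1))) <= K * (s2 - s1).
Proof.
move=> cu u1 s12 dU dA FA.
have -> : u * (U s2 - U s1) - (A (c s2) - A (c s1)) =
  (u * U s2 - A (c s2)) - (u * U s1 - A (c s1)) by ring.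
apply: (@mean_value_ineq _ _ (fun s => u * U s - A (c s))) => // s ss e e0.
have e20 : 0 < e / 2 by lra.
have [r1 r10 H1] := dU s ss _ e20; have [r2 r20 H2] := dA (c s) _ e20.
exists (Num.min r1 r2); first by rewrite lt_min r10 r20.
move=> t _; rewrite lt_min => /andP[/H1 {}H1 tr2].
have nct : nr (c t - c s) = `|t - s| by rewrite cu nrM u1 mulr1 nrR.
have {}H2 := H2 (c t); rewrite nct in H2; have {}H2 := H2 tr2.
have -> : u * U t - A (c t) - (u * U s - A (c s)) =
  u * (U t - U s - (t - s)%:C * F (c s)) - (A (c t) - A (c s) - A' (c s) * (c t - c s))
  + (t - s)%:C * u * (F (c s) - A' (c s)).
  by rewrite cu; ring.
apply: (le_trans (nr_triangle _ _)); have := nrB (u * (U t - U s - (t - s)%:C * F (c s))) (A (c t) - A (c s) - A' (c s) * (c t - c s)).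
rewrite !(nrM, u1, nrR) mul1r mulr1.
have := FA s ss; have := normr_ge0 (t - s); nra.
Qed.

Lemma cderiv_quadratic (k d q z : R[i]) :
  cderiv (fun w => k * w + d * (w - q) ^+ 2 / 2) z (k + d * (z - q)).
Proof.
move=> e e0.
exists (e / (nr d + 1)); first by rewrite divr_gt0 // ltr_wpDl // nr_ge0.
move=> w; rewrite ltr_pdivlMr ?ltr_wpDl ?nr_ge0 // => wz.
have -> : k * w + d * (w - q) ^+ 2 / 2 - (k * z + d * (z - q) ^+ 2 / 2) - (k + d * (z - q)) * (w - z)
   = d * (w - z) / 2 * (w - z) by field.
rewrite nrM ler_wpM2r ?nr_ge0 // nrM nrV !nrM.
rewrite nr_two.
have := nr_ge0 d; have := nr_ge0 (w - z); nra.
Qed.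

End goursat.

Section rectangles.
Context {R : realType} (F : R[i] -> R[i]) (xa xb ya yb : R) (p : R[i]).
Hypothesis F_cont : forall x y, xa <= x <= xb -> ya <= y <= yb -> ccont F (Complex x y).
Hypothesis F_diff : forall x y, xa <= x <= xb -> ya <= y <= yb -> Complex x y <> p ->
  exists d, cderiv F (Complex x y) d.
Hypotheses (xab : xa < xb) (yab : ya < yb).

Variables (P Q : R -> R -> R[i]).
Hypothesis dP : forall y x, ya < y < yb -> xa < x < xb -> rderiv (P y) x (F (Complex x y)).
Hypothesis dQ : forall x y, xa < x < xb -> ya < y < yb -> rderiv (Q x) y (F (Complex x y)).

(** P y and Q x are antiderivatives of F along horizontal and vertical lines, so
    this is the integral of F along the boundary of [x1, x2] x [y1, y2].  As an
    algebraic expression it is additive in the rectangle, for any order of the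
    end points. *)
Definition bdry_int x1 x2 y1 y2 : R[i] :=
  (P y1 x2 - P y1 x1) + 'i%C * (Q x2 y2 - Q x2 y1)
  - (P y2 x2 - P y2 x1) - 'i%C * (Q x1 y2 - Q x1 y1).

Let horizE (y s t : R) : Complex t y - Complex s y = (t - s)%:C * 1.
Proof. by rewrite mulr1; congr Complex; rewrite subrr. Qed.

Let vertE (x s t : R) : Complex x t - Complex x s = (t - s)%:C * 'i%C.
Proof.
apply: complex_ext => /=; ring.
Qed.

(** A function with a primitive A has boundary integral 0, so only the distance
    between F and A' counts. *)
Lemma bdry_int_estimate A A' (x1 x2 y1 y2 K : R) :
  xa < x1 -> x1 <= x2 -> x2 < xb -> ya < y1 -> y1 <= y2 -> y2 < yb ->
  (forall z, cderiv A z (A' z)) ->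
  (forall x y, x1 <= x <= x2 -> y1 <= y <= y2 -> nr (F (Complex x y) - A' (Complex x y)) <= K) ->
  nr (bdry_int x1 x2 y1 y2) <= 2 * K * ((x2 - x1) + (y2 - y1)).
Proof.
move=> ax1 x12 x2b ay1 y12 y2b dA FA.
have hx1 : xa < x1 < xb by lra. have hx2 : xa < x2 < xb by lra.
have hy1 : ya < y1 < yb by lra. have hy2 : ya < y2 < yb by lra.
have H y : y1 <= y <= y2 ->
  nr (1 * (P y x2 - P y x1) - (A (Complex x2 y) - A (Complex x1 y))) <= K * (x2 - x1).
  move=> yy; apply: (@edge_estimate _ F A A' (fun x => Complex x y)) => //.
  - by rewrite nr1.
  - by move=> s ss; apply: dP; lra.
  - by move=> s ss; apply: FA.
have V x : x1 <= x <= x2 ->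
  nr ('i%C * (Q x y2 - Q x y1) - (A (Complex x y2) - A (Complex x y1))) <= K * (y2 - y1).
  move=> xx; apply: (@edge_estimate _ F A A' (fun y => Complex x y)) => //.
  - exact: nr_i.
  - by move=> s ss; apply: dQ; lra.
  - by move=> s ss; apply: FA.
have H1 := H y1 ltac:(lra); have H2 := H y2 ltac:(lra).
have V1 := V x1 ltac:(lra); have V2 := V x2 ltac:(lra).
have -> : bdry_int x1 x2 y1 y2 =
  (1 * (P y1 x2 - P y1 x1) - (A (Complex x2 y1) - A (Complex x1 y1)))
  + ('i%C * (Q x2 y2 - Q x2 y1) - (A (Complex x2 y2) - A (Complex x2 y1)))
  - (1 * (P y2 x2 - P y2 x1) - (A (Complex x2 y2) - A (Complex x1 y2)))
  - ('i%C * (Q x1 y2 - Q x1 y1) - (A (Complex x1 y2) - A (Complex x1 y1))).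
  by rewrite /bdry_int; ring.
apply: (le_trans (nrB _ _)).
have -> : 2 * K * ((x2 - x1) + (y2 - y1)) =
   K * (x2 - x1) + K * (y2 - y1) + K * (x2 - x1) + K * (y2 - y1) by ring.
apply: lerD => //; apply: (le_trans (nrB _ _)); apply: lerD => //.
by apply: (le_trans (nr_triangle _ _)); apply: lerD.
Qed.

(** Goursat: repeatedly keep the quarter of the rectangle that carries at least
    a quarter of the boundary integral.  At the limit point F is affine up to
    an error that is small relative to the size of the rectangle. *)
Lemma goursat (x1 x2 y1 y2 : R) :
  xa < x1 -> x1 <= x2 -> x2 < xb -> ya < y1 -> y1 <= y2 -> y2 < yb ->
  (forall x y, x1 <= x <= x2 -> y1 <= y <= y2 -> Complex x y <> p) ->
  bdry_int x1 x2 y1 y2 = 0.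
Proof.
move=> ax1 x12 x2b ay1 y12 y2b np.
apply/eqP; rewrite -nr_eq0; apply/negPn/negP => E0.
set c := nr _ in E0; have c0 : 0 < c by rewrite lt_def E0 nr_ge0.
pose a n := (x2 - x1) / 2 ^+ n; pose b n := (y2 - y1) / 2 ^+ n.
have aS n : a n = a n.+1 + a n.+1 by rewrite /a exprS; field; rewrite expf_neq0.
have bS n : b n = b n.+1 + b n.+1 by rewrite /b exprS; field; rewrite expf_neq0.
have a_ge0 n : 0 <= a n by rewrite divr_ge0 ?subr_ge0 // exprn_ge0.
have b_ge0 n : 0 <= b n by rewrite divr_ge0 ?subr_ge0 // exprn_ge0.
pose big (n : nat) (v : R * R) := [/\ x1 <= v.1, v.1 + a n <= x2, y1 <= v.2, v.2 + b n <= y2 &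
  c / 4 ^+ n <= nr (bdry_int v.1 (v.1 + a n) v.2 (v.2 + b n))].
have step (nv : nat * (R * R)) : exists v' : R * R, big nv.1 nv.2 ->
   [/\ big nv.1.+1 v', nv.2.1 <= v'.1 <= nv.2.1 + a nv.1.+1 & nv.2.2 <= v'.2 <= nv.2.2 + b nv.1.+1].
  case: nv => n [x y] /=; have [bn|nb] := pselect (big n (x, y)); last by exists (x, y).
  have [/= hx1 hx2 hy1 hy2] := bn.
  rewrite aS bS in hx2 hy2 *; set h := a n.+1 in hx2 *; set k := b n.+1 in hy2 *.
  have h0 : 0 <= h := a_ge0 _. have k0 : 0 <= k := b_ge0 _.
  have -> : bdry_int x (x + (h + h)) y (y + (k + k)) =
    (bdry_int x (x + h) y (y + k) + bdry_int (x + h) (x + h + h) y (y + k)) +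
    (bdry_int x (x + h) (y + k) (y + k + k) + bdry_int (x + h) (x + h + h) (y + k) (y + k + k)).
    by rewrite /bdry_int !addrA; ring.
  set E1 := bdry_int x _ y _; set E2 := bdry_int _ _ y _; set E3 := bdry_int x _ _ _; set E4 := bdry_int _ _ _ _.
  have -> : c / 4 ^+ n = 4 * (c / 4 ^+ n.+1) by rewrite exprS; field; rewrite expf_neq0.
  move=> cE.
  have cE' : 4 * (c / 4 ^+ n.+1) <= nr E1 + nr E2 + (nr E3 + nr E4).
    apply: (le_trans cE); apply: (le_trans (nr_triangle _ _)).
    by apply: lerD; exact: nr_triangle.
  have [|e1] := leP (c / 4 ^+ n.+1) (nr E1).
    by exists (x, y) => _; split; rewrite /big /=; try split; rewrite -?/h -?/k //; lra.
  have [|e2] := leP (c / 4 ^+ n.+1) (nr E2).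
    by exists (x + h, y) => _; split; rewrite /big /=; try split; rewrite -?/h -?/k //; lra.
  have [|e3] := leP (c / 4 ^+ n.+1) (nr E3).
    by exists (x, y + k) => _; split; rewrite /big /=; try split; rewrite -?/h -?/k //; lra.
  exists (x + h, y + k) => _; split; rewrite /big /=; try split; rewrite -?/h -?/k //; try lra.
have [f fP] := choice step.
pose v := fix v n := if n is n'.+1 then f (n', v n') else (x1, y1).
have bigv n : big n (v n).
  elim: n => [|n IH]; last by have [] := fP (n, v n) IH.
  by split; rewrite /= /a /b ?expr0 ?divr1 ?subrKC.
have vS n := let: And3 _ hx hy := fP (n, v n) (bigv n) in conj hx hy.
pose X n := (v n).1; pose Y n := (v n).2.
have XS n : X n <= X n.+1 <= X n + a n.+1 := (vS n).1.
have YS n : Y n <= Y n.+1 <= Y n + b n.+1 := (vS n).2.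
have nest (Z l : nat -> R) : (forall n, l n = l n.+1 + l n.+1) -> (forall n, 0 <= l n) ->
   (forall n, Z n <= Z n.+1 <= Z n + l n.+1) -> exists s, forall n, Z n <= s <= Z n + l n.
  move=> lS l0 ZS.
  have up n k : Z n <= Z (n + k)%N.
    elim: k => [|k IH]; rewrite ?addn0 ?addnS //.
    by apply: (le_trans IH); case/andP: (ZS (n + k)%N).
  have dn n k : Z (n + k)%N + l (n + k)%N <= Z n + l n.
    elim: k => [|k IH]; rewrite ?addn0 ?addnS //.
    by apply: le_trans IH; have := lS (n + k)%N; case/andP: (ZS (n + k)%N); lra.
  have bd m n : Z m <= Z n + l n.
    have [mn|nm] := leqP m n.
      by have := up m (n - m)%N; rewrite subnKC //; have := l0 n; lra.
    by have := dn n (m - n)%N; rewrite subnKC ?(ltnW nm) //; have := l0 m; lra.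
  exists (sup (range Z)) => n; apply/andP; split.
    apply: ub_le_sup; last by exists n.
    by exists (Z 0%N + l 0%N) => _ [m _ <-].
  apply: ge_sup; first by exists (Z 0%N), 0%N.
  by move=> _ [m _ <-].
have [qx qxP] := nest X a aS a_ge0 XS; have [qy qyP] := nest Y b bS b_ge0 YS.
have a0E : a 0%N = x2 - x1 by rewrite /a expr0 divr1.
have b0E : b 0%N = y2 - y1 by rewrite /b expr0 divr1.
have qx1 : x1 <= qx <= x2 by have := qxP 0%N; rewrite a0E /X /=; lra.
have qy1 : y1 <= qy <= y2 by have := qyP 0%N; rewrite b0E /Y /=; lra.
have [||d dF] := F_diff _ _ (np qx qy qx1 qy1); try lra.
set q := Complex qx qy in dF.
set l := (x2 - x1) + (y2 - y1).
have l0 : 0 <= l by rewrite /l; lra.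
(* after n halvings the estimate is 2 e l^2 / 4^n, to be compared with c / 4^n *)
pose e := c / (2 * l ^+ 2 + 1).
have e0 : 0 < e by rewrite divr_gt0 //; nra.
have el : 2 * e * l ^+ 2 < c.
  rewrite /e; have -> : 2 * (c / (2 * l ^+ 2 + 1)) * l ^+ 2 = c * (2 * l ^+ 2) / (2 * l ^+ 2 + 1).
    by field; apply: lt0r_neq0; nra.
  by rewrite ltr_pdivrMr; nra.
have [r r0 dFr] := dF e e0.
have [n ln] : exists n, l / 2 ^+ n < r.
  exists (Num.bound (l / r)); rewrite ltr_pdivrMr ?exprn_gt0 //.
  rewrite mulrC -ltr_pdivrMr //.
  have lr0 : 0 <= l / r by rewrite divr_ge0 // ltW.
  apply: (lt_trans (archi_boundP lr0)).
  by rewrite -natrX ltr_nat ltn_expl.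
have abn : a n + b n = l / 2 ^+ n by rewrite /a /b /l; ring.
have [hx1 hx2 hy1 hy2 hE] := bigv n.
have hq x y : X n <= x <= X n + a n -> Y n <= y <= Y n + b n ->
   nr (Complex x y - q) <= l / 2 ^+ n.
  move=> xx yy; apply: (le_trans (nr_ReIm _)); rewrite -abn /=.
  by apply: lerD; rewrite ler_norml; have := qxP n; have := qyP n; lra.
have := @bdry_int_estimate _ _ (X n) (X n + a n) (Y n) (Y n + b n) (e * (l / 2 ^+ n))
  _ _ _ _ _ _ (cderiv_quadratic (F q) d q) _.
rewrite /X /Y => est.
have {}est : nr (bdry_int (v n).1 ((v n).1 + a n) (v n).2 ((v n).2 + b n)) <=
   2 * (e * (l / 2 ^+ n)) * (a n + b n).
  apply: (le_trans (est _ _ _ _ _ _ _)); try by have := a_ge0 n; have := b_ge0 n; lra.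
    move=> x y xx yy; have zq := hq x y xx yy.
    have -> : F (Complex x y) - (F q + d * (Complex x y - q)) =
       F (Complex x y) - F q - d * (Complex x y - q) by ring.
    apply: (le_trans (dFr _ (le_lt_trans zq ln))).
    by rewrite ler_wpM2l // ltW.
have := le_trans hE est; rewrite abn.
have -> : 2 * (e * (l / 2 ^+ n)) * (l / 2 ^+ n) = 2 * e * l ^+ 2 / 4 ^+ n.
  have -> : 4 ^+ n = 2 ^+ n * 2 ^+ n :> R by rewrite -exprMn; congr (_ ^+ _); ring.
  by field; rewrite expf_neq0.
by rewrite ler_pM2r ?invr_gt0 ?exprn_gt0 // leNgt el.
Qed.
Let bdry_int_swapx u1 u2 v1 v2 : bdry_int u2 u1 v1 v2 = - bdry_int u1 u2 v1 v2.
Proof. by rewrite /bdry_int; ring. Qed.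

Let bdry_int_swapy u1 u2 v1 v2 : bdry_int u1 u2 v2 v1 = - bdry_int u1 u2 v1 v2.
Proof. by rewrite /bdry_int; ring. Qed.

(** The rectangle is given by two opposite corners in any order; the sign
    condition keeps p off it. *)
Lemma goursat_signed (x1 x2 y1 y2 : R) :
  xa < x1 < xb -> xa < x2 < xb -> ya < y1 < yb -> ya < y2 < yb ->
  0 < (x1 - complex.Re p) * (x2 - complex.Re p) \/
  0 < (y1 - complex.Im p) * (y2 - complex.Im p) ->
  bdry_int x1 x2 y1 y2 = 0.
Proof.
wlog x12 : x1 x2 / x1 <= x2 => [W|] hx1 hx2 hy1 hy2 avoid.
  have [/W|/ltW/W W'] := leP x1 x2; first exact.
  by rewrite bdry_int_swapx W' ?oppr0 //; case: avoid; [left | right]; rewrite // mulrC.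
wlog y12 : y1 y2 hy1 hy2 avoid / y1 <= y2 => [W|].
  have [/W|/ltW/W W'] := leP y1 y2; first exact.
  by rewrite bdry_int_swapy W' ?oppr0 //; case: avoid; [left | right]; rewrite // mulrC.
case/andP: hx1 => ax1 x1b; case/andP: hx2 => ax2 x2b.
case/andP: hy1 => ay1 y1b; case/andP: hy2 => ay2 y2b.
apply: (goursat ax1 x12 x2b ay1 y12 y2b).
move=> x y /andP[xx xx'] /andP[yy yy'] pE; rewrite -pE /= in avoid.
case: avoid; rewrite ltNge => /negP; apply; rewrite mulr_le0_ge0 ?subr_le0 ?subr_ge0 //.
Qed.

(** F need not be differentiable at p: the boundary integral reduces to that of
    an arbitrarily small rectangle around p, which is small because F is bounded
    near p. *)
Lemma bdry_int0 (x1 x2 y1 y2 : R) :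
  xa < x1 < xb -> xa < x2 < xb -> ya < y1 < yb -> ya < y2 < yb ->
  bdry_int x1 x2 y1 y2 = 0.
Proof.
have EXX u v1 v2 : bdry_int u u v1 v2 = 0 by rewrite /bdry_int; ring.
have EYY u1 u2 v : bdry_int u1 u2 v v = 0 by rewrite /bdry_int; ring.
wlog x12 : x1 x2 / x1 <= x2 => [W|] hx1 hx2 hy1 hy2.
  have [/W|/ltW/W W'] := leP x1 x2; first exact.
  by rewrite bdry_int_swapx W' ?oppr0.
wlog y12 : y1 y2 hy1 hy2 / y1 <= y2 => [W|].
  have [/W|/ltW/W W'] := leP y1 y2; first exact.
  by rewrite bdry_int_swapy W' ?oppr0.
have gs := goursat_signed; move: gs F_cont.
case: p => px py /= gs Fc.
have [hp1|hp1] := ltP px x1; first by apply: gs => //; left; nra.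
have [hp2|hp2] := ltP x2 px; first by apply: gs => //; left; nra.
have [hp3|hp3] := ltP py y1; first by apply: gs => //; right; nra.
have [hp4|hp4] := ltP y2 py; first by apply: gs => //; right; nra.
have [||d d0 dF] := Fc px py _ _ 1 (@ltr01 R); [lra|lra|].
set K := nr (F (Complex px py)) + 1.
have K0 : 0 < K by rewrite /K ltr_wpDl ?nr_ge0.
apply: nr_sub_eq0 => e0 e0_gt0; rewrite subr0.
pose e := Num.min (d / 3) (e0 / (8 * K)).
have e_gt0 : 0 < e by rewrite lt_min !divr_gt0 //; lra.
have ed : e <= d / 3 by rewrite ge_min lexx.
have ee : 8 * K * e <= e0.
  rewrite mulrC -ler_pdivlMr ?mulr_gt0 //; first by rewrite ge_min lexx orbT.
clearbody e.
(* the part of an interval within e of v, together with the reason why each end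
   point is where it is *)
have cl (u1 u2 v : R) : u1 <= v <= u2 -> exists u1' u2',
   [/\ u1 <= u1' <= v, v <= u2' <= u2, v - e <= u1', u2' <= v + e &
       (u1' = u1 \/ u1' = v - e) /\ (u2' = u2 \/ u2' = v + e)].
  move=> vv; exists (Num.max u1 (v - e)), (Num.min u2 (v + e)).
  by case: (leP u1 (v - e)) => h1; case: (leP u2 (v + e)) => h2; split; try lra; split; auto.
have [|u1 [u2 [hu1 hu2 hu3 hu4 [hu5 hu6]]]] := cl x1 x2 px; first lra.
have [|v1 [v2 [hv1 hv2 hv3 hv4 [hv5 hv6]]]] := cl y1 y2 py; first lra.
have -> : bdry_int x1 x2 y1 y2 = bdry_int x1 u1 y1 y2 + bdry_int u2 x2 y1 y2
   + (bdry_int u1 u2 y1 v1 + bdry_int u1 u2 v2 y2) + bdry_int u1 u2 v1 v2.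
  by rewrite /bdry_int; ring.
have -> : bdry_int x1 u1 y1 y2 = 0.
  case: hu5 => hu; [by rewrite hu EXX | have [hh|hh] := eqVneq x1 u1;
    [by rewrite hh EXX | apply: gs; try lra; left]];
    have : x1 < u1 by rewrite lt_neqAle hh; case/andP: hu1.
  by nra.
have -> : bdry_int u2 x2 y1 y2 = 0.
  by case: hu6 => hu; [rewrite hu EXX | apply: gs; try lra; left; nra].
have -> : bdry_int u1 u2 y1 v1 = 0.
  by case: hv5 => hu; [rewrite hu EYY | apply: gs; try lra; right; nra].
have -> : bdry_int u1 u2 v2 y2 = 0.
  by case: hv6 => hu; [rewrite hu EYY | apply: gs; try lra; right; nra].
rewrite !add0r.
have est : nr (bdry_int u1 u2 v1 v2) <= 2 * K * ((u2 - u1) + (v2 - v1)).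
  apply: (bdry_int_estimate _ _ _ _ _ _ (fun z => cderiv_cst z 0)); [lra|lra|lra|lra|lra|lra|].
  move=> x y xx yy; rewrite subr0.
  have pd : nr (Complex x y - Complex px py) < d.
    apply: (le_lt_trans (nr_ReIm _)) => /=.
    have hx : `|x - px| <= e by rewrite ler_norml; lra.
    have hy : `|y - py| <= e by rewrite ler_norml; lra.
    lra.
  have := nr_triangle (F (Complex x y) - F (Complex px py)) (F (Complex px py)).
  rewrite subrK /K => /le_trans; apply; rewrite addrC lerD2l; exact: dF.
apply: (le_trans est); have K20 : 0 <= 2 * K by lra.
apply: le_trans ee; have -> : 8 * K * e = 2 * K * (4 * e) by ring.
by rewrite ler_wpM2l //; lra.
Qed.

Lemma edge_estimate_signed (k : R[i]) (c : R -> R[i]) (u : R[i]) (U : R -> R[i])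
    (s1 s2 K : R) :
  (forall s t, c t - c s = (t - s)%:C * u) -> nr u = 1 ->
  (forall s, `|s - s1| <= `|s2 - s1| -> rderiv U s (F (c s))) ->
  (forall s, `|s - s1| <= `|s2 - s1| -> nr (F (c s) - k) <= K) ->
  nr (u * (U s2 - U s1) - k * (c s2 - c s1)) <= K * `|s2 - s1|.
Proof.
move=> cu u1 dU FK.
have dA z : cderiv (fun w => k * w + 0 * (w - 0) ^+ 2 / 2) z k.
  by have := cderiv_quadratic k 0 0 z; rewrite !mul0r addr0.
have [s12|/ltW s21] := leP s1 s2.
  have := @edge_estimate _ F _ _ c u U s1 s2 K cu u1 s12 _ dA _.
  rewrite !mul0r !addr0 ger0_norm ?subr_ge0 // mulrBr => H.
  by rewrite mulrBr; apply: H => s ss; [apply: dU | apply: FK]; rewrite ![`|_|]ger0_norm ?subr_ge0; lra.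
have := @edge_estimate _ F _ _ c u U s2 s1 K cu u1 s21 _ dA _.
rewrite !mul0r !addr0 [`|s2 - s1|]distrC ger0_norm ?subr_ge0 // => H.
rewrite -nrN; have -> : - (u * (U s2 - U s1) - k * (c s2 - c s1)) =
   u * (U s1 - U s2) - (k * c s1 - k * c s2) by ring.
by apply: H => s ss; [apply: dU | apply: FK]; rewrite distrC [`|s2 - s1|]distrC ![`|_|]ger0_norm ?subr_ge0; lra.
Qed.

(** The primitive at z is the integral from the centre, first horizontally and
    then vertically.  Since boundary integrals vanish, its increment near z is
    the integral along two short edges at z, where F is nearly constant. *)
Lemma primitive_rectangle : exists Phi : R[i] -> R[i],
  forall x y, xa < x < xb -> ya < y < yb -> cderiv Phi (Complex x y) (F (Complex x y)).
Proof.
pose x0 := (xa + xb) / 2; pose y0 := (ya + yb) / 2.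
have hx0 : xa < x0 < xb by rewrite !midf_lt.
have hy0 : ya < y0 < yb by rewrite !midf_lt.
clearbody x0 y0.
exists (fun z => P y0 (complex.Re z) - P y0 x0 +
   'i%C * (Q (complex.Re z) (complex.Im z) - Q (complex.Re z) y0)) => x y hx hy e e0.
have e20 : 0 < e / 2 by lra.
have [||d d0 dF] := @F_cont x y _ _ _ e20; [lra|lra|].
pose r := Num.min (d / 3) (Num.min (Num.min (x - xa) (xb - x)) (Num.min (y - ya) (yb - y))).
have r0 : 0 < r by rewrite !lt_min; lra.
have [rd rx1 rx2 ry1 ry2] : [/\ r <= d / 3, r <= x - xa, r <= xb - x, r <= y - ya & r <= yb - y].
  by split; rewrite !ge_min lexx ?orbT.
clearbody r; exists r => // -[x' y'] zr /=.
have := nr_Re (Complex x' y' - Complex x y); have := nr_Im (Complex x' y' - Complex x y).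
set N := nr _ in zr *; rewrite /= => yN xN.
have Ez := @bdry_int0 x x' y0 y hx ltac:(move: xN; rewrite ler_norml; lra) hy0 hy.
have close u v : `|u - x| <= `|x' - x| -> `|v - y| <= `|y' - y| ->
   nr (F (Complex u v) - F (Complex x y)) <= e / 2.
  move=> hu hv; apply: dF; apply: (le_lt_trans (nr_ReIm _)) => /=; lra.
have H1 := @edge_estimate_signed (F (Complex x y)) (fun x => Complex x y) 1 (P y) x x' (e / 2)
  (horizE y) (nr1) _ _.
have H2 := @edge_estimate_signed (F (Complex x y)) (fun y => Complex x' y) 'i%C (Q x') y y' (e / 2)
  (vertE x') (nr_i) _ _.
have {}H1 : nr (1 * (P y x' - P y x) - F (Complex x y) * (Complex x' y - Complex x y)) <= e / 2 * `|x' - x|.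
  apply: H1 => s ss; first by apply: dP => //; move: ss; rewrite ler_norml; lra.
  by apply: close => //; rewrite subrr normr0.
have {}H2 : nr ('i%C * (Q x' y' - Q x' y) - F (Complex x y) * (Complex x' y' - Complex x' y)) <= e / 2 * `|y' - y|.
  apply: H2 => s ss; last by apply: close.
  apply: dQ; last by move: ss; rewrite ler_norml; lra.
  by move: xN; rewrite ler_norml; lra.
have -> : P y0 x' - P y0 x0 + 'i%C * (Q x' y' - Q x' y0) - (P y0 x - P y0 x0 + 'i%C * (Q x y - Q x y0))
   - F (Complex x y) * (Complex x' y' - Complex x y) =
  (1 * (P y x' - P y x) - F (Complex x y) * (Complex x' y - Complex x y)) +
  ('i%C * (Q x' y' - Q x' y) - F (Complex x y) * (Complex x' y' - Complex x' y)) + bdry_int x x' y0 y.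
  by rewrite /bdry_int; ring.
rewrite Ez addr0; apply: (le_trans (nr_triangle _ _)); nra.
Qed.

End rectangles.

Section local_primitives.
Context {R : realType}.
Implicit Types (F Phi : R[i] -> R[i]) (a b c z w : R[i]) (r : R).

(** Squares are as good as discs for local statements, and the cells of a
    lattice are squares. *)
Definition sq a r : set R[i] := [set z |
  `|complex.Re z - complex.Re a| < r /\ `|complex.Im z - complex.Im a| < r].

Definition primitive_on (D : set R[i]) F Phi : Prop :=
  forall z, D z -> cderiv Phi z (F z).

(** The exceptional point makes room for difference quotients. *)
Definition almost_holomorphic (D : set R[i]) p F : Prop :=
  (forall z, D z -> ccont F z) /\
  (forall z, D z -> z <> p -> exists d, cderiv F z d).

Lemma sq_nr a r z : nr (z - a) < r -> sq a r z.
Proof.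
by move=> za; split; rewrite -raddfB /=; [apply: le_lt_trans (nr_Re _) za | apply: le_lt_trans (nr_Im _) za].
Qed.

Lemma nr_sq a r z : sq a r z -> nr (z - a) < 2 * r.
Proof.
by move=> [h1 h2]; apply: (le_lt_trans (nr_ReIm _)); rewrite !raddfB /=; lra.
Qed.

Lemma sq_center a r : 0 < r -> sq a r a.
Proof. by move=> r0; split; rewrite subrr normr0. Qed.

Lemma sub_sq a r r' : r <= r' -> sq a r `<=` sq a r'.
Proof. by move=> rr z [h1 h2]; split; lra. Qed.

Lemma primitive_sq F a r r' p : 0 < r -> r < r' ->
  almost_holomorphic (sq a r') p F -> exists Phi, primitive_on (sq a r) F Phi.
Proof.
move=> r0 rr [Fc Fd]; case: a Fc Fd => ax ay Fc Fd.
pose xa := ax - r; pose xb := ax + r; pose ya := ay - r; pose yb := ay + r.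
have xab : xa < xb by rewrite /xa /xb; lra.
have yab : ya < yb by rewrite /ya /yb; lra.
have insq x y : xa <= x <= xb -> ya <= y <= yb -> sq (Complex ax ay) r' (Complex x y).
  by move=> xx yy; split => /=; rewrite ltr_norml; move: xx yy; rewrite /xa /xb /ya /yb; lra.
have {}Fc x y : xa <= x <= xb -> ya <= y <= yb -> ccont F (Complex x y).
  by move=> xx yy; apply/Fc/insq.
have {}Fd x y : xa <= x <= xb -> ya <= y <= yb -> Complex x y <> p ->
    exists d, cderiv F (Complex x y) d.
  by move=> xx yy; apply/Fd/insq.
have HP y : exists P : R -> R[i], ya < y < yb ->
    forall x, xa < x < xb -> rderiv P x (F (Complex x y)).
  have [yy|ny] := boolP (ya < y < yb); last by exists (fun _ => 0).
  have [|P HP] := @antiderivative _ (fun x => F (Complex x y)) xa xb xab.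
    move=> x xx e e0; have [|d d0 Hd] := Fc x y xx _ e e0; first lra.
    exists d => // x' x'd; apply: Hd.
    have -> : Complex x' y - Complex x y = (x' - x)%:C by congr Complex; rewrite subrr.
    by rewrite nrR.
  by exists P => _ x xx e e0; apply: HP.
have HQ x : exists Q : R -> R[i], xa < x < xb ->
    forall y, ya < y < yb -> rderiv Q y (F (Complex x y)).
  have [xx|nx] := boolP (xa < x < xb); last by exists (fun _ => 0).
  have [|Q HQ] := @antiderivative _ (fun y => F (Complex x y)) ya yb yab.
    move=> y yy e e0; have [|d d0 Hd] := Fc x y _ yy e e0; first lra.
    exists d => // y' y'd; apply: Hd; apply: (le_lt_trans (nr_ReIm _)) => /=.
    by rewrite subrr normr0 add0r.
  by exists Q => _ y yy e e0; apply: HQ.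
have [P PP] := choice HP; have [Q QQ] := choice HQ.
have [Phi HPhi] := @primitive_rectangle _ F xa xb ya yb p Fc Fd xab yab P Q
  (fun y x yy xx => PP y yy x xx) (fun x y xx yy => QQ x xx y yy).
exists Phi => -[x y] [/= hx hy]; apply: HPhi; move: hx hy; rewrite !ltr_norml /xa /xb /ya /yb; lra.
Qed.

Lemma segment_mean_value F Phi k z w (K : R) :
  (forall s : R, 0 <= s <= 1 -> cderiv Phi (z + s%:C * (w - z)) (F (z + s%:C * (w - z)))) ->
  (forall s : R, 0 <= s <= 1 -> nr (F (z + s%:C * (w - z)) - k) <= K) ->
  nr (Phi w - Phi z - k * (w - z)) <= K * nr (w - z).
Proof.
move=> dPhi FK; set u := w - z.
pose c s := z + s%:C * u : R[i].
have cB s t : c t - c s = (t - s)%:C * u by rewrite /c rmorphB /=; ring.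
have c1 : c 1 = w by rewrite /c mul1r /u addrC subrK.
have c0 : c 0 = z by rewrite /c mul0r addr0.
have -> : Phi w - Phi z - k * u = (Phi (c 1) - k * c 1) - (Phi (c 0) - k * c 0).
  by rewrite c1 c0 /u; ring.
have -> : K * nr u = K * nr u * (1 - 0) by rewrite subr0 mulr1.
apply: (@mean_value_ineq _ _ (fun s => Phi (c s) - k * c s)) => // s ss e e0.
have e'0 : 0 < e / (nr u + 1) by rewrite divr_gt0 // ltr_wpDl ?nr_ge0.
have [d d0 Hd] := dPhi s ss _ e'0.
have u1 : 0 < nr u + 1 by rewrite ltr_wpDl ?nr_ge0.
exists (d / (nr u + 1)); first by rewrite divr_gt0.
move=> t _; rewrite ltr_pdivlMr // => ts.
have nct : nr (c t - c s) = `|t - s| * nr u by rewrite cB nrM nrR.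
have {}Hd := Hd (c t); rewrite -/u -/(c s) nct in Hd.
have {}Hd := Hd ltac:(have := normr_ge0 (t - s); nra).
have -> : Phi (c t) - k * c t - (Phi (c s) - k * c s) =
  (Phi (c t) - Phi (c s) - F (c s) * (c t - c s)) + (F (c s) - k) * (c t - c s) by ring.
apply: (le_trans (nr_triangle _ _)); rewrite nrM nct.
have hK := FK s ss; rewrite -/u -/(c s) in hK.
have eu : e / (nr u + 1) * nr u <= e.
  by rewrite -mulrA ger_pMr // mulrC ler_pdivrMr // mul1r; lra.
have h1 : e / (nr u + 1) * (`|t - s| * nr u) <= `|t - s| * e.
  by rewrite mulrCA ler_wpM2l.
have h2 : nr (F (c s) - k) * (`|t - s| * nr u) <= K * (`|t - s| * nr u).
  by rewrite ler_wpM2r // mulr_ge0 ?nr_ge0.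
apply: (le_trans (lerD (le_trans Hd h1) h2)).
by apply: eq_leW; ring.
Qed.

Lemma cderivB F1 F2 z d1 d2 :
  cderiv F1 z d1 -> cderiv F2 z d2 -> cderiv (fun w => F1 w - F2 w) z (d1 - d2).
Proof.
move=> H1 H2 e e0; have e20 : 0 < e / 2 by lra.
have [r1 r10 {}H1] := H1 _ e20; have [r2 r20 {}H2] := H2 _ e20.
exists (Num.min r1 r2); first by rewrite lt_min r10 r20.
move=> w; rewrite lt_min => /andP[/H1 {}H1 /H2 {}H2].
have -> : F1 w - F2 w - (F1 z - F2 z) - (d1 - d2) * (w - z) =
  (F1 w - F1 z - d1 * (w - z)) - (F2 w - F2 z - d2 * (w - z)) by ring.
apply: (le_trans (nrB _ _)); lra.
Qed.

Lemma sq_convex a r z w (s : R) : sq a r z -> sq a r w -> 0 <= s <= 1 ->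
  sq a r (z + s%:C * (w - z)).
Proof.
have conv (u v : R) : u < r -> v < r -> 0 <= s <= 1 -> u + s * (v - u) < r.
  move=> ur vr /andP[s0]; rewrite le_eqVlt => /orP[/eqP->|s1]; first by rewrite mul1r addrC subrK.
  by nra.
case: a z w => [ax ay] [zx zy] [wx wy] [/= h1 h2] [/= h3 h4] ss.
move: h1 h2 h3 h4; rewrite !ltr_norml => /andP[h1 h1'] /andP[h2 h2'] /andP[h3 h3'] /andP[h4 h4'].
split => /=; rewrite mul0r ?subr0 ?addr0 ltr_norml.
  have := conv (zx - ax) (wx - ax) h1' h3' ss.
  have := conv (ax - zx) (ax - wx) ltac:(lra) ltac:(lra) ss; lra.
have := conv (zy - ay) (wy - ay) h2' h4' ss.
have := conv (ay - zy) (ay - wy) ltac:(lra) ltac:(lra) ss; lra.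
Qed.

(** The increment from a to b of a primitive of F on a square that contains both
    points: the integral of F from a to b along any path in the square. *)
Definition pint F a b : R[i] := xget 0 [set y | exists c r Phi,
  [/\ sq c r a, sq c r b, primitive_on (sq c r) F Phi & y = Phi b - Phi a]].

(** Two such squares meet in a convex set that contains a and b, on which the
    difference of the primitives is constant. *)
Lemma pintE F c r Phi a b : primitive_on (sq c r) F Phi ->
  sq c r a -> sq c r b -> pint F a b = Phi b - Phi a.
Proof.
move=> pPhi ca cb; rewrite /pint; case: xgetP => [y _ /= [c' [r' [Psi [ca' cb' pPsi ->]]]]|/(_ (Phi b - Phi a))[]]; last first.
  by exists c, r, Phi.
apply/eqP; rewrite -subr_eq0 -nr_eq0 eq_le nr_ge0 andbT.
have -> : Psi b - Psi a - (Phi b - Phi a) = (Psi b - Phi b) - (Psi a - Phi a) - 0 * (b - a) by ring.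
rewrite -[leRHS](mul0r (nr (b - a))).
apply: (@segment_mean_value (fun _ => 0) (fun z => Psi z - Phi z)) => s ss; last by rewrite subrr nr0.
have := cderivB (pPsi _ (sq_convex ca' cb' ss)) (pPhi _ (sq_convex ca cb ss)).
by rewrite subrr.
Qed.

End local_primitives.

(** * Riemann-Stieltjes sums and contour integrals *)

Section riemann_stieltjes.
Context {R : realType}.

Definition dominates_variation (v : R -> R) (g : R -> R[i]) : Prop :=
  forall a b, 0 <= a -> a <= b -> b <= 1 -> nr (g b - g a) <= v b - v a.

(** The sum of the variations of the real and imaginary parts: a monotone
    function of this kind turns estimates along subdivisions into telescoping
    sums. *)
Lemma rectifiable_variation (g : R -> R[i]) : rectifiable g ->
  exists v, dominates_variation v g.
Proof.
move=> [L gL].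
have bv (f : R -> R) : (forall s t, `|f s - f t| <= nr (g s - g t)) -> bounded_variation 0 1 f.
  move=> fg; exists L => _ [s sp <-]; rewrite -lecR; apply: le_trans (gL s sp).
  rewrite /variation rmorph_sum /=; apply: ler_sum => k _.
  by rewrite nrE lecR fg.
have tv (f : R -> R) : bounded_variation 0 1 f ->
  exists w : R -> R, forall a b, 0 <= a -> a <= b -> b <= 1 -> `|f b - f a| <= w b - w a.
  move=> bf; exists (fun t => fine (total_variation 0 t f)) => a b a0 ab b1.
  have b0 := le_trans a0 ab; have a1 := le_trans ab b1.
  have fa : total_variation 0 a f \is a fin_num.
    by apply/bounded_variationP => //; apply: bounded_variationl bf.
  have fab : total_variation a b f \is a fin_num.
    apply/bounded_variationP => //; apply: (bounded_variationl ab b1).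
    exact: bounded_variationr bf.
  rewrite (total_variationD f a0 ab) fineD // [fine _ + _]addrC addrK.
  by rewrite -lee_fin fineK //; apply: total_variation_ge.
have [|w1 w1P] := tv (fun t => complex.Re (g t)); first by apply: bv => s t; rewrite -raddfB nr_Re.
have [|w2 w2P] := tv (fun t => complex.Im (g t)); first by apply: bv => s t; rewrite -raddfB nr_Im.
exists (fun t => w1 t + w2 t) => a b a0 ab b1.
apply: (le_trans (nr_ReIm _)); rewrite !raddfB /=.
have := w1P a b a0 ab b1; have := w2P a b a0 ab b1; lra.
Qed.

Definition rsum (V : normedModType R[i]) (g : R -> R[i]) (H : R -> V) n (x tag : nat -> R) : V :=
  \sum_(0 <= k < n) (g (x k.+1) - g (x k)) *: H (tag k).

Definition tagged n (x tag : nat -> R) (d : R) : Prop :=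
  [/\ x 0%N = 0, x n = 1 & forall k, (k < n)%N ->
   [/\ x k <= x k.+1, x k.+1 - x k < d & x k <= tag k <= x k.+1]].

Lemma tagged_bounds n x tag d k : tagged n x tag d -> (k <= n)%N -> 0 <= x k <= 1.
Proof.
move=> [x0 xn xS] kn; apply/andP; split.
  elim: k kn => [|k IH] kn; first by rewrite x0.
  by apply: (le_trans (IH (ltnW kn))); have [] := xS k kn.
have : forall m, (m <= n)%N -> x (n - m)%N <= 1.
  elim=> [|m IH] mn; first by rewrite subn0 xn.
  have h : (n - m.+1 < n)%N by rewrite ltn_subrL (leq_trans _ mn).
  have [h1 _ _] := xS _ h; apply: (le_trans h1).
  by rewrite -subSn // subSS IH // ltnW.
by move=> /(_ (n - k)%N (leq_subr _ _)); rewrite subKn.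
Qed.

Definition clamp (a b t : R) : R := Num.max a (Num.min b t).

Lemma clamp_overlap a b c d : a <= b -> c <= d ->
  (clamp a b d = clamp a b c /\ clamp c d b = clamp c d a) \/
  [/\ clamp a b d = clamp c d b, clamp a b c = clamp c d a, c <= b & a <= d].
Proof.
move=> ab cd; rewrite /clamp.
have /orP[bc|cb] := le_total b c.
  left; rewrite (min_l (le_trans bc cd)) (min_l bc) (min_r (le_trans bc cd)).
  by rewrite (min_r (le_trans ab (le_trans bc cd))) (max_l bc) (max_l (le_trans ab bc)).
have /orP[da|ad] := le_total d a.
  left; rewrite (min_r (le_trans da ab)) (min_r cb) (min_l da) (min_l (le_trans da ab)).
  by rewrite (max_l da) (max_l (le_trans cd da)).
right; split => //; last by rewrite (min_r cb) (min_r ad) maxC.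
by rewrite [Num.min d b]minC !max_r // le_min ?ab ?cb ?ad ?cd.
Qed.

Lemma clamp_mono a b s t : s <= t -> clamp a b s <= clamp a b t.
Proof.
move=> st; rewrite /clamp ge_max !le_max lexx /=; apply/orP; right.
by rewrite le_min !ge_min lexx /= st orbT.
Qed.

Lemma clamp_l a b t : a <= b -> t <= a -> clamp a b t = a.
Proof. by move=> ab ta; rewrite /clamp (min_r (le_trans ta ab)) max_l. Qed.

Lemma clamp_r a b t : a <= b -> b <= t -> clamp a b t = b.
Proof. by move=> ab bt; rewrite /clamp min_l // max_r. Qed.

Lemma clamp_itv a b t : a <= b -> a <= clamp a b t <= b.
Proof. by move=> ab; rewrite /clamp le_max lexx /= ge_max ab ge_min lexx. Qed.

(** Two Riemann-Stieltjes sums are compared on the common refinement, whose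
    increments are indexed by pairs of intervals: the increment of g over the
    intersection of two intervals is a difference of clamped end points. *)
Lemma rsum_compare (V : normedModType R[i]) (g : R -> R[i]) v (H : R -> V)
    n x tag d n' x' tag' d' (e : R) :
  dominates_variation v g ->
  tagged n x tag d -> tagged n' x' tag' d' -> 0 <= e ->
  (forall s t, 0 <= s <= 1 -> 0 <= t <= 1 -> `|s - t| < d + d' -> nr (H s - H t) <= e) ->
  nr (rsum g H n x tag - rsum g H n' x' tag') <= e * (v 1 - v 0).
Proof.
move=> gv T T' e0 He.
have bx k := @tagged_bounds _ _ _ _ k T; have bx' k := @tagged_bounds _ _ _ _ k T'.
move: (T) (T') => [x0 xn xS] [x'0 x'n x'S].
pose p k l := clamp (x k) (x k.+1) (x' l); pose q l k := clamp (x' l) (x' l.+1) (x k).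
have sumD (W : zmodType) (h : R -> W) k : (k < n)%N ->
   \sum_(0 <= l < n') (h (p k l.+1) - h (p k l)) = h (x k.+1) - h (x k).
  move=> kn; have [xk _ _] := xS k kn.
  rewrite telescope_sumr // /p x'n x'0 clamp_r ?clamp_l //.
    by have /andP[] := bx k (ltnW kn).
  by have /andP[] := bx k.+1 kn.
have sumD' (W : zmodType) (h : R -> W) l : (l < n')%N ->
   \sum_(0 <= k < n) (h (q l k.+1) - h (q l k)) = h (x' l.+1) - h (x' l).
  move=> ln; have [xl _ _] := x'S l ln.
  rewrite telescope_sumr // /q xn x0 clamp_r ?clamp_l //.
    by have /andP[] := bx' l (ltnW ln).
  by have /andP[] := bx' l.+1 ln.
have pq k l : (k < n)%N -> (l < n')%N ->
  (p k l.+1 = p k l /\ q l k.+1 = q l k) \/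
  [/\ p k l.+1 = q l k.+1, p k l = q l k, x' l <= x k.+1 & x k <= x' l.+1].
  by move=> kn ln; have [xk _ _] := xS k kn; have [xl _ _] := x'S l ln; apply: clamp_overlap.
have -> : rsum g H n x tag - rsum g H n' x' tag' =
  \sum_(0 <= k < n) \sum_(0 <= l < n') (g (p k l.+1) - g (p k l)) *: (H (tag k) - H (tag' l)).
  have -> : rsum g H n x tag = \sum_(0 <= k < n) \sum_(0 <= l < n') (g (p k l.+1) - g (p k l)) *: H (tag k).
    by apply: eq_big_nat => k kn; rewrite -scaler_suml sumD.
  have -> : rsum g H n' x' tag' = \sum_(0 <= k < n) \sum_(0 <= l < n') (g (p k l.+1) - g (p k l)) *: H (tag' l).
    rewrite exchange_big_nat /=; apply: eq_big_nat => l ln.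
    rewrite -sumD' // scaler_suml; apply: eq_big_nat => k kn.
    by have [[-> ->]|[-> -> _ _]] := pq k l kn ln; rewrite ?subrr.
  rewrite -sumrB; apply: eq_bigr => k _; rewrite -sumrB; apply: eq_bigr => l _.
  by rewrite scalerBr.
apply: (le_trans (nr_sum _ _)).
have -> : e * (v 1 - v 0) = \sum_(0 <= k < n) e * (v (x k.+1) - v (x k)).
  by rewrite -mulr_sumr (telescope_sumr (fun k => v (x k))) // xn x0.
rewrite big_nat [leRHS]big_nat; apply: ler_sum => k /= kn.
apply: (le_trans (nr_sum _ _)); rewrite -sumD // mulr_sumr.
rewrite big_nat [leRHS]big_nat; apply: ler_sum => l /= ln.
rewrite nrZ mulrC.
have [xk xkd tk] := xS k kn; have [xl xld tl] := x'S l ln.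
have [[-> _]|[_ _ h1 h2]] := pq k l kn ln; first by rewrite !subrr nr0 !mulr0.
have bk := bx _ kn; have bk' := bx _ (ltnW kn).
have bl := bx' _ ln; have bl' := bx' _ (ltnW ln).
have pitv j : 0 <= p k j <= 1.
  by have /andP[h3 h4] := clamp_itv (x' j) xk; rewrite /p; apply/andP; split; lra.
have pm : p k l <= p k l.+1 by apply: clamp_mono.
apply: ler_pM; rewrite ?nr_ge0 //.
  by apply: He; rewrite ?ltr_norml; lra.
by apply: gv => //; [case/andP: (pitv l) | case/andP: (pitv l.+1)].
Qed.

Definition unif (n : nat) (k : nat) : R := k%:R / n.+1%:R.

Lemma unif_tagged n (d : R) : n.+1%:R^-1 < d -> tagged n.+1 (unif n) (unif n) d.
Proof.
move=> nd; have n0 : (0 : R) < n.+1%:R by rewrite ltr0n.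
split; rewrite /unif ?mul0r ?divff ?gt_eqF // => k kn.
have le : k%:R / n.+1%:R <= k.+1%:R / n.+1%:R :> R by rewrite ler_pM2r ?invr_gt0 // ler_nat.
by split; rewrite ?lexx // -mulrBl -natrB // subSnn mul1r.
Qed.

Lemma unifS n k : unif n k.+1 - unif n k = n.+1%:R^-1.
Proof. by rewrite /unif -mulrBl -natrB // subSnn mul1r. Qed.

Lemma inv_lt (d : R) : 0 < d -> exists N, forall n, (N <= n)%N -> n.+1%:R^-1 < d.
Proof.
move=> d0; exists (Num.bound d^-1) => n Nn.
rewrite invf_plt ?posrE ?ltr0n //; apply: (lt_le_trans (archi_boundP _)); first by rewrite invr_ge0 ltW.
by rewrite ler_nat leqW.
Qed.

(** Completeness in the form in which integrals use it; it holds for the scalar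
    field as well as for a Banach space, and both occur as values of integrands. *)
Definition seq_complete (V : normedModType R[i]) : Prop := forall u : nat -> V,
  (forall e : R, 0 < e -> exists N, forall m n, (N <= m)%N -> (N <= n)%N -> nr (u m - u n) <= e) ->
  exists y, forall e : R, 0 < e -> exists N, forall n, (N <= n)%N -> nr (u n - y) <= e.

Lemma seq_complete_banach (V : completeNormedModType R[i]) : seq_complete V.
Proof.
move=> u cu.
have pos (e : R[i]) : 0 < e -> exists2 r : R, 0 < r & r%:C = e.
  by case: e => a b; rewrite ltcE /= => /andP[/eqP b0 a0]; exists a; rewrite ?b0.
have : cvg (u @ \oo).
  apply: cauchy_cvg; apply/cauchy_exP => e /pos[r r0 <-].
  have [N uN] := cu (r / 2) ltac:(lra); exists (u N); exists N => // n /= Nn.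
  rewrite -ball_normE /ball_ /= nr_lt; apply: le_lt_trans (uN _ _ (leqnn N) Nn) _; lra.
move=> /cvg_ex[y /cvgrPdist_le uy]; exists y => e e0.
have [|N _ HN] := uy e%:C; first by rewrite ltcR.
by exists N => n Nn; rewrite nr_sym -nr_le; apply: HN.
Qed.

Lemma seq_complete_complex : seq_complete R[i].
Proof.
move=> u cu.
have cR (f : R[i] -> R) : (forall z w, `|f z - f w| <= nr (z - w)) ->
    exists y, forall e : R, 0 < e -> exists N, forall n, (N <= n)%N -> `|f (u n) - y| <= e.
  move=> fl; have : cvg ((fun n => f (u n)) @ \oo).
    apply: cauchy_cvg; apply/cauchy_exP => e e0.
    have [N uN] := cu (e / 2) ltac:(lra); exists (f (u N)); exists N => // n /= Nn.
    rewrite /ball /=; apply: (le_lt_trans (fl _ _)).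
    apply: le_lt_trans (uN _ _ (leqnn N) Nn) _; lra.
  move=> /cvg_ex[y /cvgrPdist_le uy]; exists y => e e0.
  by have [N _ HN] := uy e e0; exists N => n Nn; rewrite distrC; apply: HN.
have [|a Ha] := cR (@complex.Re R); first by move=> z w; rewrite -raddfB nr_Re.
have [|b Hb] := cR (@complex.Im R); first by move=> z w; rewrite -raddfB nr_Im.
exists (Complex a b) => e e0; have e20 : 0 < e / 2 by lra.
have [N1 H1] := Ha _ e20; have [N2 H2] := Hb _ e20; exists (maxn N1 N2) => n.
rewrite geq_max => /andP[/H1 {}H1 /H2 {}H2].
by apply: (le_trans (nr_ReIm _)); move: H1 H2; case: (u n) => p q /=; lra.
Qed.

Lemma limit_le (V : normedModType R[i]) (u : nat -> V) y z (K : R) :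
  (forall e : R, 0 < e -> exists N, forall n, (N <= n)%N -> nr (u n - y) <= e) ->
  (exists N, forall n, (N <= n)%N -> nr (z - u n) <= K) -> nr (z - y) <= K.
Proof.
move=> uy [N1 H1]; apply/ler_addgt0Pr => e e0; have [N2 H2] := uy e e0.
have := nr_dist (u (maxn N1 N2)) z y.
have := H1 _ (leq_maxl N1 N2); have := H2 _ (leq_maxr N1 N2); lra.
Qed.

Definition icont (V : normedModType R[i]) (H : R -> V) : Prop :=
  forall x, 0 <= x <= 1 -> forall e : R, 0 < e -> exists2 d : R, 0 < d &
    forall y, 0 <= y <= 1 -> `|y - x| < d -> nr (H y - H x) <= e.

Lemma icont_unif (V : normedModType R[i]) (H : R -> V) : icont H ->
  forall e : R, 0 < e -> exists2 d : R, 0 < d &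
    forall s t, 0 <= s <= 1 -> 0 <= t <= 1 -> `|s - t| < d -> nr (H s - H t) <= e.
Proof.
move=> cH e e0; apply: lebesgue_number => // x xx.
have e20 : 0 < e / 2 by lra.
have [d d0 Hd] := cH x xx _ e20; exists d => // s t ss tt sx tx.
have := nr_dist (H x) (H s) (H t); have := Hd _ ss sx.
have := Hd _ tt tx; rewrite [nr (H t - _)]nr_sym; lra.
Qed.

Lemma icont_bounded (V : normedModType R[i]) (H : R -> V) : icont H ->
  exists2 K : R, 0 < K & forall s, 0 <= s <= 1 -> nr (H s) <= K.
Proof.
move=> cH; have [K HK] : exists K, forall s, 0 <= s <= 1 -> nr (H s) <= K.
  apply: locally_bounded_bounded => // s ss; have [d d0 Hd] := cH s ss 1 ltr01.
  exists d => //; exists (nr (H s) + 1) => t tt ts.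
  have := Hd t tt ts; have := nr_triangle (H t - H s) (H s); rewrite subrK; lra.
exists (`|K| + 1); first by rewrite ltr_wpDl.
by move=> s /HK; have := ler_norm K; lra.
Qed.

(** The limit comes with an explicit error bound, which depends on the integrand
    only through a modulus of continuity. *)
Lemma riemann_stieltjes (V : normedModType R[i]) (Vc : seq_complete V) (g : R -> R[i]) v (H : R -> V) :
  dominates_variation v g -> icont H ->
  exists y, forall e d : R, 0 <= e -> 0 < d ->
    (forall s t, 0 <= s <= 1 -> 0 <= t <= 1 -> `|s - t| < d -> nr (H s - H t) <= e) ->
    forall n x tag, tagged n x tag (d / 2) -> nr (rsum g H n x tag - y) <= e * (v 1 - v 0).
Proof.
move=> gv cH.
have v01 : 0 <= v 1 - v 0 by apply: le_trans (gv 0 1 _ _ _); rewrite ?nr_ge0.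
pose u n := rsum g H n.+1 (unif n) (unif n).
have [y uy] : exists y, forall e : R, 0 < e -> exists N, forall n, (N <= n)%N -> nr (u n - y) <= e.
  apply: Vc => e e0.
  have e'0 : 0 < e / (v 1 - v 0 + 1) by rewrite divr_gt0 //; lra.
  have [d d0 Hd] := icont_unif cH e'0.
  have [N HN] := @inv_lt (d / 2) ltac:(lra).
  exists N => m n Nm Nn.
  have -> : e = e / (v 1 - v 0 + 1) * (v 1 - v 0 + 1) by rewrite divfK //; apply: lt0r_neq0; lra.
  apply: (@le_trans _ _ (e / (v 1 - v 0 + 1) * (v 1 - v 0))); last by rewrite ler_pM2l //; lra.
  apply: (rsum_compare gv (unif_tagged (HN m Nm)) (unif_tagged (HN n Nn)) (ltW e'0)).
  by move=> s t ss tt st; apply: Hd => //; lra.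
exists y => e d e0 d0 He n x tag T.
apply: (limit_le uy).
have [N HN] := @inv_lt (d / 2) ltac:(lra); exists N => m Nm.
apply: (rsum_compare gv T (unif_tagged (HN m Nm)) e0).
by move=> s t ss tt st; apply: He => //; lra.
Qed.

End riemann_stieltjes.

Section contour_integrals.
Context {R : realType}.

Lemma node_tagged (s : seq R) (tag : nat -> R) (d : R) : itv_partition 0 1 s ->
  (forall k, (k < size s)%N -> node s k.+1 - node s k < d /\ node s k <= tag k <= node s k.+1) ->
  tagged (size s) (node s) tag d.
Proof.
move=> sp Hs; split => //; first by rewrite /node (itv_partition_nth_size _ sp).
move=> k ks; have [h1 h2] := Hs k ks; split => //.
by case/andP: h2 => h3 h4; apply: le_trans h4.
Qed.

Lemma unif_partition (n : nat) : let s := [seq @unif R n k.+1 | k <- iota 0 n.+1] in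
  [/\ itv_partition 0 1 s, size s = n.+1 & forall k, (k <= n.+1)%N -> node s k = unif n k].
Proof.
move=> s; have ss : size s = n.+1 by rewrite size_map size_iota.
have ns k : (k <= n.+1)%N -> node s k = unif n k.
  case: k => [|k] kn; first by rewrite /node /unif mul0r.
  by rewrite /node /= (nth_map 0%N) ?size_iota // nth_iota.
split => //; split.
  apply/(pathP 1) => k; rewrite ss => kn.
  have := ns k (ltnW kn); have := ns k.+1 kn; rewrite /node /= => -> ->.
  by rewrite /unif ltr_pM2r ?invr_gt0 ?ltr0n // ltr_nat.
rewrite (last_nth 1) ss; have := ns n.+1 (leqnn _); rewrite /node => ->.
by rewrite /unif divff // gt_eqF // ltr0n.
Qed.

Lemma contour_integral_unique (V : normedModType R[i]) (g : R -> R[i]) (h : R[i] -> V) y y' :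
  is_contour_integral g h y -> is_contour_integral g h y' -> y = y'.
Proof.
move=> H H'; apply: nr_sub_eq0 => e e0; have e20 : 0 < e / 2 by lra.
have [d d0 Hd] := H _ e20; have [d' d'0 Hd'] := H' _ e20.
have [|N HN] := @inv_lt R (Num.min d d'); first by rewrite lt_min d0 d'0.
have [sp ss ns] := unif_partition N.
have := HN N (leqnn N); rewrite lt_min => /andP[Nd Nd'].
have T (c : R) : N.+1%:R^-1 < c ->
   forall k : nat, (k < size [seq @unif R N k.+1 | k <- iota 0 N.+1])%N ->
   node [seq @unif R N k.+1 | k <- iota 0 N.+1] k.+1 - node [seq @unif R N k.+1 | k <- iota 0 N.+1] k < c /\
   node [seq @unif R N k.+1 | k <- iota 0 N.+1] k <= unif N k <= node [seq @unif R N k.+1 | k <- iota 0 N.+1] k.+1.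
  move=> Nc k; rewrite ss => kN; rewrite !ns // 1?ltnW //.
  by have [_ _ /(_ k kN)[? ? ?]] := unif_tagged Nc.
have := Hd _ (unif N) sp (T _ Nd); have := Hd' _ (unif N) sp (T _ Nd').
rewrite !nr_lt; set S := \sum_(_ <= _ < _) _ => h1 h2.
have := nr_dist S y y'; rewrite [nr (y - S)]nr_sym; lra.
Qed.

Section estimates.
Context (g : R -> R[i]) (v : R -> R) (gv : dominates_variation v g).
Local Notation L := (v 1 - v 0).

Lemma variation_ge0 : 0 <= v 1 - v 0.
Proof. by apply: le_trans (gv _ _ _); rewrite ?nr_ge0 ?lexx. Qed.

Lemma contour_integral_spec (V : normedModType R[i]) (Vc : seq_complete V) (h : R[i] -> V) :
  icont (fun t => h (g t)) ->
  forall e d : R, 0 <= e -> 0 < d ->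
    (forall s t, 0 <= s <= 1 -> 0 <= t <= 1 -> `|s - t| < d -> nr (h (g s) - h (g t)) <= e) ->
    forall n x tag, tagged n x tag (d / 2) ->
    nr (rsum g (fun t => h (g t)) n x tag - contour_integral g h) <= e * L.
Proof.
have L0 := variation_ge0.
move=> ch; have [y Hy] := riemann_stieltjes Vc gv ch.
suff -> : contour_integral g h = y by [].
have Iy : is_contour_integral g h y.
  move=> e e0; have e'0 : 0 < e / (2 * (L + 1)) by rewrite divr_gt0 //; lra.
  have [d d0 Hd] := icont_unif ch e'0.
  exists (d / 2); first lra.
  move=> s tag sp Hs; have := Hy _ _ (ltW e'0) d0 Hd _ _ _ (node_tagged sp Hs).
  rewrite nr_lt; move/le_lt_trans; apply; rewrite mulrAC ltr_pdivrMr; last lra.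
  by rewrite ltr_pM2l //; lra.
apply: (contour_integral_unique _ Iy); rewrite /contour_integral.
by case: xgetP => [z _ //|/(_ y)/(_ Iy)].
Qed.

(** Uniform subdivisions can be refined by a given factor and compared index by
    index, unlike arbitrary ones. *)
Lemma contour_integral_cvg (V : normedModType R[i]) (Vc : seq_complete V) (h : R[i] -> V) :
  icont (fun t => h (g t)) -> forall e : R, 0 < e -> exists N, forall n, (N <= n)%N ->
  nr (rsum g (fun t => h (g t)) n.+1 (unif n) (unif n) - contour_integral g h) <= e.
Proof.
have L0 := variation_ge0.
move=> ch e e0; have e'0 : 0 < e / (L + 1) by rewrite divr_gt0 //; lra.
have [d d0 Hd] := icont_unif ch e'0.
have [N HN] := @inv_lt R (d / 2) ltac:(lra); exists N => n Nn.
apply: (le_trans (contour_integral_spec Vc ch (ltW e'0) d0 Hd (unif_tagged (HN n Nn)))).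
by rewrite mulrAC ler_pdivrMr ?ler_pM2l //; lra.
Qed.

Lemma rsum_bound (V : normedModType R[i]) (H : R -> V) n x tag d (K : R) :
  tagged n x tag d -> (forall t, 0 <= t <= 1 -> nr (H t) <= K) ->
  nr (rsum g H n x tag) <= K * L.
Proof.
move=> T HK; have bx k := @tagged_bounds _ _ _ _ _ k T; have [x0 xn xS] := T.
have -> : K * L = \sum_(0 <= k < n) K * (v (x k.+1) - v (x k)).
  by rewrite -mulr_sumr (telescope_sumr (fun k => v (x k))) // xn x0.
apply: (le_trans (nr_sum _ _)).
rewrite big_nat [leRHS]big_nat; apply: ler_sum => k /= kn.
have [xk xd tk] := xS k kn; have := bx k (ltnW kn); have := bx k.+1 kn => bk bk'.
rewrite nrZ mulrC ler_pM ?nr_ge0 //; first by apply: HK; lra.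
by apply: gv => //; lra.
Qed.

Lemma contour_integral_bound (V : normedModType R[i]) (Vc : seq_complete V) (h : R[i] -> V) (K : R) :
  icont (fun t => h (g t)) -> (forall t, 0 <= t <= 1 -> nr (h (g t)) <= K) ->
  nr (contour_integral g h) <= K * L.
Proof.
move=> ch hK; apply/ler_addgt0Pr => e e0.
have [N HN] := contour_integral_cvg Vc ch e0.
have [n1 Hn1] := @inv_lt R 1 ltr01.
have := HN _ (leq_maxl N n1); have := rsum_bound (unif_tagged (Hn1 _ (leq_maxr N n1))) hK.
set S := rsum _ _ _ _ _ => h1; rewrite nr_sym => h2.
have := nr_triangle (contour_integral g h - S) S; rewrite subrK; lra.
Qed.

Lemma contour_integral_lin (V : normedModType R[i]) (Vc : seq_complete V) (h1 h2 : R[i] -> V) (k1 k2 : R[i]) :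
  icont (fun t => h1 (g t)) -> icont (fun t => h2 (g t)) ->
  icont (fun t => k1 *: h1 (g t) + k2 *: h2 (g t)) ->
  contour_integral g (fun z => k1 *: h1 z + k2 *: h2 z) =
  k1 *: contour_integral g h1 + k2 *: contour_integral g h2.
Proof.
move=> c1 c2 c3; apply: nr_sub_eq0 => e e0.
set K := nr k1 + nr k2 + 1.
have K0 : 0 < K by rewrite /K; have := nr_ge0 k1; have := nr_ge0 k2; lra.
have e'0 : 0 < e / K by rewrite divr_gt0.
have [N1 HN1] := contour_integral_cvg Vc c1 e'0; have [N2 HN2] := contour_integral_cvg Vc c2 e'0.
have [N3 HN3] := @contour_integral_cvg _ Vc (fun z => k1 *: h1 z + k2 *: h2 z) c3 _ e'0.
pose n := maxn N1 (maxn N2 N3).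
have := HN1 n (leq_maxl _ _).
have := HN2 n (leq_trans (leq_maxl _ _) (leq_maxr _ _)).
have := HN3 n (leq_trans (leq_maxr _ _) (leq_maxr _ _)).
set S1 := rsum g (fun t => h1 (g t)) _ _ _; set S2 := rsum g (fun t => h2 (g t)) _ _ _.
have -> : rsum g (fun t => k1 *: h1 (g t) + k2 *: h2 (g t)) n.+1 (unif n) (unif n) = k1 *: S1 + k2 *: S2.
  rewrite /S1 /S2 /rsum !scaler_sumr -big_split; apply: eq_bigr => k _ /=.
  by rewrite scalerDr !scalerA ![_ * (_ - _)]mulrC.
set J1 := contour_integral g h1; set J2 := contour_integral g h2.
set I := contour_integral g _; rewrite nr_sym => h3 h4 h5.
have -> : I - (k1 *: J1 + k2 *: J2) = (I - (k1 *: S1 + k2 *: S2)) + (k1 *: (S1 - J1) + k2 *: (S2 - J2)).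
  have aux (a b c d d' : V) : a - (b + c) = (a - (d + d')) + ((d - b) + (d' - c)).
    by rewrite [d - b + _]addrACA -opprD addrA subrK.
  by rewrite !scalerBr -aux.
apply: (le_trans (nr_triangle _ _)); have := nr_triangle (k1 *: (S1 - J1)) (k2 *: (S2 - J2)).
rewrite !nrZ => h6.
have -> : e = e / K + (nr k1 * (e / K) + nr k2 * (e / K)).
  by rewrite -mulrDl -[X in X + _]mul1r -mulrDl addrC -/K mulrC divfK // gt_eqF.
apply: lerD => //; apply: (le_trans h6); apply: lerD; apply: ler_wpM2l => //; exact: nr_ge0.
Qed.

End estimates.

End contour_integrals.

Section primitive_sums.
Context {R : realType}.

Lemma sum_nat_mul (V : zmodType) (n m : nat) (f : nat -> V) :
  \sum_(0 <= j < n * m) f j = \sum_(0 <= k < n) \sum_(0 <= i < m) f (k * m + i)%N.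
Proof.
elim: n => [|n IH]; first by rewrite mul0n !big_geq.
rewrite big_nat_recr //= -IH mulSn addnC (@big_cat_nat _ _ _ (n * m)%N) ?leq_addr //=.
by congr (_ + _); rewrite -{1}[(n * m)%N]add0n big_addn addKn; apply: eq_bigr => i _; rewrite addnC.
Qed.

Lemma unif_tagged1 n : tagged n.+1 (@unif R n) (unif n) (n.+1%:R^-1 + 1).
Proof. by apply: unif_tagged; rewrite ltrDl. Qed.

Context (g : R -> R[i]) (v : R -> R).
Hypotheses (gv : dominates_variation v g) (gc : icont g).

Lemma icont_comp (V : normedModType R[i]) (F : R[i] -> V) :
  (forall s, 0 <= s <= 1 -> ccont F (g s)) -> icont (fun t => F (g t)).
Proof.
move=> Fc s ss e e0; have [d d0 Fd] := Fc s ss e e0.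
have d20 : 0 < d / 2 by lra.
have [r r0 gr] := gc ss d20; exists r => // t tt ts; apply: Fd.
by apply: (le_lt_trans (gr t tt ts)); lra.
Qed.

Lemma unif_ccont (F : R[i] -> R[i]) : (forall s, 0 <= s <= 1 -> ccont F (g s)) ->
  forall e : R, 0 < e -> exists2 d : R, 0 < d &
    forall s, 0 <= s <= 1 -> forall p, nr (p - g s) < d -> nr (F p - F (g s)) <= e.
Proof.
move=> Fc e e0.
apply: (uniform_radius (Q := fun s d => forall p, nr (p - g s) < d -> nr (F p - F (g s)) <= e)) => //.
  by move=> s d d' _ dd H p pd; apply: H; exact: lt_le_trans dd.
move=> s ss; have e20 : 0 < e / 2 by lra.
have [d d0 Fd] := Fc s ss _ e20; have d20 : 0 < d / 3 by lra.
have [r r0 gr] := gc ss d20; exists r => //; exists (d / 3) => // t tt ts p pt.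
have gts := gr t tt ts.
have h1 : nr (F (g t) - F (g s)) <= e / 2 by apply: Fd; lra.
have h2 : nr (F p - F (g s)) <= e / 2.
  by apply: Fd; apply: (le_lt_trans (nr_dist (g t) _ _)); lra.
by apply: (le_trans (nr_dist (F (g s)) _ _)); rewrite [nr (_ - F (g t))]nr_sym; lra.
Qed.

(** Cutting each arc further does not change the sum of the increments of local
    primitives, while it brings the sum arbitrarily close to the integral. *)
Lemma contour_integral_pint (F : R[i] -> R[i]) (r : R) n :
  (forall s, 0 <= s <= 1 -> ccont F (g s)) ->
  (forall s, 0 <= s <= 1 -> exists Phi, primitive_on (sq (g s) r) F Phi) ->
  (forall s t, 0 <= s <= 1 -> 0 <= t <= 1 -> `|s - t| <= n.+1%:R^-1 -> sq (g s) r (g t)) ->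
  contour_integral g F = \sum_(0 <= k < n.+1) pint F (g (unif n k)) (g (unif n k.+1)).
Proof.
move=> Fc Fp gr; set S := \sum_(_ <= _ < _) _.
have L0 := variation_ge0 gv.
apply: nr_sub_eq0 => e e0.
have e'0 : 0 < e / (v 1 - v 0 + 1) / 2 by rewrite !divr_gt0 //; lra.
set e' := e / _ / 2 in e'0.
have [d d0 Fd] := unif_ccont Fc e'0.
have [d' d'0 gd] := icont_unif gc (ltac:(lra) : 0 < d / 2).
have e20 : 0 < e / 2 by lra.
have [N1 HN1] := contour_integral_cvg gv (@seq_complete_complex R) (icont_comp Fc) e20.
have [N2 HN2] := inv_lt d'0.
pose m := maxn N1 N2; pose N := (n.+1 * m.+1).-1.
have NE : N.+1 = (n.+1 * m.+1)%N by rewrite /N prednK // muln_gt0.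
have mN : (m <= N)%N by rewrite -ltnS NE leq_pmull.
have uN k i : unif N (k * m.+1 + i) = unif n k + i%:R / (n.+1%:R * m.+1%:R) :> R.
  by rewrite /unif NE natrM natrD natrM mulrDl -mulf_div divff ?mulr1 // pnatr_eq0.
have SE : S = \sum_(0 <= j < N.+1) pint F (g (unif N j)) (g (unif N j.+1)).
  rewrite NE sum_nat_mul /S; apply: eq_big_nat => k /andP[_ kn].
  have [_ _ uS] := unif_tagged1 n.
  have [uk _ _] := uS k kn.
  have hk := tagged_bounds (unif_tagged1 n) (ltnW kn).
  have hk1 := tagged_bounds (unif_tagged1 n) kn.
  have ukS : unif n k.+1 = unif n k + n.+1%:R^-1 :> R by rewrite -(unifS n k) addrC subrK.
  have [Phi HPhi] := Fp _ hk.
  have inq i : (i <= m.+1)%N -> sq (g (unif n k)) r (g (unif N (k * m.+1 + i))).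
    move=> im; have t0 : 0 <= i%:R / (n.+1%:R * m.+1%:R) :> R by rewrite divr_ge0 ?mulr_ge0.
    have t1 : i%:R / (n.+1%:R * m.+1%:R) <= n.+1%:R^-1 :> R.
      rewrite invfM mulrCA ger_pMr ?invr_gt0 ?ltr0n // ler_pdivrMr ?ltr0n // mul1r.
      by rewrite ler_nat.
    apply: gr => //; rewrite uN; first (move: ukS hk hk1 t0 t1; move: (unif n k) (unif n k.+1) (_ / _) (_^-1) => a b c q; lra).
    by rewrite opprD addrA subrr sub0r normrN ger0_norm.
  have u0 : g (unif n k) = g (unif N (k * m.+1 + 0)) by rewrite uN mul0r addr0.
  have u1 : g (unif n k.+1) = g (unif N (k * m.+1 + m.+1)).
    by rewrite uN ukS invfM mulrCA divff ?pnatr_eq0 // mulr1.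
  rewrite u1 {1}u0 (pintE HPhi (inq 0%N _) (inq m.+1 _)) //.
  transitivity (\sum_(0 <= i < m.+1) (Phi (g (unif N (k * m.+1 + i.+1))) - Phi (g (unif N (k * m.+1 + i))))).
    by rewrite (telescope_sumr (fun i => Phi (g (unif N (k * m.+1 + i))))).
  apply: eq_big_nat => i /andP[_ im].
  by rewrite -addnS (pintE HPhi (inq i _) (inq i.+1 _)) // ltnW.
have h1 := HN1 N (leq_trans (leq_maxl _ _) mN).
have dN := HN2 N (leq_trans (leq_maxr _ _) mN).
set Rs := rsum _ _ _ _ _ in h1.
have TN := unif_tagged1 N.
have bN j := @tagged_bounds _ _ _ _ _ j TN.
have Nn : N.+1%:R^-1 <= n.+1%:R^-1 :> R.
  by rewrite lef_pV2 ?posrE ?ltr0n // ler_nat NE leq_pmulr.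
have h2 : nr (Rs - S) <= e' * (v 1 - v 0).
  rewrite SE /Rs /rsum -sumrB; apply: (le_trans (nr_sum _ _)).
  have -> : e' * (v 1 - v 0) = \sum_(0 <= j < N.+1) e' * (v (unif N j.+1) - v (unif N j)).
    by rewrite -mulr_sumr (telescope_sumr (fun j => v (unif N j))) // /unif mul0r divff // pnatr_eq0.
  rewrite big_nat [leRHS]big_nat; apply: ler_sum => j /= jN.
  have b1 := bN j (ltnW jN); have b2 := bN j.+1 jN.
  have dj : `|unif N j - unif N j.+1| = N.+1%:R^-1 :> R.
    by rewrite distrC unifS ger0_norm ?invr_ge0.
  have [Phi HPhi] := Fp _ b1.
  have s1 := gr _ _ b1 b1 ltac:(by rewrite subrr normr0 invr_ge0).
  have s2 := gr _ _ b1 b2 ltac:(by rewrite dj).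
  rewrite (pintE HPhi s1 s2) nr_sym [_ *: _]mulrC.
  set z := g (unif N j) in s1 s2 *; set w := g (unif N j.+1) in s2 *.
  have wz : nr (w - z) <= d / 2 by rewrite nr_sym; apply: gd; rewrite ?dj.
  apply: (@le_trans _ _ (e' * nr (w - z))).
    apply: (@segment_mean_value _ F) => s ss; first exact/HPhi/sq_convex.
    apply: Fd => //; rewrite -/z addrAC subrr add0r nrM nrR ger0_norm; last by case/andP: ss.
    apply: (@le_lt_trans _ _ (1 * nr (w - z))); last lra.
    by rewrite ler_wpM2r ?nr_ge0 //; case/andP: ss.
  rewrite ler_pM2l //; apply: gv; [by case/andP: b1 | | by case/andP: b2].
  by rewrite -subr_ge0 unifS invr_ge0.
have h3 : e' * (v 1 - v 0) <= e / 2.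
  rewrite /e' mulrAC ler_pM2r // mulrAC ler_pdivrMr ?ler_pM2l //; lra.
have := nr_dist Rs (contour_integral g F) S; rewrite [nr (_ - Rs)]nr_sym; lra.
Qed.

Lemma contour_integral_primitive (F Phi : R[i] -> R[i]) (D : set R[i]) (r : R) :
  0 < r -> g 0 = g 1 -> (forall s, 0 <= s <= 1 -> ccont F (g s)) ->
  (forall s, 0 <= s <= 1 -> sq (g s) r `<=` D) -> primitive_on D F Phi ->
  contour_integral g F = 0.
Proof.
move=> r0 g01 Fc gD pF.
have pr s : 0 <= s <= 1 -> primitive_on (sq (g s) r) F Phi by move=> ss z /(gD s ss)/pF.
have [d d0 gd] := icont_unif gc (ltac:(lra) : 0 < r / 2).
have [n Hn] := inv_lt d0.
have gr s t : 0 <= s <= 1 -> 0 <= t <= 1 -> `|s - t| <= n.+1%:R^-1 -> sq (g s) r (g t).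
  move=> ss tt st; apply: sq_nr; have := gd t s tt ss; rewrite distrC => h.
  have := Hn n (leqnn n); have := h ltac:(apply: le_lt_trans st (Hn n (leqnn n))); lra.
rewrite (@contour_integral_pint F r n) //; last by move=> s ss; exists Phi; apply: pr.
have TN := unif_tagged1 n.
have bN j := @tagged_bounds _ _ _ _ _ j TN.
transitivity (\sum_(0 <= k < n.+1) (Phi (g (unif n k.+1)) - Phi (g (unif n k)))).
  apply: eq_big_nat => k /andP[_ kn]; have b1 := bN k (ltnW kn).
  apply: (pintE (pr _ b1)); first by apply: sq_center.
  apply: gr => //; first exact: bN.
  by rewrite distrC unifS ger0_norm // invr_ge0.
by rewrite (telescope_sumr (fun k => Phi (g (unif n k)))) // /unif mul0r divff ?pnatr_eq0 // g01 subrr.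
Qed.

End primitive_sums.

(** * Lattice approximation of closed curves *)

Section discrete_green.
Context {R : realType}.
Variables (eh ev : nat -> nat -> R[i]).

(** eh i j and ev i j are the integrals along the edges that leave the lattice
    point (i, j) to the right and upwards. *)
Definition row_sum i j := \sum_(0 <= a < i) eh a j.
Definition col_sum i j := \sum_(0 <= b < j) ev i b.
Definition cell_bdry i j := eh i j + ev i.+1 j - eh i j.+1 - ev i j.

Lemma discrete_green i j :
  \sum_(0 <= a < i) \sum_(0 <= b < j) cell_bdry a b =
  row_sum i 0 - row_sum i j + (col_sum i j - col_sum 0 j).
Proof.
have E : \sum_(0 <= a < i) \sum_(0 <= b < j) cell_bdry a b =
   \sum_(0 <= a < i) (\sum_(0 <= b < j) (eh a b - eh a b.+1) + \sum_(0 <= b < j) (ev a.+1 b - ev a b)).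
  apply: eq_bigr => a _; rewrite -big_split; apply: eq_bigr => b _ /=.
  by rewrite /cell_bdry addrACA [RHS]addrC; ring.
rewrite E big_split /=; congr (_ + _).
  rewrite /row_sum -sumrB; apply: eq_bigr => a _.
  rewrite -[RHS]opprB -(telescope_sumr (fun b => eh a b)) // -sumrN.
  by apply: eq_bigr => b _; rewrite opprB.
rewrite exchange_big_nat /= /col_sum -sumrB; apply: eq_bigr => b _.
by rewrite (telescope_sumr (fun a => ev a b)).
Qed.

(** A closed lattice path is a combination of cell boundaries: relative to the
    potential row_sum + col_sum 0, moving right costs nothing and moving up is
    corrected by the cells to the left of the edge. *)
Lemma lattice_path n (i j : nat -> nat) N :
  (forall k, (k <= n)%N -> (i k <= N)%N /\ (j k <= N)%N) -> i n = i 0%N -> j n = j 0%N ->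
  \sum_(0 <= k < n) (row_sum (i k.+1) (j k) - row_sum (i k) (j k)
     + (col_sum (i k.+1) (j k.+1) - col_sum (i k.+1) (j k))) =
  \sum_(0 <= a < N) \sum_(0 <= b < N)
    (\sum_(0 <= k < n) (((a < i k.+1) && (b < j k.+1))%N%:R - ((a < i k.+1) && (b < j k))%N%:R)) * cell_bdry a b.
Proof.
move=> ijN iE jE.
pose W a0 b0 := \sum_(0 <= a < a0) \sum_(0 <= b < b0) cell_bdry a b.
pose P a b := col_sum 0 b + row_sum a b.
have WN a0 b0 : (a0 <= N)%N -> (b0 <= N)%N ->
   W a0 b0 = \sum_(0 <= a < N) \sum_(0 <= b < N) ((a < a0) && (b < b0))%N%:R * cell_bdry a b.
  move=> aN bN; rewrite /W (@big_cat_nat _ _ _ a0 0 N) //= -[LHS]addr0; congr (_ + _).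
    apply: eq_big_nat => a /andP[_ aa].
    rewrite (@big_cat_nat _ _ _ b0 0 N) //= -[LHS]addr0; congr (_ + _).
      by apply: eq_big_nat => b /andP[_ bb]; rewrite aa bb mul1r.
    by rewrite big_nat big1 // => b /andP[bb _]; rewrite [(b < b0)%N]ltnNge bb andbF mul0r.
  rewrite big_nat big1 // => a /andP[aa _]; rewrite big1 // => b _.
  by rewrite [(a < a0)%N]ltnNge aa mul0r.
transitivity (\sum_(0 <= k < n) (P (i k.+1) (j k.+1) - P (i k) (j k)) +
   \sum_(0 <= k < n) (W (i k.+1) (j k.+1) - W (i k.+1) (j k))).
  rewrite -big_split; apply: eq_bigr => k _ /=.
  rewrite /W !discrete_green /P.
  move: (row_sum _ _) (row_sum _ _) => p q; ring.
rewrite (telescope_sumr (fun k => P (i k) (j k))) // iE jE subrr add0r.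
have -> : \sum_(0 <= k < n) (W (i k.+1) (j k.+1) - W (i k.+1) (j k)) =
  \sum_(0 <= k < n) \sum_(0 <= a < N) \sum_(0 <= b < N)
   (((a < i k.+1) && (b < j k.+1))%N%:R - ((a < i k.+1) && (b < j k))%N%:R) * cell_bdry a b.
  apply: eq_big_nat => k /andP[_ kn].
  have [i1 j1] := ijN k.+1 kn; have [_ j0] := ijN k (ltnW kn).
  rewrite !WN // -sumrB; apply: eq_bigr => a _; rewrite -sumrB; apply: eq_bigr => b _.
  by rewrite mulrBl.
rewrite exchange_big_nat /=; apply: eq_bigr => a _.
rewrite exchange_big_nat /=; apply: eq_bigr => b _.
by rewrite mulr_suml.
Qed.

End discrete_green.

Section lattice_approximation.
Context {R : realType}.
Variables (B d : R).
Hypothesis d0 : 0 < d.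

Definition lat (i j : nat) : R[i] := Complex (- B + i%:R * d) (- B + j%:R * d).
Definition hedge (F : R[i] -> R[i]) i j := pint F (lat i j) (lat i.+1 j).
Definition vedge (F : R[i] -> R[i]) i j := pint F (lat i j) (lat i j.+1).
Definition cell_int (F : R[i] -> R[i]) := cell_bdry (hedge F) (vedge F).

Lemma floor_lattice (x : R) : `|x| < B ->
  exists2 i : nat, 0 <= x - (- B + i%:R * d) < d & i%:R * d <= 2 * B.
Proof.
rewrite ltr_norml => /andP[xB1 xB2].
have t0 : 0 <= (x + B) / d by apply: divr_ge0; [lra | exact: ltW].
exists (Num.truncn ((x + B) / d)).
  have /andP[] := truncn_itv t0; rewrite ler_pdivlMr // ltr_pdivrMr // -natr1; lra.
have /andP[h _] := truncn_itv t0; move: h; rewrite ler_pdivlMr //; lra.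
Qed.

Lemma floor_close (x y : R) (i j : nat) :
  0 <= x - (- B + i%:R * d) < d -> 0 <= y - (- B + j%:R * d) < d -> `|x - y| < d ->
  (i <= j.+1)%N.
Proof.
move=> hi hj; rewrite ltr_norml => xy; rewrite leqNgt; apply/negP => ji.
have : (j.+2%:R : R) <= i%:R by rewrite ler_nat.
rewrite -!natr1 => ji'; have := ler_wpM2r (ltW d0) ji'. lra.
Qed.

Lemma telescope_near (f : nat -> R[i]) (Phi : nat -> R[i]) i i' :
  (i <= i'.+1)%N -> (i' <= i.+1)%N ->
  (forall a, (i <= a.+1)%N -> (a.+1 <= i.+1)%N -> f a = Phi a.+1 - Phi a) ->
  \sum_(0 <= a < i') f a - \sum_(0 <= a < i) f a = Phi i' - Phi i.
Proof.
move=> ii' i'i fP; have [E|[E|E]] : i' = i \/ (i' = i.+1 \/ i = i'.+1) by lia.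
- by rewrite E !subrr.
- by rewrite E big_nat_recr //= addrAC subrr add0r fP.
- by rewrite E big_nat_recr //= opprD addrA subrr sub0r fP -?E // opprB.
Qed.

Context (g : R -> R[i]) (v : R -> R).
Hypotheses (gv : dominates_variation v g) (gc : icont g) (g01 : g 0 = g 1).
Hypothesis gB : forall s, 0 <= s <= 1 -> `|complex.Re (g s)| < B /\ `|complex.Im (g s)| < B.
Variable r : R.
Hypothesis dr : 4 * d <= r.

(** Each point of a fine uniform subdivision is moved to the lattice point below
    and to the left of it.  Consecutive lattice points are at most one step
    apart in each direction and share with the arc a square on which F has a
    primitive; the connecting increments cancel because the curve is closed, and
    lattice_path applies to what remains.  The coefficients depend on the curve
    only. *)
Lemma curve_lattice : exists N (c : nat -> nat -> R[i]), forall F : R[i] -> R[i],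
  (forall s, 0 <= s <= 1 -> ccont F (g s)) ->
  (forall s, 0 <= s <= 1 -> exists Phi, primitive_on (sq (g s) r) F Phi) ->
  contour_integral g F = \sum_(0 <= a < N) \sum_(0 <= b < N) c a b * cell_int F a b.
Proof.
have dpos := d0; have dler := dr.
have [e e0 ge] := icont_unif gc (ltac:(lra) : 0 < d / 2).
have [n Hn] := inv_lt e0; have {}Hn := Hn n (leqnn n).
have gd s t : 0 <= s <= 1 -> 0 <= t <= 1 -> `|s - t| <= n.+1%:R^-1 -> nr (g s - g t) < d.
  move=> ss tt st; apply: (@le_lt_trans _ _ (d / 2)); last lra.
  by apply: ge => //; apply: le_lt_trans Hn.
have gsq s t : 0 <= s <= 1 -> 0 <= t <= 1 -> `|s - t| <= n.+1%:R^-1 -> sq (g s) r (g t).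
  by move=> ss tt st; apply: sq_nr; rewrite nr_sym; apply: (lt_trans (gd _ _ ss tt st)); lra.
have bu k : (k <= n.+1)%N -> 0 <= @unif R n k <= 1 by move=> h; exact: (tagged_bounds (@unif_tagged1 R n) h).
have [idx Hidx] : exists f : nat -> nat * nat, forall k, (k <= n.+1)%N ->
    [/\ 0 <= complex.Re (g (unif n k)) - (- B + (f k).1%:R * d) < d,
        0 <= complex.Im (g (unif n k)) - (- B + (f k).2%:R * d) < d,
        (f k).1%:R * d <= 2 * B & (f k).2%:R * d <= 2 * B].
  have : forall k : nat, exists p : nat * nat, (k <= n.+1)%N ->
    [/\ 0 <= complex.Re (g (unif n k)) - (- B + p.1%:R * d) < d,
        0 <= complex.Im (g (unif n k)) - (- B + p.2%:R * d) < d,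
        p.1%:R * d <= 2 * B & p.2%:R * d <= 2 * B].
    move=> k; have [kn|kn] := leqP k n.+1; last by exists (0%N, 0%N).
    have [h1 h2] := gB (bu k kn).
    have [i Hi Hi'] := floor_lattice h1; have [j Hj Hj'] := floor_lattice h2.
    by exists (i, j).
  by move=> /choice[f fP]; exists f.
pose i k := (idx k).1; pose j k := (idx k).2.
have u0 : unif n 0 = 0 :> R by rewrite /unif mul0r.
have u1 : unif n n.+1 = 1 :> R by rewrite /unif divff // pnatr_eq0.
have close k l : (k <= n.+1)%N -> (l <= n.+1)%N -> nr (g (unif n k) - g (unif n l)) < d ->
   (i k <= (i l).+1)%N /\ (j k <= (j l).+1)%N.
  move=> kn ln kl; have [h1 h2 _ _] := Hidx k kn; have [h3 h4 _ _] := Hidx l ln.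
  split; [apply: floor_close h1 h3 _ | apply: floor_close h2 h4 _]; rewrite -raddfB.
    exact: le_lt_trans (nr_Re _) kl.
  exact: le_lt_trans (nr_Im _) kl.
(* the end points of the curve coincide, so they may be given the same lattice
   point, which closes the lattice path *)
pose i' k := if k == n.+1 then i 0%N else i k.
pose j' k := if k == n.+1 then j 0%N else j k.
have Hij k : (k <= n.+1)%N ->
    [/\ 0 <= complex.Re (g (unif n k)) - (- B + (i' k)%:R * d) < d,
        0 <= complex.Im (g (unif n k)) - (- B + (j' k)%:R * d) < d,
        (i' k)%:R * d <= 2 * B & (j' k)%:R * d <= 2 * B].
  move=> kn; rewrite /i' /j'; case: eqVneq => [->|_]; last exact: Hidx.
  by have := Hidx 0%N isT; rewrite u0 g01 u1.
have uS k : (k < n.+1)%N -> `|unif n k - unif n k.+1| <= n.+1%:R^-1 :> R.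
  by move=> kn; rewrite distrC unifS ger0_norm // invr_ge0.
have [N HN] : exists N : nat, forall k, (k <= n.+1)%N -> (i' k <= N)%N /\ (j' k <= N)%N.
  exists (Num.truncn (2 * B / d)) => k kn; have [_ _ h1 h2] := Hij k kn.
  have B0 : 0 <= 2 * B / d.
    by rewrite divr_ge0 ?(ltW d0) //; have := ler_wpM2r (ltW d0) (ler0n R (i' k)); lra.
  by split; rewrite truncn_ge_nat // ler_pdivlMr.
exists N, (fun a b => \sum_(0 <= k < n.+1) (((a < i' k.+1) && (b < j' k.+1))%N%:R - ((a < i' k.+1) && (b < j' k))%N%:R)).
move=> F Fc Fp.
rewrite (contour_integral_pint gv gc Fc Fp gsq) -lattice_path //; last first.
- by rewrite /j' eqxx.
- by rewrite /i' eqxx.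
pose al k := pint F (g (unif n k)) (lat (i' k) (j' k)).
transitivity (\sum_(0 <= k < n.+1) (row_sum (hedge F) (i' k.+1) (j' k) - row_sum (hedge F) (i' k) (j' k) +
    (col_sum (vedge F) (i' k.+1) (j' k.+1) - col_sum (vedge F) (i' k.+1) (j' k)))
  - \sum_(0 <= k < n.+1) (al k.+1 - al k)); last first.
  by rewrite (telescope_sumr al) // /al /i' /j' eqxx /= u0 u1 g01 subrr subr0.
rewrite -sumrB; apply: eq_big_nat => k /andP[_ kn].
have bk := bu k (ltnW kn); have bk1 := bu k.+1 kn.
have [Phi HPhi] := Fp _ bk.
have gk1 := gsq _ _ bk bk1 (uS k kn).
have gk0 : sq (g (unif n k)) r (g (unif n k)) by apply: sq_center; lra.
have [hi1 hj1 _ _] := Hij k (ltnW kn); have [hi2 hj2 _ _] := Hij k.+1 kn.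
have dk := gd _ _ bk bk1 (uS k kn).
have dRe : `|complex.Re (g (unif n k)) - complex.Re (g (unif n k.+1))| < d.
  by rewrite -raddfB; apply: le_lt_trans (nr_Re _) dk.
have dIm : `|complex.Im (g (unif n k)) - complex.Im (g (unif n k.+1))| < d.
  by rewrite -raddfB; apply: le_lt_trans (nr_Im _) dk.
have li1 := floor_close hi1 hi2 dRe; have li2 := floor_close hi2 hi1 ltac:(by rewrite distrC).
have lj1 := floor_close hj1 hj2 dIm; have lj2 := floor_close hj2 hj1 ltac:(by rewrite distrC).
have insq a b : (i' k <= a.+1)%N -> (a <= (i' k).+1)%N -> (j' k <= b.+1)%N -> (b <= (j' k).+1)%N ->
    sq (g (unif n k)) r (lat a b).
  have nat_d (p q : nat) : (p <= q.+1)%N -> p%:R * d <= q%:R * d + d.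
    by move=> pq; rewrite -[X in _ + X]mul1r -mulrDl ler_pM2r // natr1 ler_nat.
  move=> h1 h2 h3 h4; have := nat_d _ _ h1; have := nat_d _ _ h2.
  have := nat_d _ _ h3; have := nat_d _ _ h4 => n4 n3 n2 n1.
  by split; rewrite /= ltr_norml; move: hi1 hj1; lra.
have E1 : pint F (g (unif n k)) (g (unif n k.+1)) = Phi (g (unif n k.+1)) - Phi (g (unif n k)).
  exact: (pintE HPhi gk0 gk1).
have E2 : al k = Phi (lat (i' k) (j' k)) - Phi (g (unif n k)).
  by apply: (pintE HPhi gk0); apply: insq.
have E3 : al k.+1 = Phi (lat (i' k.+1) (j' k.+1)) - Phi (g (unif n k.+1)).
  by apply: (pintE HPhi gk1); apply: insq.
have E4 : row_sum (hedge F) (i' k.+1) (j' k) - row_sum (hedge F) (i' k) (j' k) =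
    Phi (lat (i' k.+1) (j' k)) - Phi (lat (i' k) (j' k)).
  apply: (@telescope_near _ (fun a => Phi (lat a (j' k)))) => // a h1 h2.
  by apply: (pintE HPhi); apply: insq; rewrite // ?(leqW h1) ?(ltnW h2).
have E5 : col_sum (vedge F) (i' k.+1) (j' k.+1) - col_sum (vedge F) (i' k.+1) (j' k) =
    Phi (lat (i' k.+1) (j' k.+1)) - Phi (lat (i' k.+1) (j' k)).
  apply: (@telescope_near _ (fun b => Phi (lat (i' k.+1) b))) => // b h1 h2.
  by apply: (pintE HPhi); apply: insq; rewrite // ?(leqW h1) ?(ltnW h2).
by rewrite E1 E2 E3 E4 E5; ring.
Qed.

End lattice_approximation.

(** * The Cauchy kernel on lattice cells *)

Section calculus.
Context {R : realType}.
Implicit Types (F G : R[i] -> R[i]) (z w : R[i]).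

Lemma ccont_cderiv F z d : cderiv F z d -> ccont F z.
Proof.
move=> H e e0; have [r r0 Hr] := H 1 ltr01.
have K0 : 0 < nr d + 1 by rewrite ltr_wpDl ?nr_ge0.
exists (Num.min r (e / (nr d + 1))); first by rewrite lt_min r0 divr_gt0.
move=> w; rewrite lt_min ltr_pdivlMr // => /andP[wr we].
have := Hr w wr; have := nr_triangle (F w - F z - d * (w - z)) (d * (w - z)).
rewrite subrK nrM; lra.
Qed.

Lemma ccont_cst z k : ccont (fun _ : R[i] => k : R[i]) z.
Proof. by move=> e e0; exists 1 => // w _; rewrite subrr nr0 ltW. Qed.

Lemma ccontD F G z : ccont F z -> ccont G z -> ccont (fun w => F w + G w) z.
Proof.
move=> H1 H2 e e0; have e20 : 0 < e / 2 by lra.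
have [r1 r10 {}H1] := H1 _ e20; have [r2 r20 {}H2] := H2 _ e20.
exists (Num.min r1 r2); first by rewrite lt_min r10 r20.
move=> w; rewrite lt_min => /andP[/H1 {}H1 /H2 {}H2].
have -> : F w + G w - (F z + G z) = (F w - F z) + (G w - G z) by ring.
by apply: (le_trans (nr_triangle _ _)); lra.
Qed.

Lemma ccontM F G z : ccont F z -> ccont G z -> ccont (fun w => F w * G w) z.
Proof.
move=> H1 H2 e e0.
set K := nr (F z) + nr (G z) + 1.
have K0 : 0 < K by rewrite ltr_wpDl // addr_ge0 ?nr_ge0.
pose e1 := Num.min 1 (e / K).
have e10 : 0 < e1 by rewrite lt_min ltr01 divr_gt0.
have [e11 e1K] : e1 <= 1 /\ e1 * K <= e.
  by rewrite -ler_pdivlMr // /e1 !ge_min !lexx orbT.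
have [r1 r10 {}H1] := H1 _ e10; have [r2 r20 {}H2] := H2 _ e10.
exists (Num.min r1 r2); first by rewrite lt_min r10 r20.
move=> w; rewrite lt_min => /andP[/H1 {}H1 /H2 {}H2].
have -> : F w * G w - F z * G z = (F w - F z) * (G w - G z) + (F w - F z) * G z + F z * (G w - G z) by ring.
apply: (le_trans (nr_triangle _ _)); have := nr_triangle ((F w - F z) * (G w - G z)) ((F w - F z) * G z).
rewrite !nrM.
have a1 : nr (F w - F z) * nr (G w - G z) <= e1.
  by rewrite -[leRHS]mulr1; apply: ler_pM; rewrite ?nr_ge0 //; lra.
have a2 : nr (F w - F z) * nr (G z) <= e1 * nr (G z) by rewrite ler_wpM2r ?nr_ge0.
have a3 : nr (F z) * nr (G w - G z) <= nr (F z) * e1 by rewrite ler_wpM2l ?nr_ge0.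
move: e1K; rewrite /K; lra.
Qed.

Lemma cderiv_inv w z : z <> w -> cderiv (fun z => (z - w)^-1) z (- (z - w) ^- 2).
Proof.
move=> /eqP zw; rewrite -subr_eq0 in zw; set u := z - w in zw *.
have u0 : 0 < nr u by rewrite nr_gt0.
move=> e e0; exists (Num.min (nr u / 2) (e * nr u ^+ 3 / 2)).
  by rewrite lt_min !divr_gt0 ?mulr_gt0 ?exprn_gt0.
move=> z'; rewrite lt_min => /andP[h1 h2].
set u' := z' - w; have E : z' - z = u' - u by rewrite /u' /u; ring.
have u'2 : nr u / 2 <= nr u'.
  by have := nr_triangle (u - u') u'; rewrite subrK [nr (u - u')]nr_sym -E; lra.
have u'0 : u' != 0 by rewrite -nr_gt0; lra.
have -> : u'^-1 - u^-1 - - u ^- 2 * (z' - z) = (u' - u) * (u'^-1 * (u^-1 * u^-1) * (u' - u)).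
  by rewrite E; field; rewrite u'0 zw.
rewrite E in h1 h2 *; rewrite nrM mulrC ler_wpM2r ?nr_ge0 // !nrM !nrV.
have u'i : (nr u')^-1 <= 2 / nr u.
  by rewrite -[X in _ <= X]invf_div lef_pV2 ?posrE ?divr_gt0 //; lra.
apply: (@le_trans _ _ (2 / nr u * ((nr u)^-1 * (nr u)^-1) * (e * nr u ^+ 3 / 2))).
  apply: ler_pM; rewrite ?mulr_ge0 ?invr_ge0 ?nr_ge0 //; last exact: ltW.
  by rewrite ler_wpM2r // mulr_ge0 ?invr_ge0 ?nr_ge0.
apply: eq_leW; field; by rewrite gt_eqF.
Qed.

Lemma nr2E (a b : R) : nr (Complex a b) ^+ 2 = a ^+ 2 + b ^+ 2.
Proof.
have /complexI : (nr (Complex a b) ^+ 2)%:C = (a ^+ 2 + b ^+ 2)%:C; last by [].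
by rewrite rmorphXn /= -nrE -add_Re2_Im2.
Qed.

Lemma notin_sq_nr a r z : ~ sq a r z -> r <= nr (z - a).
Proof. by move=> H; rewrite leNgt; apply/negP => h; apply/H/sq_nr. Qed.

(** Primitives are asked for on squares only, so F may have periods. *)
Definition locally_primitive (D : set R[i]) F : Prop := forall a r r', 0 < r -> r < r' ->
  sq a r' `<=` D -> exists Phi, primitive_on (sq a r) F Phi.

Lemma almost_holomorphic_primitive (D : set R[i]) p F : almost_holomorphic D p F -> locally_primitive D F.
Proof.
move=> [Fc Fd] a r r' r0 rr aD; apply: (primitive_sq r0 rr (p := p)).
by split=> z /aD; [exact: Fc | exact: Fd].
Qed.

Definition cauchy_kernel w z : R[i] := (z - w)^-1.

Lemma kernel_ccont w z : z <> w -> ccont (cauchy_kernel w) z.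
Proof. by move=> zw; apply: ccont_cderiv (cderiv_inv zw). Qed.

Lemma kernel_primitive w : locally_primitive (~` [set w]) (cauchy_kernel w).
Proof.
apply: (@almost_holomorphic_primitive _ w); split=> z zw; first exact: kernel_ccont.
by move=> _; exists (- (z - w) ^- 2); apply: cderiv_inv.
Qed.

End calculus.

Section cells.
Context {R : realType}.
Variables (B d : R).
Hypothesis d0 : 0 < d.
Local Notation lat := (lat B d).
Local Notation cell_int := (cell_int B d).

Definition cell_center a b : R[i] := lat a b + Complex (d / 2) (d / 2).

Lemma cell_int0 F Phi a b (r : R) : d / 2 < r -> primitive_on (sq (cell_center a b) r) F Phi ->
  cell_int F a b = 0.
Proof.
move=> dr HPhi; have dpos := d0.
have insq a' b' : (a <= a' <= a.+1)%N -> (b <= b' <= b.+1)%N -> sq (cell_center a b) r (lat a' b').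
  have nd (p q : nat) : (p <= q <= p.+1)%N -> p%:R * d <= q%:R * d <= p%:R * d + d.
    move=> /andP[h1 h2]; rewrite ler_pM2r // ler_nat h1 -[X in _ + X]mul1r -mulrDl ler_pM2r //.
    by rewrite natr1 ler_nat.
  move=> /nd h1 /nd h2; split; rewrite /= ltr_norml; lra.
rewrite /cell_int /cell_bdry /hedge /vedge.
have h1 := insq a b; have h2 := insq a.+1 b; have h3 := insq a b.+1; have h4 := insq a.+1 b.+1.
rewrite !(leqnn, leqnSn) /= in h1 h2 h3 h4.
rewrite (pintE HPhi (h1 isT isT) (h2 isT isT)) (pintE HPhi (h2 isT isT) (h4 isT isT)).
by rewrite (pintE HPhi (h3 isT isT) (h4 isT isT)) (pintE HPhi (h1 isT isT) (h3 isT isT)); ring.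
Qed.

(** Along the side from P to Q of a square with centre w and half side h, the
    kernel 1/(z-w) stays within 3/(5h) of a constant k with
    k (Q - P) = 3i/2, so the integral is within 6/5 of 3i/2.  A square around
    the side that avoids w, where the kernel has a primitive, must have its
    centre c pushed outwards. *)
Lemma side_integral w (h : R) (u c : R[i]) : 0 < h -> nr u = 1 ->
  let P := w + u * Complex (- h) (- h) in let Q := w + u * Complex h (- h) in
  sq c (6 / 5 * h) P -> sq c (6 / 5 * h) Q -> ~ sq c (13 / 10 * h) w ->
  0 < complex.Im (pint (cauchy_kernel w) P Q) /\
  pint (cauchy_kernel w) Q P = - pint (cauchy_kernel w) P Q.
Proof.
move=> h0 u1 P Q cP cQ cw.
have u0 : u != 0 by rewrite -nr_gt0 u1.
have r0 : 0 < 6 / 5 * h by lra.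
have rr : 6 / 5 * h < 13 / 10 * h by lra.
have [|Phi HPhi] := @kernel_primitive R w c _ _ r0 rr.
  by move=> z cz /= zw; apply: cw; rewrite -zw.
rewrite (pintE HPhi cP cQ) (pintE HPhi cQ cP) opprB; split => //.
(* up to the factor 1/u, the kernel runs from (-1 + i)/(2h) through i/h to
   (1 + i)/(2h), and 3i/(4h) is roughly in the middle *)
pose k : R[i] := u^-1 * Complex 0 (3 / 4 / h).
have QP : Q - P = u * (2 * h)%:C.
  rewrite /P /Q opprD addrACA subrr add0r -mulrBr; congr (_ * _).
  by apply: complex_ext => /=; ring.
have nQP : 3 / 5 / h * nr (Q - P) = 6 / 5.
  by rewrite QP nrM u1 mul1r nrR ger0_norm; [field; rewrite gt_eqF | lra].
have kQP : k * (Q - P) = Complex 0 (3 / 2).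
  rewrite QP /k mulrACA [u^-1 * u]mulVf // mul1r.
  by apply: complex_ext => /=; field; rewrite gt_eqF.
have H : nr (Phi Q - Phi P - Complex 0 (3 / 2)) <= 6 / 5.
  rewrite -nQP -kQP.
  apply: (@segment_mean_value _ (cauchy_kernel w)) => s ss; first exact/HPhi/sq_convex.
  rewrite QP; pose x := - h + s * (2 * h).
  have -> : P + s%:C * (u * (2 * h)%:C) = w + u * Complex x (- h).
    rewrite /P -addrA mulrCA -mulrDr; congr (_ + _ * _).
    by apply: complex_ext; rewrite /x /=; ring.
  rewrite /cauchy_kernel addrAC subrr add0r invfM -mulrBr nrM nrV u1 invr1 mul1r.
  have B0 : Complex x (- h) != 0 by rewrite eq_complex /= negb_and oppr_eq0 (gt_eqF h0) orbT.
  have -> : (Complex x (- h))^-1 - Complex 0 (3 / 4 / h) =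
     Complex (h / 4) (- (3 / 4 * x)) / (h%:C * Complex x (- h)).
    apply: (mulIf B0); rewrite mulrBl mulVf // invfM mulrA mulrAC mulfVK //.
    apply: (mulIf (_ : h%:C != 0)); first by rewrite fmorph_eq0 gt_eqF.
    rewrite divfK ?fmorph_eq0 ?gt_eqF //.
    by apply: complex_ext => /=; field; rewrite gt_eqF.
  rewrite nrM nrV nrM nrR ger0_norm ?(ltW h0) // invfM mulrA.
  rewrite ler_pdivrMr ?nr_gt0 // ler_pdivrMr //.
  have -> : 3 / 5 / h * nr (Complex x (- h)) * h = 3 / 5 * nr (Complex x (- h)).
    by field; rewrite gt_eqF.
  rewrite -ler_sqr ?nnegrE ?mulr_ge0 ?nr_ge0 //; try lra.
  rewrite exprMn !nr2E.
  have xh : x ^+ 2 <= h ^+ 2.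
    by rewrite -ler_sqrt ?sqr_ge0 // !sqrtr_sqr [`|h|]ger0_norm ?(ltW h0) // ler_norml /x; nra.
  by nra.
have := nr_Im (Phi Q - Phi P - Complex 0 (3 / 2)).
move=> /le_trans/(_ H); rewrite ler_norml => /andP[].
case: (Phi Q - Phi P) => a b /=; lra.
Qed.

Lemma side_integral4 w (h : R) (u : R[i]) : 0 < h ->
  [\/ u = 1, u = 'i%C, u = - 1 | u = - 'i%C] ->
  let P := w + u * Complex (- h) (- h) in let Q := w + u * Complex h (- h) in
  0 < complex.Im (pint (cauchy_kernel w) P Q) /\
  pint (cauchy_kernel w) Q P = - pint (cauchy_kernel w) P Q.
Proof.
move=> h0 hu; apply: (@side_integral w h u (w + u * Complex 0 (- (3 / 2 * h))) h0).
- by case: hu => ->; rewrite ?nrN ?nr1 ?nr_i.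
- by case: w => x y; case: hu => -> /=; split => /=; rewrite ltr_norml; lra.
- by case: w => x y; case: hu => -> /=; split => /=; rewrite ltr_norml; lra.
- by case: w => x y; case: hu => -> /= [/=]; rewrite !ltr_norml; lra.
Qed.

(** The four sides are the rotations of one side about the centre by powers of
    i, and each contributes a positive imaginary part. *)
Lemma cell_center_kernel a b : cell_int (cauchy_kernel (cell_center a b)) a b != 0.
Proof.
set w := cell_center a b; set k := cauchy_kernel w.
have [h h0 dh] : exists2 h, 0 < h & d = h + h by exists (d / 2); have := d0; lra.
have S u := @side_integral4 w h u h0.
have wE : w = lat a b + Complex h h by rewrite /w /cell_center dh; congr (_ + Complex _ _); field.
have natS (n : nat) : n.+1%:R * d = n%:R * d + d by rewrite -natr1 mulrDl mul1r.
have c1 : lat a b = w + 1 * Complex (- h) (- h).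
  by rewrite wE; apply: complex_ext => /=; ring.
have c2 : lat a.+1 b = w + 1 * Complex h (- h).
  by rewrite wE; apply: complex_ext; rewrite /= ?natS dh; ring.
have c2' : lat a.+1 b = w + 'i%C * Complex (- h) (- h).
  by rewrite wE; apply: complex_ext; rewrite /= ?natS dh; ring.
have c3 : lat a.+1 b.+1 = w + 'i%C * Complex h (- h).
  by rewrite wE; apply: complex_ext; rewrite /= ?natS dh; ring.
have c3' : lat a.+1 b.+1 = w + (- 1) * Complex (- h) (- h).
  by rewrite wE; apply: complex_ext; rewrite /= ?natS dh; ring.
have c4 : lat a b.+1 = w + (- 1) * Complex h (- h).
  by rewrite wE; apply: complex_ext; rewrite /= ?natS dh; ring.
have c4' : lat a b.+1 = w + (- 'i%C) * Complex (- h) (- h).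
  by rewrite wE; apply: complex_ext; rewrite /= ?natS dh; ring.
have c1' : lat a b = w + (- 'i%C) * Complex h (- h).
  by rewrite wE; apply: complex_ext => /=; ring.
have [p1 _] : _ /\ _ := S 1 ltac:(by constructor 1).
have [p2 _] : _ /\ _ := S 'i%C ltac:(by constructor 2).
have [p3 q3] : _ /\ _ := S (- 1) ltac:(by constructor 3).
have [p4 q4] : _ /\ _ := S (- 'i%C) ltac:(by constructor 4).
rewrite -c1 -c2 in p1; rewrite -c2' -c3 in p2; rewrite -c3' -c4 in p3 q3; rewrite -c4' -c1' in p4 q4.
suff : 0 < complex.Im (cell_int k a b) by apply: contraTneq => ->; rewrite /= ltxx.
rewrite /cell_int /cell_bdry /hedge /vedge -/k in p1 p2 p3 p4 q3 q4 *.
rewrite q3 q4 !opprK.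
move: p1 p2 p3 p4.
case: (pint k _ _) => ? ? /=; case: (pint k _ _) => ? ? /=; case: (pint k _ _) => ? ? /=; case: (pint k _ _) => ? ? /=; lra.
Qed.

(** The kernel has a primitive near a cell that does not contain its pole. *)
Lemma cell_other_kernel a b a' b' : (a != a') || (b != b') ->
  cell_int (cauchy_kernel (cell_center a b)) a' b' = 0.
Proof.
move=> ab; have dpos := d0.
have h1 : 0 < 3 / 5 * d by lra.
have h2 : 3 / 5 * d < 9 / 10 * d by lra.
have [|Phi HPhi] := @kernel_primitive R (cell_center a b) (cell_center a' b') _ _ h1 h2; last first.
  by apply: cell_int0 HPhi; lra.
move=> z cz /= zE; move: cz; rewrite zE => -[/=].
have far (p q : nat) : p != q -> `|p%:R * d - q%:R * d| < 9 / 10 * d -> False.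
  rewrite ltr_norml neq_ltn => /orP[] pq; have : p.+1%:R <= q%:R :> R \/ q.+1%:R <= p%:R :> R.
  - by left; rewrite ler_nat.
  - by move=> [h|h]; have := ler_wpM2r (ltW dpos) h; rewrite -natr1; lra.
  - by right; rewrite ler_nat.
  - by move=> [h|h]; have := ler_wpM2r (ltW dpos) h; rewrite -natr1; lra.
have E (p q : nat) : - B + p%:R * d + d / 2 - (- B + q%:R * d + d / 2) = p%:R * d - q%:R * d by ring.
by rewrite !E; case/orP: ab => /far; [move=> H /H | move=> H _ /H].
Qed.

End cells.

(** * Cauchy's theorem and formula for curves homologous to zero *)

Section homologous_cauchy.
Context {R : realType}.
Context (g : R -> R[i]) (v : R -> R).
Hypotheses (gv : dominates_variation v g) (gc : icont g) (g01 : g 0 = g 1).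

Lemma icont_kernel w : (forall s, 0 <= s <= 1 -> g s <> w) ->
  icont (fun t => cauchy_kernel w (g t)).
Proof. by move=> gw; apply: icont_comp => // s ss; apply: kernel_ccont; apply: gw. Qed.

(** Off the curve the derivative of the winding number is the integral of
    1/(z-w)^2, which vanishes because that function has a primitive. *)
Lemma winding_deriv0 w (eta : R) : 0 < eta ->
  (forall s, 0 <= s <= 1 -> ~ sq (g s) eta w) ->
  cderiv (fun w => contour_integral g (cauchy_kernel w)) w 0.
Proof.
move=> eta0 far.
have L0 := variation_ge0 gv; set L := v 1 - v 0 in L0.
have nfar s : 0 <= s <= 1 -> eta <= nr (w - g s) by move=> ss; apply/notin_sq_nr/far.
have gw s : 0 <= s <= 1 -> g s <> w.
  by move=> ss E; have := nfar s ss; rewrite E subrr nr0; lra.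
pose k2 z := cauchy_kernel w z * cauchy_kernel w z.
have ck2 s : 0 <= s <= 1 -> ccont k2 (g s).
  by move=> ss; apply: ccontM; apply: kernel_ccont; apply: gw.
have ik2 : contour_integral g k2 = 0.
  apply: (@contour_integral_primitive _ g v gv gc k2 (fun z => 0 - cauchy_kernel w z) (~` [set w]) eta) => //.
    by move=> s ss z zs /= zw; apply: (far s ss); rewrite -zw.
  move=> z /= zw; have -> : k2 z = 0 - - (z - w) ^- 2 by rewrite sub0r opprK /k2 /cauchy_kernel -invfM -expr2.
  apply: cderivB; last exact: cderiv_inv.
  exact: cderiv_cst.
move=> e e0.
pose M := 2 / eta ^+ 3 * L.
have M0 : 0 <= M by rewrite mulr_ge0 ?divr_ge0 ?exprn_ge0 // ltW.
exists (Num.min (eta / 2) (e / (M + 1))).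
  by rewrite lt_min !divr_gt0 // ltr_wpDl.
move=> p; rewrite lt_min => /andP[pw1 pw2].
rewrite mul0r subr0.
have nfarp s : 0 <= s <= 1 -> eta / 2 <= nr (p - g s).
  move=> ss; have := nr_dist p w (g s); have := nfar s ss; rewrite [nr (w - p)]nr_sym; lra.
have gp s : 0 <= s <= 1 -> g s <> p.
  by move=> ss E; have := nfarp s ss; rewrite E subrr nr0; lra.
have Rc := @seq_complete_complex R.
pose h1 z : R[i] := 1 *: cauchy_kernel p z + (- 1) *: cauchy_kernel w z.
pose h z : R[i] := 1 *: h1 z + (- (p - w)) *: k2 z.
have ch1 s : 0 <= s <= 1 -> ccont h1 (g s).
  move=> ss; apply: ccontD; apply: ccontM; try exact: ccont_cst.
    by apply: kernel_ccont; apply: gp.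
  by apply: kernel_ccont; apply: gw.
have ch s : 0 <= s <= 1 -> ccont h (g s).
  move=> ss; apply: ccontD; apply: ccontM; try exact: ccont_cst; [exact: ch1 | exact: ck2].
have -> : contour_integral g (cauchy_kernel p) - contour_integral g (cauchy_kernel w) = contour_integral g h.
  rewrite (contour_integral_lin gv Rc (icont_comp gc ch1) (icont_comp gc ck2) (icont_comp gc ch)).
  rewrite ik2 scaler0 addr0 scale1r.
  rewrite (contour_integral_lin gv Rc (icont_kernel gp) (icont_kernel gw) (icont_comp gc ch1)).
  by rewrite scale1r scaleN1r.
set N := nr (p - w) in pw1 pw2 *.
have N0 : 0 <= N := nr_ge0 _.
have := @contour_integral_bound _ g v gv _ Rc h (N ^+ 2 * (2 / eta ^+ 3)) (icont_comp gc ch) _.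
rewrite -mulrA -/L -/M => H; apply: (le_trans (H _)); last first.
  rewrite expr2 -mulrA [e * N]mulrC ler_wpM2l //.
  move: pw2; rewrite ltr_pdivlMr ?ltr_wpDl // mulrDr mulr1; move: (N * M) => NM; lra.
move=> s ss.
have a0 : g s - w != 0 by rewrite subr_eq0; apply/eqP/gw.
have b0 : g s - p != 0 by rewrite subr_eq0; apply/eqP/gp.
have -> : h (g s) = (p - w) ^+ 2 * ((g s - p)^-1 * (g s - w) ^- 2).
  rewrite /h /h1 /k2 /cauchy_kernel !scale1r scaleN1r -[_ *: _]/(_ * _).
  by field; rewrite a0 b0.
rewrite nrM expr2 nrM -/N -expr2 ler_wpM2l ?sqr_ge0 //.
rewrite !(nrM, nrV, expr2).
have nA := nfarp s ss; rewrite nr_sym in nA; have nB := nfar s ss; rewrite nr_sym in nB.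
have -> : 2 / eta ^+ 3 = (eta / 2)^-1 * (eta * eta)^-1 by field; rewrite gt_eqF.
apply: ler_pM; rewrite ?invr_ge0 ?mulr_ge0 ?nr_ge0 //.
  by rewrite lef_pV2 ?posrE //; lra.
rewrite lef_pV2 ?posrE ?mulr_gt0 //; try lra.
by apply: ler_pM => //; lra.
Qed.

Lemma winding_const w0 w (rho eta : R) : 0 < eta -> sq w rho w0 -> 0 < rho ->
  (forall p, sq w rho p -> forall s, 0 <= s <= 1 -> ~ sq (g s) eta p) ->
  contour_integral g (cauchy_kernel w) = contour_integral g (cauchy_kernel w0).
Proof.
move=> eta0 ww rho0 far; apply/eqP; rewrite -subr_eq0 -nr_eq0 eq_le nr_ge0 andbT.
rewrite -[leRHS](mul0r (nr (w - w0))).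
have -> : contour_integral g (cauchy_kernel w) - contour_integral g (cauchy_kernel w0) =
  contour_integral g (cauchy_kernel w) - contour_integral g (cauchy_kernel w0) - 0 * (w - w0).
  by rewrite mul0r subr0.
apply: (@segment_mean_value _ (fun _ => 0) (fun w => contour_integral g (cauchy_kernel w))) => s ss; last first.
  by rewrite subrr nr0.
apply: (winding_deriv0 eta0) => t tt; apply: far => //.
by apply: sq_convex => //; apply: sq_center.
Qed.

Lemma trace_margin (G : set R[i]) :
  (forall z, G z -> exists2 r : R, 0 < r & sq z r `<=` G) ->
  (forall s, 0 <= s <= 1 -> G (g s)) ->
  exists2 rho : R, 0 < rho & forall s, 0 <= s <= 1 -> sq (g s) rho `<=` G.
Proof.
move=> oG gG.
apply: (uniform_radius (Q := fun s rho => sq (g s) rho `<=` G)) => //.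
  by move=> s d d' _ /sub_sq dd; apply: subset_trans.
move=> s ss; have [r r0 rG] := oG _ (gG s ss); have r20 : 0 < r / 3 by lra.
have [d d0 gd] := gc ss r20; exists d => //; exists (r / 2); first lra.
move=> t tt ts z [z1 z2]; apply: rG; have gt := gd t tt ts.
have := le_trans (nr_Re _) gt; have := le_trans (nr_Im _) gt; rewrite !raddfB /= => h2 h1.
split.
  by apply: (le_lt_trans (ler_distD (complex.Re (g t)) _ _)); lra.
by apply: (le_lt_trans (ler_distD (complex.Im (g t)) _ _)); lra.
Qed.

Lemma trace_bounded : exists B : R, forall s, 0 <= s <= 1 ->
  `|complex.Re (g s)| < B /\ `|complex.Im (g s)| < B.
Proof.
have [K _ HK] := icont_bounded gc.
exists (K + 1) => s ss; have := HK s ss; have := nr_Re (g s); have := nr_Im (g s); lra.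
Qed.

(** The integral is a combination of integrals over the boundaries of lattice
    cells, with coefficients that do not depend on the integrand.  A cell that
    is not well inside G has coefficient zero: testing with the kernel at its
    centre gives a multiple of the winding number, which agrees with that around
    a nearby point outside G. *)
Theorem cauchy_homologous (G : set R[i]) (F : R[i] -> R[i]) :
  (forall z, G z -> exists2 r : R, 0 < r & sq z r `<=` G) ->
  (forall s, 0 <= s <= 1 -> G (g s)) ->
  (forall w, ~ G w -> contour_integral g (cauchy_kernel w) = 0) ->
  (forall z, G z -> ccont F z) -> locally_primitive G F ->
  contour_integral g F = 0.
Proof.
move=> oG gG wind Fc Fp.
have [rho rho0 rhoG] := trace_margin oG gG.
have [B gB] := trace_bounded.
(* curve_lattice needs primitives on squares of size 10 d about the curve.  The
   centre of a cell that is not well inside G is within 2 d of a point outside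
   G, hence at least 16 d away from the curve. *)
pose d := rho / 20.
have [d0 rhoE] : 0 < d /\ rho = 20 * d by rewrite /d; split; [rewrite divr_gt0 | field].
clearbody d.
have [N [c Hc]] := @curve_lattice R B d d0 g v gv gc g01 gB (10 * d) ltac:(lra).
rewrite (Hc F); last first.
- by move=> s ss; apply: (Fp _ _ (20 * d)); [lra | lra | rewrite -rhoE; apply: rhoG].
- by move=> s ss; apply/Fc/gG.
rewrite big_nat big1 // => a /= aN; rewrite big_nat big1 // => b /= bN.
set w := cell_center B d a b.
have [wG|nwG] := pselect (sq w (2 * d) `<=` G).
  have [||Phi HPhi] := Fp w d (2 * d) _ _ wG; [lra|lra|].
  by rewrite (cell_int0 d0 _ HPhi) ?mulr0 //; lra.
have [w0 ww0 nGw0] : exists2 w0, sq w (2 * d) w0 & ~ G w0.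
  by apply: contrapT => H; apply: nwG => z zw; apply: contrapT => nz; apply: H; exists z.
have far p : sq w (2 * d) p -> forall s, 0 <= s <= 1 -> ~ sq (g s) (16 * d) p.
  move=> [p1 p2] s ss [q1 q2]; apply: nGw0; apply: (rhoG s ss); rewrite rhoE; case: ww0 => r1 r2.
  move: p1 p2 q1 q2 r1 r2; rewrite !ltr_norml => p1 p2 q1 q2 r1 r2.
  by split; rewrite ltr_norml; lra.
have d2 : 0 < 2 * d by lra. have d16 : 0 < 16 * d by lra.
have := winding_const d16 ww0 d2 far; rewrite (wind w0 nGw0).
have farw := far w (sq_center w d2).
rewrite (Hc (cauchy_kernel w)); last first.
- move=> s ss; apply: (@kernel_primitive R w _ _ (16 * d)); [lra|lra|].
  by move=> z zs /= zw; apply: (farw s ss); rewrite -zw.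
- move=> s ss; apply: kernel_ccont => E; apply: (farw s ss); rewrite -E; exact: sq_center.
rewrite (bigD1_seq a) ?mem_index_iota ?iota_uniq //= [X in _ + X]big1 ?addr0; last first.
  move=> a' aa'; rewrite big1 // => b' _.
  by rewrite (cell_other_kernel B d0) ?mulr0 // eq_sym aa'.
rewrite (bigD1_seq b) ?mem_index_iota ?iota_uniq //= [X in _ + X]big1 ?addr0; last first.
  move=> b' bb'.
  by rewrite (cell_other_kernel B d0) ?mulr0 // [b == _]eq_sym bb' orbT.
move/eqP; rewrite mulf_eq0 (negbTE (cell_center_kernel B d0 a b)) orbF => /eqP ->.
by rewrite mul0r.
Qed.

End homologous_cauchy.

Section topology_bridge.
Context {R : realType}.

Lemma gt0_complexE (e : R[i]) : 0 < e -> exists2 r : R, 0 < r & e = r%:C.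
Proof. by case: e => a b; rewrite ltcE /= => /andP[/eqP b0 a0]; exists a; rewrite ?b0. Qed.

Lemma cderiv_derivable (f : R[i] -> R[i]) (z : R[i]) : derivable f z 1 -> cderiv f z (derive1 f z).
Proof.
move=> df e e0; set d := derive1 f z.
have := cvg_toP df (erefl _); rewrite -[lim _]/('D_1 f z) -derive1E -/d.
move=> /cvgrPdist_le/(_ e%:C); rewrite ltcR => /(_ e0).
rewrite /dnbhs near_withinE => /nbhs_ballP[_ /= /gt0_complexE[r r0 ->] Hr].
exists r => // w wz.
have [->|wnz] := eqVneq w z; first by rewrite !subrr mulr0 subr0 nr0 mulr0.
have wz0 : w - z != 0 by rewrite subr_eq0.
have := Hr (w - z); rewrite -ball_normE /ball_ /= sub0r normrN nr_lt => /(_ wz wz0).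
rewrite [(w - z) *: 1]mulr1 subrK nr_le -[_ *: (_ - _)]/((w - z)^-1 * _) => He.
have -> : f w - f z - d * (w - z) = - ((w - z) * (d - (w - z)^-1 * (f w - f z))).
  by field.
by rewrite nrN nrM mulrC ler_wpM2r ?nr_ge0.
Qed.

Lemma open_sq (G : set R[i]) : open G -> forall z, G z -> exists2 r : R, 0 < r & sq z r `<=` G.
Proof.
move=> oG z Gz; have := open_nbhs_nbhs (conj oG Gz).
move=> /nbhs_ballP[_ /= /gt0_complexE[r r0 ->] Hr]; exists (r / 2); first lra.
move=> w wz; apply: Hr; rewrite -ball_normE /ball_ /= nr_lt nr_sym.
have := nr_sq wz; lra.
Qed.

Lemma icont_within (g : R -> R[i]) : {within `[0, 1], continuous g} -> icont g.
Proof.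
move=> gc x xx e e0.
have /cvgrPdist_le/(_ e%:C) := gc x; rewrite ltcR => /(_ e0).
move=> H.
have xI : `[0, 1]%classic x by rewrite /= in_itv.
have [V /nbhs_ballP[d /= d0 Hd] VE] := (nbhs_subspace_ex _ xI).1 H.
exists d => // y yy yx; rewrite nr_sym -nr_le.
have : (V `&` `[0, 1]%classic) y.
  by split; [apply: Hd; rewrite /ball /= distrC | rewrite /= in_itv].
by rewrite -VE => -[].
Qed.

End topology_bridge.

Section cauchy_formula.
Context {R : realType}.

Lemma contour_integral_ext (V : normedModType R[i]) (g : R -> R[i]) (h1 h2 : R[i] -> V) :
  (forall s, 0 <= s <= 1 -> h1 (g s) = h2 (g s)) ->
  contour_integral g h1 = contour_integral g h2.
Proof.
have sub (k1 k2 : R[i] -> V) y : (forall s, 0 <= s <= 1 -> k1 (g s) = k2 (g s)) ->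
    is_contour_integral g k1 y -> is_contour_integral g k2 y.
  move=> E H e /H[d d0 Hd]; exists d => // s tag sp Hs.
  have T := node_tagged sp Hs.
  have -> : \sum_(0 <= k < size s) (g (node s k.+1) - g (node s k)) *: k2 (g (tag k)) =
     \sum_(0 <= k < size s) (g (node s k.+1) - g (node s k)) *: k1 (g (tag k)).
    apply: eq_big_nat => k /andP[_ ks]; rewrite E //.
    have [_ _ /(_ k ks)[_ _ hk]] := T.
    by have := tagged_bounds T (ltnW ks); have := tagged_bounds T ks; lra.
  exact: Hd.
move=> E; rewrite /contour_integral; congr (xget 0 _); apply/seteqP; split=> y; apply: sub => //.
by move=> s ss; rewrite E.
Qed.

Lemma cderivM (F G : R[i] -> R[i]) z d1 d2 : cderiv F z d1 -> cderiv G z d2 ->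
  cderiv (fun w => F w * G w) z (d1 * G z + F z * d2).
Proof.
move=> H1 H2 e e0.
set K := nr (G z) + 1 + nr d1 + nr (F z) + 1.
have K0 : 0 < K by rewrite /K; have := nr_ge0 (G z); have := nr_ge0 d1; have := nr_ge0 (F z); lra.
have e10 : 0 < e / K by rewrite divr_gt0.
set e1 := e / K in e10.
have [r1 r10 {}H1] := H1 _ e10; have [r2 r20 H2'] := H2 _ e10.
pose e2 := Num.min 1 e1; have e20 : 0 < e2 by rewrite lt_min ltr01.
have [r3 r30 H3] := ccont_cderiv H2 e20.
have [e21 e2e1] : e2 <= 1 /\ e2 <= e1 by rewrite /e2 !ge_min !lexx orbT.
exists (Num.min r1 (Num.min r2 r3)); first by rewrite !lt_min r10 r20.
move=> w; rewrite !lt_min => /and3P[/H1 h1 /H2' h2 /H3 h3].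
set N := nr (w - z) in h1 h2 *; have N0 : 0 <= N := nr_ge0 _.
have -> : F w * G w - F z * G z - (d1 * G z + F z * d2) * (w - z) =
  (F w - F z - d1 * (w - z)) * G w + d1 * (w - z) * (G w - G z) + F z * (G w - G z - d2 * (w - z)) by ring.
have Gw : nr (G w) <= nr (G z) + 1.
  by have := nr_triangle (G w - G z) (G z); rewrite subrK; lra.
apply: (le_trans (nr_triangle _ _)).
have := nr_triangle ((F w - F z - d1 * (w - z)) * G w) (d1 * (w - z) * (G w - G z)).
rewrite !nrM -/N.
have a1 : nr (F w - F z - d1 * (w - z)) * nr (G w) <= e1 * N * (nr (G z) + 1) by apply: ler_pM; rewrite ?nr_ge0.
have a2 : nr d1 * N * nr (G w - G z) <= nr d1 * N * e1.
  by rewrite ler_wpM2l ?mulr_ge0 ?nr_ge0 //; lra.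
have a3 : nr (F z) * nr (G w - G z - d2 * (w - z)) <= nr (F z) * (e1 * N) by rewrite ler_wpM2l ?nr_ge0.
have -> : e = e1 * K by rewrite divfK // gt_eqF.
have : 0 <= e1 * N by rewrite mulr_ge0 // ltW.
rewrite /K; move: a1 a2 a3; clearbody e1; clear; nra.
Qed.

Lemma cderiv_local (F G : R[i] -> R[i]) z d (r : R) : 0 < r ->
  (forall w, nr (w - z) < r -> F w = G w) -> cderiv F z d -> cderiv G z d.
Proof.
move=> r0 FG H e e0; have [r' r'0 Hr] := H e e0.
exists (Num.min r r'); first by rewrite lt_min r0.
move=> w; rewrite lt_min => /andP[wr wr']; rewrite -!FG ?subrr ?nr0 //.
exact: Hr.
Qed.

Definition diff_quotient (f : R[i] -> R[i]) (t d z : R[i]) : R[i] :=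
  if z == t then d else (f z - f t) * cauchy_kernel t z.

Lemma diff_quotient_almost_holomorphic (G : set R[i]) (f : R[i] -> R[i]) t d :
  (forall z, G z -> exists d, cderiv f z d) -> cderiv f t d ->
  almost_holomorphic G t (diff_quotient f t d).
Proof.
move=> fG ft.
have D z : G z -> z <> t -> exists d', cderiv (diff_quotient f t d) z d'.
  move=> Gz zt; have [d1 H1] := fG z Gz.
  exists ((d1 - 0) * cauchy_kernel t z + (f z - f t) * (- (z - t) ^- 2)).
  have zt0 : 0 < nr (z - t) by rewrite nr_gt0 subr_eq0; apply/eqP.
  apply: (cderiv_local zt0 (F := fun z => (f z - f t) * cauchy_kernel t z)).
    move=> w wz; rewrite /diff_quotient; case: eqP => // wt.
    by move: wz; rewrite wt nr_sym ltxx.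
  apply: cderivM; last exact: cderiv_inv.
  by apply: cderivB => //; exact: cderiv_cst.
split=> // z Gz; have [->|/eqP zt] := eqVneq z t; last by have [d' /ccont_cderiv] := D z Gz zt.
move=> e e0; have [r r0 Hr] := ft e e0; exists r => // w wt.
rewrite /diff_quotient eqxx; case: eqVneq => [_|wnt]; first by rewrite subrr nr0 ltW.
have wt0 : w - t != 0 by rewrite subr_eq0.
have -> : (f w - f t) * cauchy_kernel t w - d = (f w - f t - d * (w - t)) / (w - t).
  by rewrite /cauchy_kernel; field.
by rewrite nrM nrV ler_pdivrMr ?nr_gt0 //; apply: Hr.
Qed.

Lemma winding_integral (g : R -> R[i]) w k : k != 0 -> winding_number g w = k ->
  (two_pi_i : R[i]) != 0 /\ contour_integral g (cauchy_kernel w) = two_pi_i * k.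
Proof.
rewrite /winding_number => k0 H.
have t0 : (two_pi_i : R[i]) != 0 by apply: contraNneq k0 => t0; rewrite -H t0 invr0 mul0r.
by split => //; rewrite -H mulrA mulfV // mul1r.
Qed.

(** The difference quotient of f at t is holomorphic off t and continuous at t,
    so its integral vanishes, and the integral of f(z)/(z-t) is f(t) times that
    of 1/(z-t).  That t has winding number one forces two_pi_i to be nonzero. *)
Theorem cauchy_formula (G S : set R[i]) (f : R[i] -> R[i]) (g : R -> R[i]) v t :
  open G -> analytic_on G f -> contour_around G S g -> dominates_variation v g -> S t ->
  [/\ (two_pi_i : R[i]) != 0, G t, forall s, 0 <= s <= 1 -> g s <> t &
    contour_integral g (fun z => f z *: cauchy_kernel t z) = two_pi_i * f t].
Proof.
move=> oG fG [[gc g01 _] gG Sg Gg] gv St.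
have ic := icont_within gc.
have [ntr wt] := Sg t St.
have [t0 It] := winding_integral (oner_neq0 _) wt.
have Gt : G t.
  by apply: contrapT => /Gg[_ ]; rewrite wt => /eqP; rewrite oner_eq0.
have intr s : 0 <= s <= 1 -> trace_of g (g s) by move=> ss; exists s => //; rewrite /= in_itv.
have gt s : 0 <= s <= 1 -> g s <> t by move=> ss E; apply: ntr; rewrite -E; exact: intr.
have gGs s : 0 <= s <= 1 -> G (g s) by move=> ss; apply: gG; exact: intr.
split => //.
have df z : G z -> cderiv f z (derive1 f z) by move=> /fG; exact: cderiv_derivable.
have ah := diff_quotient_almost_holomorphic (fun z Gz => ex_intro _ _ (df z Gz)) (df t Gt).
set F := diff_quotient f t (derive1 f t) in ah.
have F0 : contour_integral g F = 0.
  apply: (@cauchy_homologous _ g v gv ic g01 G) => //; first exact: open_sq.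
  - move=> w nGw; have [_] := Gg w nGw; rewrite /winding_number => /eqP.
    by rewrite mulf_eq0 invr_eq0 (negbTE t0) /= => /eqP.
  - by move=> z Gz; have [Fc _] := ah; apply: Fc.
  - exact: almost_holomorphic_primitive ah.
have Rc := @seq_complete_complex R.
have cf s : 0 <= s <= 1 -> ccont f (g s) by move=> ss; apply/(ccont_cderiv (df _ _))/gGs.
have ck s : 0 <= s <= 1 -> ccont (cauchy_kernel t) (g s) by move=> ss; apply/kernel_ccont/gt.
have cF s : 0 <= s <= 1 -> ccont F (g s) by move=> ss; have [Fc _] := ah; apply/Fc/gGs.
have E : contour_integral g (fun z => f z *: cauchy_kernel t z) =
         contour_integral g (fun z => 1 *: F z + f t *: cauchy_kernel t z).
  apply: contour_integral_ext => s ss; rewrite /F /diff_quotient ifN; last exact/eqP/gt.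
  have scE (k x : R[i]) : k *: x = k * x by [].
  by rewrite !scE; ring.
rewrite E (contour_integral_lin gv Rc).
- by rewrite F0 scaler0 add0r It mulr1 -[_ *: _]/(_ * _) mulrC.
- by apply: (icont_comp ic).
- by apply: (icont_comp ic).
- apply: (@icont_comp _ g ic _ (fun z => 1 *: F z + f t *: cauchy_kernel t z)) => s ss.
  by apply: ccontD; apply: ccontM; try exact: ccont_cst; [exact: cF | exact: ck].
Qed.

End cauchy_formula.

(** * Inverses and the spectral radius *)

(** A name for A that carries the ring structure of bmul and bone.  It depends
    on nz because rings are required to be nontrivial. *)
Definition unital_ring (K : numClosedFieldType) (A : banachStarAlgType K)
  (nz : (bone : A) != 0) : Type := A.

Section unital_ring_instances.
Variables (K : numClosedFieldType) (A : banachStarAlgType K) (nz : (bone : A) != 0).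
Local Notation B := (unital_ring nz).

HB.instance Definition _ := NormedModule.on B.
HB.instance Definition _ := GRing.Zmodule_isNzRing.Build B (@bmulA K A) (@bmul1a K A)
  (@bmula1 K A) (@bmulDl K A) (@bmulDr K A) nz.

Let unital_scalerAl (k : K) (x y : B) : k *: (x * y) = (k *: x) * y.
Proof. by rewrite -[RHS]/(bmul _ _) bmulZl. Qed.

Let unital_scalerAr (k : K) (x y : B) : k *: (x * y) = x * (k *: y).
Proof. by rewrite -[RHS]/(bmul _ _) bmulZr. Qed.

HB.instance Definition _ := GRing.Lmodule_isLalgebra.Build K B unital_scalerAl.
HB.instance Definition _ := GRing.Lalgebra_isAlgebra.Build K B unital_scalerAr.

End unital_ring_instances.

Section inverses.
Context {R : realType} {A : banachStarAlgType R[i]} {nz : (bone : A) != 0}.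
Local Notation B := (unital_ring nz).
Implicit Types x y a : B.

Lemma invertibleP x : invertible x <-> exists y, x * y = 1 /\ y * x = 1.
Proof. by []. Qed.

Lemma is_inverse_binv x : invertible x -> x * (binv x : B) = 1 /\ (binv x : B) * x = 1.
Proof.
move=> [y Hy]; rewrite /binv; case: xgetP => [z _ Hz|/(_ y)/(_ Hy)//]; exact: Hz.
Qed.

Lemma inverse_unique x y a : x * y = 1 -> a * x = 1 -> a = y.
Proof. by move=> xy ax; rewrite -[a]mulr1 -xy mulrA ax mul1r. Qed.

Lemma inverse_comm x y a : x * y = 1 -> y * x = 1 -> GRing.comm a x -> GRing.comm a y.
Proof.
move=> xy yx ax; rewrite /GRing.comm -[a * y]mul1r -yx -!mulrA; congr (y * _).
by rewrite !mulrA -ax -mulrA xy mulr1.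
Qed.

Lemma invertibleM x y : invertible x -> invertible y -> invertible (x * y).
Proof.
move=> /invertibleP[x' [h1 h2]] /invertibleP[y' [h3 h4]]; apply/invertibleP; exists (y' * x').
split; first by rewrite mulrA -[x * y * y']mulrA h3 mulr1.
by rewrite mulrA -[y' * x' * x]mulrA h2 mulr1.
Qed.

Lemma invertible_factor x y : GRing.comm x y -> invertible (x * y) -> invertible x.
Proof.
move=> xy /invertibleP[z [h1 h2]]; apply/invertibleP; exists (y * z); split; first by rewrite mulrA.
have cx : GRing.comm x z by apply: (inverse_comm h1 h2); rewrite /GRing.comm -mulrA -xy.
by rewrite -mulrA -cx mulrA -xy h1.
Qed.

Lemma invertibleZ (k : R[i]) x : k != 0 -> invertible x -> invertible (k *: x).
Proof.
move=> k0 /invertibleP[y [h1 h2]]; apply/invertibleP; exists (k^-1 *: y).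
by rewrite -!scalerAl -!scalerAr !scalerA mulfV // mulVf // !scale1r.
Qed.

Definition involution x : B := star (x : A).

Lemma involution1 : involution 1 = 1.
Proof.
have E : star (bone : A) = bone.
  by rewrite -[LHS]bmul1a -{1}[bone]starK -starM bmul1a starK.
exact: E.
Qed.

Lemma involutionM x y : involution (x * y) = involution y * involution x.
Proof. exact: starM. Qed.

Lemma involutionD x y : involution (x + y) = involution x + involution y.
Proof. exact: starD. Qed.

Lemma involutionZ (k : R[i]) x : involution (k *: x) = Num.conj k *: involution x.
Proof. exact: starZ. Qed.

Lemma involutionK x : involution (involution x) = x.
Proof. exact: starK. Qed.

Lemma invertible_involution x : invertible x -> invertible (involution x).
Proof.
move=> /invertibleP[y [h1 h2]]; apply/invertibleP; exists (involution y).
by rewrite -!involutionM h1 h2 involution1.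
Qed.

Lemma nr_mul x y : nr (x * y) <= nr x * nr y.
Proof. by rewrite -lecR rmorphM /= -!nrE; exact: norm_bmul. Qed.

Lemma nr_exp x n : nr (x ^+ n.+1) <= nr x ^+ n.+1.
Proof.
elim: n => [|n IH]; first by rewrite !expr1.
rewrite exprS [leRHS]exprS; apply: (le_trans (nr_mul _ _)).
by rewrite ler_wpM2l ?nr_ge0.
Qed.

Lemma pow_small (q e : R) : 0 <= q -> q < 1 -> 0 < e ->
  exists N, forall n, (N <= n)%N -> q ^+ n <= e.
Proof.
move=> q0 q1 e0.
have : (fun n => q ^+ n) @ \oo --> (0 : R) by apply: cvg_expr; rewrite ger0_norm.
move=> /cvgrPdist_le/(_ e e0)[N _ HN]; exists N => n /HN /=.
by rewrite sub0r normrN ger0_norm ?exprn_ge0.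
Qed.

(** The series starts at x rather than at 1, since the norm of the unit may be
    any number from 1 upwards and nr_exp fails for the exponent 0. *)
Lemma neumann x : nr x < 1 -> invertible (1 - x).
Proof.
move=> x1; set q := nr x in x1; have q0 : 0 <= q := nr_ge0 _.
pose u n := \sum_(0 <= k < n.+1) x ^+ k.+1.
have tail n m : (n <= m)%N -> nr (u m - u n) <= q ^+ n / (1 - q).
  move=> nm; have -> : u m - u n = \sum_(0 <= k < m - n) x ^+ (n.+1 + k).+1.
    rewrite /u (@big_cat_nat _ _ _ n.+1 0 m.+1) //= addrAC subrr add0r.
    by rewrite -{1}[n.+1]add0n big_addn subSS; apply: eq_bigr => k _; rewrite addnC.
  apply: (le_trans (nr_sum _ _)).
  apply: (@le_trans _ _ (\sum_(0 <= k < m - n) q ^+ n * q ^+ k)).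
    apply: ler_sum => k _; apply: (le_trans (nr_exp _ _)); rewrite -/q -exprD.
    by rewrite ler_wiXn2l ?(ltW x1) //; lia.
  rewrite -mulr_sumr ler_wpM2l ?exprn_ge0 //.
  have := subrX1 q (m - n); rewrite big_mkord => E.
  rewrite -[leRHS]mul1r ler_pdivlMr ?subr_gt0 // -opprB mulrN mulrC -E opprB gerBl.
  exact: exprn_ge0.
have q1 : 0 < 1 - q by rewrite subr_gt0.
have [y Hy] : exists y : B, forall e : R, 0 < e -> exists N, forall n, (N <= n)%N -> nr (u n - y) <= e.
  apply: (@seq_complete_banach _ (A : completeNormedModType _)) => e e0.
  have [N HN] := pow_small q0 x1 (mulr_gt0 e0 q1); exists N.
  have HN' n : (N <= n)%N -> q ^+ n / (1 - q) <= e by move=> Nn; rewrite ler_pdivrMr // HN.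
  move=> m n Nm Nn; have [mn|nm] := leqP m n.
    by rewrite nr_sym; apply: (le_trans (tail _ _ mn)); apply: HN'.
  by apply: (le_trans (tail _ _ (ltnW nm))); apply: HN'.
have ux n : u n * x = x * u n by rewrite /u mulr_suml mulr_sumr; apply: eq_bigr => k _; rewrite -exprSr exprS.
have uE n : (1 - x) * (1 + u n) = 1 - x ^+ n.+2.
  have := subrX1 x n.+2; rewrite -(big_mkord xpredT (fun i => x ^+ i)) big_nat_recl //= expr0 => E.
  by rewrite -opprB mulNr -/(u n) -E opprB.
have lim0 (a b : B) : (forall n, nr (a - b) <= nr (1 - x) * nr (u n - y) + q ^+ n.+2) -> a = b.
  move=> H; apply: nr_sub_eq0 => e e0.
  have K0 : 0 < nr (1 - x) + 1 by rewrite ltr_wpDl ?nr_ge0.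
  have [N1 H1] := Hy (e / 2 / (nr (1 - x) + 1)) ltac:(by rewrite !divr_gt0).
  have [N2 H2] := pow_small q0 x1 (ltac:(lra) : 0 < e / 2).
  pose n := maxn N1 N2; apply: (le_trans (H n)).
  have := H1 n (leq_maxl _ _); rewrite ler_pdivlMr // => h1.
  have := H2 n.+2 (leqW (leqW (leq_maxr _ _))) => h2.
  have := nr_ge0 (u n - y); move: h1 h2; rewrite mulrDr mulr1 mulrC; lra.
apply/invertibleP; exists (1 + y); split; apply: lim0 => n.
  have -> : (1 - x) * (1 + y) - 1 = - ((1 - x) * (u n - y)) - x ^+ n.+2.
    have -> : x ^+ n.+2 = 1 - (1 - x) * (1 + u n) by rewrite uE opprB addrC subrK.
    rewrite opprB addrA; congr (_ - 1); rewrite addrC -mulrBr; congr (_ * _).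
    by rewrite opprB addrA [1 + u n + y]addrAC addrK.
  apply: (le_trans (nrB _ _)); rewrite nrN; apply: lerD; first exact: nr_mul.
  exact: nr_exp.
have -> : (1 + y) * (1 - x) - 1 = - ((u n - y) * (1 - x)) - x ^+ n.+2.
  have uE' : (1 + u n) * (1 - x) = 1 - x ^+ n.+2.
    by rewrite -uE mulrBr mulr1 mulrBl mul1r mulrDl mulrDr mul1r mulr1 ux.
  have -> : x ^+ n.+2 = 1 - (1 + u n) * (1 - x) by rewrite uE' opprB addrC subrK.
  rewrite opprB addrA; congr (_ - 1); rewrite addrC -mulrBl; congr (_ * _).
  by rewrite opprB addrA [1 + u n + y]addrAC addrK.
apply: (le_trans (nrB _ _)); rewrite nrN; apply: lerD; last exact: nr_exp.
by rewrite mulrC; exact: nr_mul.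
Qed.

End inverses.

Section bounded_square.
Context {R : realType}.

Lemma locally_bounded_square (F : R -> R -> R) :
  (forall a b, -1 <= a <= 1 -> -1 <= b <= 1 -> exists2 d : R, 0 < d & exists K,
     forall a' b', -1 <= a' <= 1 -> -1 <= b' <= 1 -> `|a' - a| < d -> `|b' - b| < d -> F a' b' <= K) ->
  exists K, forall a b, -1 <= a <= 1 -> -1 <= b <= 1 -> F a b <= K.
Proof.
move=> loc; have n11 : -1 <= (1 : R) by lra.
have [|a aa|d d0 Fd] := uniform_radius (Q := fun a d => forall b, -1 <= b <= 1 -> F a b <= d^-1) n11.
- move=> a d d' d0 dd H b bb; apply: (le_trans (H b bb)).
  by rewrite lef_pV2 ?posrE // (lt_le_trans d0).
- have [|b bb|d d0 Fd] := uniform_radius (Q := fun b d =>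
      forall a', -1 <= a' <= 1 -> `|a' - a| < d -> F a' b <= d^-1) n11.
  + move=> b d d' d0 dd H a' ha h; apply: (le_trans (H a' ha (lt_le_trans h dd))).
    by rewrite lef_pV2 ?posrE // (lt_le_trans d0).
  + have [r r0 [K HK]] := loc a b aa bb; exists r => //.
    have K0 : 0 < (Num.max K 1)^-1 by rewrite invr_gt0 lt_max ltr01 orbT.
    have m0 : 0 < Num.min r (Num.max K 1)^-1 by rewrite lt_min r0.
    exists (Num.min r (Num.max K 1)^-1) => // b' bb' b'b a' ha; rewrite lt_min => /andP[h _].
    apply: (le_trans (HK a' b' ha bb' h b'b)); apply: (@le_trans _ _ (Num.max K 1)).
      by rewrite le_max lexx.
    by rewrite -[leLHS]invrK lef_pV2 ?posrE // ge_min lexx orbT.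
  + by exists d => //; exists d => // a' ha h b bb; apply: Fd.
- by exists d^-1 => a b aa bb; apply: Fd.
Qed.

End bounded_square.

Section spectral_radius.
Context {R : realType} {A : banachStarAlgType R[i]} {nz : (bone : A) != 0}.
Local Notation B := (unital_ring nz).

Definition inverse (x : B) : B := binv (x : A).

Lemma inverseP (x : B) : invertible x -> x * inverse x = 1 /\ inverse x * x = 1.
Proof. exact: is_inverse_binv. Qed.

Lemma inverseE (x y : B) : x * y = 1 -> y * x = 1 -> inverse x = y.
Proof.
move=> xy yx; have [|h1 h2] := @inverseP x; first by exists y.
exact: (inverse_unique xy h2).
Qed.

Lemma resolvent_identity (a b : B) : invertible a -> invertible b ->
  inverse a - inverse b = inverse a * (b - a) * inverse b.
Proof.
move=> /inverseP[a1 a2] /inverseP[b1 b2].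
by rewrite mulrBr mulrBl a2 mul1r -mulrA b1 mulr1.
Qed.

Lemma nrX (z : R[i]) n : nr (z ^+ n) = nr z ^+ n.
Proof. by elim: n => [|n IH]; rewrite ?expr0 ?nr1 // !exprS nrM IH. Qed.

Variable y : B.
Hypothesis y_inv : forall z : R[i], nr z <= 1 -> invertible (1 - z *: y).

Definition resolv (z : R[i]) : B := inverse (1 - z *: y).

Lemma resolv_diff (w z : R[i]) : nr w <= 1 -> nr z <= 1 ->
  resolv w - resolv z = (w - z) *: (resolv w * y * resolv z).
Proof.
move=> w1 z1; rewrite /resolv resolvent_identity; try exact: y_inv.
have -> : 1 - z *: y - (1 - w *: y) = (w - z) *: y.
  by rewrite opprB addrC addrA subrK scalerBl.
by rewrite -scalerAr -scalerAl.
Qed.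

Lemma resolv_bounded : exists K : R, forall z : R[i], nr z <= 1 -> nr (resolv z) <= K.
Proof.
pose F a b := if nr (Complex a b : R[i]) <= 1 then nr (resolv (Complex a b)) else 0.
have [a b ha hb|K HK] := @locally_bounded_square R F; last first.
  exists K => -[a b] z1; have := HK a b; rewrite /F z1; apply.
    by have := nr_Re (Complex a b : R[i]); rewrite /= ler_norml; lra.
  by have := nr_Im (Complex a b : R[i]); rewrite /= ler_norml; lra.
have cl (a' b' d : R) : `|a' - a| < d -> `|b' - b| < d -> nr (Complex a' b' - Complex a b : R[i]) <= 2 * d.
  by move=> h1 h2; apply: (le_trans (nr_ReIm _)) => /=; lra.
have [z1|z1] := leP (nr (Complex a b : R[i])) 1; last first.
  exists ((nr (Complex a b : R[i]) - 1) / 2); first lra.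
  exists 0 => a' b' _ _ h1 h2; rewrite /F ifN // -ltNge.
  have := cl _ _ _ h1 h2; have := nr_triangle (Complex a b - Complex a' b' : R[i]) (Complex a' b').
  have hh : 0 <= nr (Complex a b : R[i]) - 1 by lra.
  rewrite subrK [nr (Complex a b - _)]nr_sym => n1 n2.
  have : `|a' - a| + `|b' - b| < nr (Complex a b : R[i]) - 1 by lra.
  have := nr_ReIm (Complex a' b' - Complex a b : R[i]); rewrite /=; lra.
set r0 := nr (resolv (Complex a b)).
have q0 : 0 < nr y * r0 + 1 by rewrite ltr_wpDl // mulr_ge0 ?nr_ge0.
exists ((nr y * r0 + 1)^-1 / 4); first by rewrite divr_gt0 ?invr_gt0.
exists (2 * r0) => a' b' _ _ h1 h2; rewrite /F.
case: ifP => w1; last by rewrite mulr_ge0 ?nr_ge0.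
have D := resolv_diff w1 z1.
have N := cl _ _ _ h1 h2.
set z := Complex a b in z1 r0 q0 h1 h2 D N *; set w := Complex a' b' in w1 D N *.
have E : nr (resolv w) <= r0 + nr (w - z) * (nr (resolv w) * nr y * r0).
  rewrite -[resolv w in leLHS](subrK (resolv z)) D addrC; apply: (le_trans (nr_triangle _ _)).
  rewrite lerD2l nrZ ler_wpM2l ?nr_ge0 //; apply: (le_trans (nr_mul _ _)).
  by rewrite ler_wpM2r ?nr_ge0 // nr_mul.
have N' : nr (w - z) * (nr y * r0) <= 1 / 2.
  apply: (@le_trans _ _ (2 * ((nr y * r0 + 1)^-1 / 4) * (nr y * r0 + 1))).
    apply: ler_pM => //; rewrite ?mulr_ge0 ?nr_ge0 //; lra.
  by apply: eq_leW; field; rewrite gt_eqF.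
have := nr_ge0 (resolv w); nra.
Qed.

Lemma root_minus1 p : exists2 u : R[i], nr u = 1 & u ^+ (2 ^ p) = -1.
Proof.
have p0 : (0 < 2 ^ p)%N by rewrite expn_gt0.
exists ((2 ^ p).-root (-1)); last by rewrite rootCK.
by apply/eqP; rewrite -(@pexpr_eq1 _ _ (2 ^ p)%N) ?nr_ge0 // -nrX rootCK // nrN nr1.
Qed.

(** The power (z y)^(2^p), arranged so that multiplying z by a root u of
    u^(2^p) = -1 changes its sign. *)
Definition pow_arg (z : R[i]) p : B := z ^+ (2 ^ p) *: y ^+ (2 ^ p).

Lemma pow_argS z p : pow_arg z p.+1 = pow_arg z p * pow_arg z p.
Proof. by rewrite /pow_arg -scalerAl -scalerAr scalerA -!exprD addnn -mul2n -expnS. Qed.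

Lemma pow_arg_root (u z : R[i]) p : u ^+ (2 ^ p) = -1 -> pow_arg (u * z) p = - pow_arg z p.
Proof. by move=> up; rewrite /pow_arg exprMn up mulN1r scaleNr. Qed.

(** Doubling: 1/(1-w^2) is the mean of 1/(1-w) and 1/(1+w). *)
Lemma doubling (w : B) : invertible (1 - w) -> invertible (1 + w) ->
  let m := 2^-1 *: (inverse (1 - w) + inverse (1 + w)) in
  (1 - w * w) * m = 1 /\ m * (1 - w * w) = 1.
Proof.
move=> /inverseP[a1 a2] /inverseP[b1 b2] m.
have E1 : 1 - w * w = (1 - w) * (1 + w) by rewrite mulrDr mulr1 mulrBl mul1r addrA subrK.
have E2 : 1 - w * w = (1 + w) * (1 - w) by rewrite mulrBr mulr1 mulrDl mul1r opprD addrA addrK.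
have two : 2^-1 *: ((1 + w) + (1 - w)) = 1 :> B.
  have e2 : 1 + 1 = (2%:R : R[i]) *: (1 : B) by rewrite scaler_nat.
  by rewrite addrACA subrr addr0 e2 scalerA mulVf ?scale1r // pnatr_eq0.
split.
  rewrite /m -scalerAr mulrDr {1}E2 E1 -!mulrA a1 b1 !mulr1; exact: two.
rewrite /m -scalerAl mulrDl {1}E1 E2 !mulrA a2 b2 !mul1r; exact: two.
Qed.

Lemma pow_invertible p (z : R[i]) : nr z <= 1 -> invertible (1 - pow_arg z p).
Proof.
elim: p z => [|p IH] z z1; first by rewrite /pow_arg expn0 !expr1; apply: y_inv.
have [u u1 up] := root_minus1 p.
have [||h1 h2] := @doubling (pow_arg z p); first exact: IH.
  by have := IH (u * z); rewrite (pow_arg_root _ up) opprK; apply; rewrite nrM u1 mul1r.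
by apply/invertibleP; exists (2^-1 *: (inverse (1 - pow_arg z p) + inverse (1 + pow_arg z p))); rewrite pow_argS.
Qed.

Definition pow_resolv p z := inverse (1 - pow_arg z p).

Lemma pow_resolvS p (z u : R[i]) : nr z <= 1 -> nr u = 1 -> u ^+ (2 ^ p) = -1 ->
  pow_resolv p.+1 z = 2^-1 *: (pow_resolv p z + pow_resolv p (u * z)).
Proof.
move=> z1 u1 up; rewrite /pow_resolv (pow_arg_root _ up) opprK pow_argS.
have [||h1 h2] := @doubling (pow_arg z p); first exact: pow_invertible.
  by have := @pow_invertible p (u * z); rewrite (pow_arg_root _ up) opprK; apply; rewrite nrM u1 mul1r.
exact: inverseE.
Qed.

(** By doubling, pow_resolv p.+1 is a mean of two rotated copies of
    pow_resolv p, so a modulus of continuity of the resolvent in the radial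
    direction is inherited by all p. *)
Lemma pow_resolv_close (r s e : R) : 0 <= r <= 1 -> s <= 1 ->
  (forall z : R[i], nr z <= s -> nr (resolv z - resolv (r%:C * z)) <= e) ->
  forall p (z : R[i]), nr z <= s -> nr (pow_resolv p z - pow_resolv p (r%:C * z)) <= e.
Proof.
move=> /andP[r0 r1] s1 H; elim=> [|p IH] z zs.
  by rewrite /pow_resolv /pow_arg expn0 !expr1; apply: H.
have [u u1 up] := root_minus1 p.
have z1 := le_trans zs s1.
have rz1 : nr (r%:C * z) <= 1.
  rewrite nrM nrR ger0_norm //; have := nr_ge0 z; nra.
rewrite (pow_resolvS z1 u1 up) (pow_resolvS rz1 u1 up) mulrCA.
rewrite -scalerBr opprD addrACA nrZ nrV.
rewrite nr_two.
rewrite mulrC ler_pdivrMr //; apply: (le_trans (nr_triangle _ _)).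
have := IH z zs; have := IH (u * z); rewrite nrM u1 mul1r => /(_ zs); lra.
Qed.

Definition pow_vanish (s : R) := forall e : R, 0 < e -> exists N, forall p, (N <= p)%N ->
  s ^+ (2 ^ p) * nr (y ^+ (2 ^ p)) <= e.

Lemma nr_pow_arg (s : R) p : 0 <= s -> nr (pow_arg s%:C p) = s ^+ (2 ^ p) * nr (y ^+ (2 ^ p)).
Proof. by move=> s0; rewrite /pow_arg nrZ nrX nrR ger0_norm. Qed.

(** With q = (s y)^(2^p) small, 1/(1-q) is close to 1; radial continuity carries
    this over to 1/(1-q') with q' = (s' y)^(2^p), and then q' is bounded.  A
    radius slightly smaller than s' turns the bound into convergence to 0. *)
Lemma pow_vanish_step (eta s s' : R) :
  (forall w z : R[i], nr w <= 1 -> nr z <= 1 -> nr (w - z) <= eta -> nr (resolv w - resolv z) <= 1 / 4) ->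
  0 <= s -> s <= s' -> 0 < s' -> s' <= 1 -> s' - s <= eta -> pow_vanish s ->
  exists N, forall p, (N <= p)%N -> s' ^+ (2 ^ p) * nr (y ^+ (2 ^ p)) <= 1.
Proof.
move=> Heta s0 ss' s'0 s'1 se Q.
have aux1 (a b : R) : 0 <= a -> b <= 1 / 5 -> a <= a * b + b -> a <= 1 / 4.
  by move=> a0 b5; have := ler_wpM2l a0 b5; lra.
have aux2 (a b : R) : 0 <= b -> a <= 1 / 2 -> b <= a + a * b -> b <= 1.
  by move=> b0 a2; have := ler_wpM2r b0 a2; lra.
have [N HN] := Q (1 / 5) ltac:(lra); exists N => p Np.
rewrite -nr_pow_arg ?(ltW s'0) //.
have := HN p Np; rewrite -nr_pow_arg // => qs.
pose r := s / s'.
have r01 : 0 <= r <= 1 by rewrite divr_ge0 ?(ltW s'0) //= ler_pdivrMr // mul1r.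
have rs : r%:C * s'%:C = s%:C :> R[i] by rewrite -rmorphM /= divfK // gt_eqF.
have s'n : nr (s'%:C : R[i]) <= s' by rewrite nrR ger0_norm // ltW.
have s'n1 := le_trans s'n s'1.
have sn1 : nr (s%:C : R[i]) <= 1 by rewrite nrR ger0_norm //; lra.
have := @pow_resolv_close r s' (1 / 4) r01 s'1 _ p s'%:C s'n; rewrite rs => C.
have {}C : nr (pow_resolv p s'%:C - pow_resolv p s%:C) <= 1 / 4.
  apply: C => z zs; apply: Heta; first lra.
    by rewrite nrM nrR ger0_norm; [case/andP: r01 => r0 r1; have := nr_ge0 z; nra | case/andP: r01].
  have -> : z - r%:C * z = (1 - r)%:C * z by rewrite rmorphB /= mulrBl mul1r.
  rewrite nrM nrR ger0_norm; last by case/andP: r01; lra.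
  apply: le_trans se; apply: (@le_trans _ _ ((1 - r) * s')).
    by rewrite ler_wpM2l //; case/andP: r01; lra.
  by rewrite mulrBl mul1r divfK // gt_eqF.
have [a1 a2] := inverseP (@pow_invertible p _ sn1).
have [b1 b2] := inverseP (@pow_invertible p _ s'n1).
rewrite -!/(pow_resolv _ _) in a1 a2 b1 b2.
set T := pow_resolv p s%:C in C a1 a2; set T' := pow_resolv p s'%:C in C b1 b2.
set q := pow_arg s%:C p in qs a1 a2; set q' := pow_arg s'%:C p in b1 b2 *.
have hT : nr (T - 1) <= 1 / 4.
  have E : T - 1 = (T - 1) * q + q by rewrite mulrBl mul1r subrK -[in LHS]a2 mulrBr mulr1 opprB addrC subrK.
  have e : nr (T - 1) <= nr (T - 1) * nr q + nr q.
    by rewrite {1}E; apply: (le_trans (nr_triangle _ _)); rewrite lerD2r nr_mul.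
  exact: aux1 (nr_ge0 _) qs e.
have hT' : nr (T' - 1) <= 1 / 2.
  by apply: (le_trans (nr_dist T _ _)); lra.
have e : nr q' <= nr (T' - 1) + nr (T' - 1) * nr q'.
  have E : q' = (T' - 1) - (T' - 1) * q'.
    have Tq : T' * q' = T' - 1 by rewrite -[in RHS]b2 mulrBr mulr1 opprB addrC subrK.
    by rewrite mulrBl mul1r Tq opprB addrC subrK.
  rewrite {1}E; apply: (le_trans (nrB _ _)); rewrite lerD2l; exact: nr_mul.
exact: aux2 (nr_ge0 _) hT' e.
Qed.

(** A form of the spectral radius formula.  The resolvent is uniformly continuous
    on the closed unit disc, so pow_vanish_step extends by a fixed amount the
    range of s for which (s y)^(2^p) tends to 0, until it reaches s = 1. *)
Theorem power_bounded : exists N, forall p, (N <= p)%N -> nr (y ^+ (2 ^ p)) <= 1.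
Proof.
have [K0 HK0] := resolv_bounded.
have [K K1 HK] : exists2 K, 0 < K & forall z : R[i], nr z <= 1 -> nr (resolv z) <= K.
  exists (`|K0| + 1); first by rewrite ltr_wpDl.
  by move=> z /HK0; have := ler_norm K0; lra.
pose eta := (4 * K * K * (nr y + 1) + 1)^-1.
have D0 : 0 < 4 * K * K * (nr y + 1) + 1.
  by rewrite ltr_wpDl // !mulr_ge0 ?(ltW K1) // addr_ge0 ?nr_ge0.
have eta0 : 0 < eta by rewrite invr_gt0.
have eta1 : eta <= 1.
  by rewrite invf_le1 // lerDr !mulr_ge0 ?(ltW K1) // addr_ge0 ?nr_ge0.
have etaK : 4 * (eta * (K * nr y * K)) <= 1.
  have : eta * (4 * K * K * (nr y + 1) + 1) = 1 by rewrite mulVf // gt_eqF.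
  have : 0 <= eta * (K * K) by rewrite !mulr_ge0 // ltW.
  lra.
have Heta (w z : R[i]) : nr w <= 1 -> nr z <= 1 -> nr (w - z) <= eta -> nr (resolv w - resolv z) <= 1 / 4.
  move=> w1 z1 wz; rewrite resolv_diff // nrZ.
  have h : nr (resolv w * y * resolv z) <= K * nr y * K.
    apply: (le_trans (nr_mul _ _)); apply: ler_pM; rewrite ?nr_ge0 ?HK //.
    by apply: (le_trans (nr_mul _ _)); rewrite ler_wpM2r ?nr_ge0 ?HK.
  have := ler_pM (nr_ge0 _) (nr_ge0 _) wz h; lra.
clearbody eta.
pose s k : R := Num.min (k%:R * (eta / 2)) (1 - eta / 2).
have s0 k : 0 <= s k by rewrite le_min mulr_ge0 ?divr_ge0 ?(ltW eta0) //=; lra.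
have s1 k : s k <= 1 - eta / 2 by rewrite ge_min lexx orbT.
have sS k : s k <= s k.+1 <= s k + eta / 2.
  have e2 : 0 < eta / 2 by rewrite divr_gt0.
  have kE : k.+1%:R * (eta / 2) = k%:R * (eta / 2) + eta / 2 by rewrite -natr1 mulrDl mul1r.
  have gen (a b c : R) : 0 < c -> Num.min a b <= Num.min (a + c) b <= Num.min a b + c.
    by move=> c0; case: (leP a b) => h1; case: (leP (a + c) b) => h2; lra.
  by rewrite /s kE; apply: gen.
have Q k : pow_vanish (s k).
  elim: k => [|k IH].
    move=> e e0; exists 0%N => p _; rewrite /s mul0r min_l; last by lra.
    by rewrite expr0n expn_eq0 /= mul0r ltW.
  have [s' s'E] : exists s', s' = s k.+1 + eta / 2 by eexists.
  have /andP[h1 h2] := sS k; have h3 := s1 k.+1; have h4 := s0 k.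
  have e2 : 0 < eta / 2 by rewrite divr_gt0.
  have s'0 : 0 < s' by lra.
  have k1 : s k <= s' by lra.
  have k2 : s' <= 1 by lra.
  have k3 : s' - s k <= eta by lra.
  have [N HN] := pow_vanish_step Heta h4 k1 s'0 k2 k3 IH.
  move=> e e0.
  have r0 : 0 <= s k.+1 / s' by rewrite divr_ge0 // ltW.
  have r1 : s k.+1 / s' < 1 by rewrite ltr_pdivrMr // mul1r s'E ltrDl.
  have [N2 HN2] := pow_small r0 r1 e0; exists (maxn N N2) => p; rewrite geq_max => /andP[p1 p2].
  have -> : s k.+1 = s k.+1 / s' * s' by rewrite divfK // gt_eqF.
  rewrite exprMn -mulrA -[leRHS]mulr1; apply: ler_pM; rewrite ?mulr_ge0 ?exprn_ge0 ?nr_ge0 ?(ltW s'0) //.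
    by apply: HN2; apply: (leq_trans p2); apply: ltnW; apply: ltn_expl.
  exact: HN.
have [n Hn] : exists n : nat, 1 - eta / 2 <= n%:R * (eta / 2).
  exists (Num.bound ((1 - eta / 2) / (eta / 2))); rewrite -ler_pdivrMr ?divr_gt0 //.
  by apply/ltW/archi_boundP; rewrite divr_ge0 ?divr_ge0 ?(ltW eta0) //; lra.
have sn : s n = 1 - eta / 2 by rewrite /s min_r.
have k1 : s n <= 1 by rewrite sn; lra.
have k3 : 1 - s n <= eta by rewrite sn; lra.
have [N HN] := pow_vanish_step Heta (s0 n) k1 ltr01 (lexx _) k3 (Q n).
by exists N => p /HN; rewrite expr1n mul1r.
Qed.

End spectral_radius.

(** * Positive functionals and the involution *)

Section real_part.
Context {R : realType} {A : banachStarAlgType R[i]} {nz : (bone : A) != 0}.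
Local Notation B := (unital_ring nz).
Implicit Types x y h : B.

Definition real_part x : B := 2^-1 *: (x + involution x).

Lemma two_neq0 : (2 : R[i]) != 0.
Proof. by rewrite pnatr_eq0. Qed.

Lemma real_part_selfadjoint x : involution (real_part x) = real_part x.
Proof.
rewrite /real_part involutionZ involutionD involutionK addrC; congr (_ *: _).
by rewrite fmorphV rmorph_nat.
Qed.

Lemma real_part_decomp x : x = real_part x - 'i%C *: real_part ('i%C *: x).
Proof.
have ci : Num.conj 'i%C = - 'i%C :> R[i] by apply/eqP; rewrite eq_complex /= oppr0 !eqxx.
have ii : 'i%C * 'i%C = -1 :> R[i].
  by apply: complex_ext => /=; ring.
rewrite /real_part involutionZ ci scaleNr -scalerBr !scalerA mulrAC ii mulN1r !scaleNr opprK.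
rewrite -scalerDr addrACA subrr addr0.
have -> : x + x = (2%:R : R[i]) *: x by rewrite scaler_nat.
by rewrite scalerA mulVf ?scale1r // two_neq0.
Qed.

(** Induction on n: as a mean of x and its involute, one factor real_part x
    either gives a factor x, of norm at most rho, or raises k. *)
Lemma real_part_geometric x (rho C : R) : 0 < rho -> GRing.comm x (involution x) ->
  nr x <= rho -> (forall k, nr (involution x ^+ k) <= C * rho ^+ k) ->
  forall n k, nr (involution x ^+ k * real_part x ^+ n) <= C * rho ^+ (k + n).
Proof.
move=> rho0 xx xr HC; elim=> [|n IH] k; first by rewrite expr0 mulr1 addn0.
have -> : involution x ^+ k * real_part x ^+ n.+1 =
  2^-1 *: (x * (involution x ^+ k * real_part x ^+ n) + involution x ^+ k.+1 * real_part x ^+ n).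
  rewrite exprS mulrA /real_part -scalerAr -scalerAl mulrDr mulrDl; congr (_ *: (_ + _)).
    by rewrite mulrA; congr (_ * _); apply/esym/commrX.
  by rewrite -exprSr.
rewrite nrZ nrV.
rewrite nr_two.
rewrite mulrC ler_pdivrMr //; apply: (le_trans (nr_triangle _ _)).
have h1 := IH k.+1.
have h2 : nr (x * (involution x ^+ k * real_part x ^+ n)) <= rho * (C * rho ^+ (k + n)).
  by apply: (le_trans (nr_mul _ _)); apply: ler_pM; rewrite ?nr_ge0.
have E1 : C * rho ^+ (k.+1 + n) = C * rho ^+ (k + n.+1) by rewrite addSnnS.
have E2 : rho * (C * rho ^+ (k + n)) = C * rho ^+ (k + n.+1) by rewrite addnS exprS; ring.
by rewrite E1 in h1; rewrite E2 in h2; rewrite mulr2n mulrDr mulr1; apply: lerD.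
Qed.

Lemma invertible_power h n : nr (h ^+ n.+1) < 1 -> invertible (1 - h).
Proof.
move=> /neumann H; have := subrX1 h n.+1 => E.
apply: (@invertible_factor _ _ _ _ (\sum_(i < n.+1) h ^+ i)).
  apply: commr_sum => i _; apply: commrX; apply: commr_sym; apply: commrB; first exact: commr1.
  by [].
by have -> : (1 - h) * (\sum_(i < n.+1) h ^+ i) = 1 - h ^+ n.+1 by rewrite -opprB mulNr -E opprB.
Qed.

(** The involution need not be continuous, so the norm of the real part is not
    controlled by that of x.  The spectral radius of the involute of x is at
    most the norm of x, however, and so is that of the real part, because x and
    its involute commute. *)
Lemma real_part_invertible x : GRing.comm x (involution x) -> nr x < 1 ->
  invertible (1 - real_part x).
Proof.
move=> xx x1; pose rho := (nr x + 1) / 2.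
have [xrho rho0 rho1] : [/\ nr x < rho, 0 < rho & rho < 1].
  by have := nr_ge0 x; rewrite /rho; split; lra.
clearbody rho.
have rhoC : (rho%:C : R[i]) != 0 by rewrite fmorph_eq0 gt_eqF.
pose y : B := (rho%:C)^-1 *: involution x.
have y_inv (z : R[i]) : nr z <= 1 -> invertible (1 - z *: y).
  move=> z1; have -> : 1 - z *: y = involution (1 - Num.conj (z / rho%:C) *: x).
    rewrite -[in RHS]scaleNr involutionD involution1 involutionZ.
    by rewrite rmorphN /= conjCK scaleNr /y scalerA.
  apply: invertible_involution; apply: neumann; rewrite nrZ.
  have -> : nr (Num.conj (z / rho%:C)) = nr z / rho.
    have /complexI : (nr (Num.conj (z / rho%:C)))%:C = (nr z / rho)%:C; last by [].
    by rewrite -nrE norm_conjC nrE nrM nrV nrR ger0_norm // ltW.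
  rewrite mulrAC ltr_pdivrMr // mul1r; apply: le_lt_trans xrho.
  by rewrite -[leRHS]mul1r ler_wpM2r ?nr_ge0.
have [N /(_ N (leqnn N)) yN] := power_bounded y_inv.
set P := (2 ^ N)%N in yN; have P0 : (0 < P)%N by rewrite expn_gt0.
have xP : nr (involution x ^+ P) <= rho ^+ P.
  have -> : involution x ^+ P = rho%:C ^+ P *: y ^+ P.
    by rewrite /y exprZn scalerA exprVn mulfV ?scale1r // expf_neq0.
  by rewrite nrZ nrX nrR ger0_norm ?(ltW rho0) // -[leRHS]mulr1 ler_wpM2l // exprn_ge0 // ltW.
pose C := \sum_(r < P) nr (involution x ^+ r) / rho ^+ r.
have C0 : 0 <= C by apply: sumr_ge0 => i _; rewrite divr_ge0 ?nr_ge0 ?exprn_ge0 // ltW.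
have HC k : nr (involution x ^+ k) <= C * rho ^+ k.
  elim/ltn_ind: k => k IH; have [kP|Pk] := ltnP k P.
    rewrite -ler_pdivrMr ?exprn_gt0 // /C (bigD1 (Ordinal kP)) //= lerDl.
    by apply: sumr_ge0 => i _; rewrite divr_ge0 ?nr_ge0 ?exprn_ge0 // ltW.
  rewrite -(subnK Pk) !exprD mulrA; apply: (le_trans (nr_mul _ _)).
  apply: ler_pM; rewrite ?nr_ge0 //; apply: IH.
  by rewrite ltn_subrL P0 (leq_trans P0).
have D0 : 0 < (C + 1)^-1 / 2 by rewrite divr_gt0 ?invr_gt0 //; lra.
have [N2 HN2] := pow_small (ltW rho0) rho1 D0.
apply: (@invertible_power _ N2).
have := real_part_geometric rho0 xx (ltW xrho) HC N2.+1 0; rewrite expr0 mul1r add0n.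
move/le_lt_trans; apply.
apply: (@le_lt_trans _ _ (C * ((C + 1)^-1 / 2))).
  by rewrite ler_wpM2l // HN2.
by rewrite mulrA ltr_pdivrMr // mul1r ltr_pdivrMr; lra.
Qed.

Section positive.
Hypothesis hermA : hermitian_algebra A.

(** The spectrum is real because the algebra is Hermitian, and for z < 0 the
    element z - (1 - h) = - (1 - z) (1 - h/(1-z)), with h the real part of x, is
    invertible because 1 - z > 1. *)
Lemma real_part_nonnegative x : GRing.comm x (involution x) -> nr x < 1 ->
  nonnegative (1 - real_part x : A).
Proof.
move=> xx x1.
have sa : selfadjoint (1 - real_part x : A).
  rewrite /selfadjoint; have : involution (1 - real_part x) = 1 - real_part x; last by [].
  by rewrite -scaleN1r involutionD involution1 involutionZ real_part_selfadjoint rmorphN1.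
split=> // z zs; have zr := hermA sa zs; rewrite /= real_leNgt ?real0 //; apply/negP => z0.
apply: zs; have k0 : 1 - z != 0 by rewrite subr_eq0; apply/eqP => E; rewrite -E ltr10 in z0.
have k1 : 1 < 1 - z by rewrite ltrBrDr gtrDl.
have -> : z *: (bone : A) - (1 - real_part x) =
   (- (1 - z)) *: (1 - real_part ((1 - z)^-1 *: x)) :> B.
  have E : real_part ((1 - z)^-1 *: x) = (1 - z)^-1 *: real_part x.
    rewrite /real_part involutionZ.
    have -> : Num.conj (1 - z)^-1 = (1 - z)^-1 by apply/CrealP; rewrite realV realB ?real1.
    by rewrite -scalerDr !scalerA [2^-1 * _]mulrC.
  rewrite E scalerBr scalerA mulNr mulfV // !scaleNr !scale1r opprK scalerBl scale1r !opprB.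
  by rewrite addrA [RHS]addrAC.
apply: (@invertibleZ _ _ nz); first by rewrite oppr_eq0.
apply: real_part_invertible.
  by rewrite involutionZ /GRing.comm -!scalerAl -!scalerAr !scalerA mulrC xx.
have n1 : 1 < nr (1 - z).
  move: k1; rewrite ltcE => /andP[_ h]; apply: (lt_le_trans h).
  by apply: le_trans (nr_Re _); exact: ler_norm.
by rewrite nrZ nrV mulrC ltr_pdivrMr ?mul1r; [exact: lt_trans n1 | exact: lt_trans n1].
Qed.

Lemma real_part_scale (t : R) x : real_part (t%:C *: x) = t%:C *: real_part x.
Proof.
rewrite /real_part involutionZ.
have -> : Num.conj t%:C = t%:C by apply/CrealP/complex_realP; exists t.
by rewrite -scalerDr !scalerA mulrC.
Qed.

Variable psi : {scalar A}.
Hypotheses (psi_pos : positive_functional psi) (psi1 : psi bone = 1).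

Lemma functional_real_part x (t : R) : GRing.comm x (involution x) -> nr x < t ->
  psi (real_part x : A) <= t%:C.
Proof.
move=> xx xt; have t0 : 0 < t := le_lt_trans (nr_ge0 _) xt.
have tC : (t%:C : R[i]) != 0 by rewrite fmorph_eq0 gt_eqF.
pose x' : B := (t^-1)%:C *: x.
have xx' : GRing.comm x' (involution x').
  by rewrite /x' involutionZ /GRing.comm -!scalerAl -!scalerAr !scalerA mulrC xx.
have x'1 : nr x' < 1 by rewrite nrZ nrR ger0_norm ?invr_ge0 ?(ltW t0) // mulrC ltr_pdivrMr // mul1r.
have := psi_pos (real_part_nonnegative xx' x'1).
rewrite /x' real_part_scale.
have -> : psi (1 - (t^-1)%:C *: real_part x : B) = 1 - (t^-1)%:C * psi (real_part x).
  by rewrite linearB linearZ /= psi1.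
rewrite subr_ge0 => H.
rewrite -[psi _](mulVKf tC) -[leRHS]mulr1 ler_pM2l ?ltcR //.
by rewrite -fmorphV.
Qed.

(** The bound from above applies to the real parts of x, -x, ix and -ix, and psi x
    is a combination of psi at the real parts of x and of ix; hence the
    factor 2. *)
Lemma functional_bound x : GRing.comm x (involution x) -> nr (psi (x : A)) <= 2 * nr x.
Proof.
move=> xx; apply/ler_addgt0Pr => e e0; pose t := nr x + e / 2.
have xt : nr x < t by rewrite /t; lra.
have conjE (k : R[i]) : nr k = 1 -> GRing.comm (k *: x) (involution (k *: x)) /\ nr (k *: x) < t.
  move=> k1; rewrite nrZ k1 mul1r; split => //.
  by rewrite involutionZ /GRing.comm -!scalerAl -!scalerAr !scalerA mulrC xx.
have F (k : R[i]) : nr k = 1 -> psi (real_part (k *: x) : A) <= t%:C.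
  by move=> /conjE[h1 h2]; apply: functional_real_part.
have n1 : nr ((-1)%:C : R[i]) = 1 by rewrite nrR normrN1.
have realt (a : R[i]) : a <= t%:C -> (-1)%:C * a <= t%:C -> nr a <= t.
  case: a => a1 a2; rewrite !lecE /= => /andP[/eqP a20 a1t] /andP[_]; rewrite -a20 => h.
  have -> : Complex a1 0 = a1%:C by [].
  by rewrite nrR ler_norml; move: h; rewrite mul0r subr0; lra.
have psiN k : psi (real_part ((-1)%:C *: (k *: x)) : A) = (-1)%:C * psi (real_part (k *: x) : A).
  by rewrite real_part_scale linearZ.
have h1 := realt _ (F 1 nr1) _; have hi := realt _ (F 'i%C nr_i) _.
have {}h1 : nr (psi (real_part x : A)) <= t.
  rewrite -[x]scale1r; apply: h1; rewrite -psiN scalerA; apply: F.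
  by rewrite nrM n1 nr1 mulr1.
have {}hi : nr (psi (real_part ('i%C *: x) : A)) <= t.
  by apply: hi; rewrite -psiN scalerA; apply: F; rewrite nrM n1 nr_i mulr1.
have -> : psi (x : A) = psi (real_part x : A) - 'i%C * psi (real_part ('i%C *: x) : A).
  transitivity (psi (real_part x - 'i%C *: real_part ('i%C *: x) : B)); first by rewrite -real_part_decomp.
  by rewrite linearB; congr (_ - _); exact: linearZ.
apply: (le_trans (nrB _ _)); rewrite nrM nr_i mul1r.
by rewrite /t in h1 hi; lra.
Qed.

End positive.

End real_part.

(** * Rational functions of a selfadjoint element *)

Section rational_calculus.
Context {R : realType} {A : banachStarAlgType R[i]} {nz : (bone : A) != 0}.
Local Notation B := (unital_ring nz).
Variable c : B.
Local Notation S := (spectrum (c : A)).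

Lemma notin_spectrum (z : R[i]) : ~ S z -> invertible (z *: 1 - c).
Proof. by move=> H; apply: contrapT. Qed.

(** a stands for N(c) / D(c).  The quotient is expressed by a multiplication, so
    that sums and products need no inverses. *)
Definition rational_value (phi : R[i] -> R[i]) (a : B) : Prop := exists N D : {poly R[i]},
  [/\ forall t, S t -> D.[t] != 0 /\ phi t = N.[t] / D.[t],
      GRing.comm a c & a * horner_alg c D = horner_alg c N].

Lemma horner_algZ (k : R[i]) (p : {poly R[i]}) : horner_alg c (k *: p) = k *: horner_alg c p.
Proof. by rewrite -mul_polyC rmorphM /= horner_algC -scalerAl mul1r. Qed.

Lemma horner_alg_comm (a : B) (p : {poly R[i]}) : GRing.comm a c -> GRing.comm a (horner_alg c p).
Proof.
move=> ac; elim/poly_ind: p => [|p k IH]; first by rewrite rmorph0; apply: commr0.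
rewrite rmorphD rmorphM /= horner_algX horner_algC; apply: commrD; first exact: commrM.
by rewrite /GRing.comm -scalerAl -scalerAr mulr1 mul1r.
Qed.

Lemma horner_alg_commute (p q : {poly R[i]}) : GRing.comm (horner_alg c p) (horner_alg c q).
Proof. by rewrite /GRing.comm -!rmorphM mulrC. Qed.

Lemma horner_alg_invertible (p : {poly R[i]}) : p != 0 -> (forall t, S t -> p.[t] != 0) ->
  invertible (horner_alg c p).
Proof.
move=> p0 pS; have [r pE] := closed_field_poly_normal p.
have l0 : lead_coef p != 0 by rewrite lead_coef_eq0.
have rS t : t \in r -> ~ S t.
  move=> tr /pS /negP; apply; apply/eqP; rewrite pE hornerZ horner_prod.
  by rewrite (big_rem t) //= hornerXsubC subrr mul0r mulr0.
have -> : horner_alg c p = lead_coef p *: horner_alg c (\prod_(z <- r) ('X - z%:P)).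
  by rewrite {1}pE horner_algZ.
apply: (@invertibleZ _ _ nz) => //.
elim: r rS {pE} => [|t r IH] rS.
  by rewrite big_nil rmorph1; apply/(@invertibleP _ _ nz); exists 1; rewrite !mulr1.
rewrite big_cons rmorphM; apply: (@invertibleM _ _ nz); last by apply: IH => s sr; apply: rS; rewrite inE sr orbT.
rewrite rmorphB /= horner_algX horner_algC -opprB -scaleN1r; apply: (@invertibleZ _ _ nz); first by rewrite oppr_eq0 oner_eq0.
by apply: notin_spectrum; apply: rS; rewrite inE eqxx.
Qed.

(** Multiplied by D(c), z - a becomes (zD - N)(c), a product of invertible
    factors if zD - N has no zero on the spectrum.  The point t0 of the spectrum
    excludes that zD - N is the zero polynomial. *)
Lemma rational_spectrum phi (a : B) (t0 z : R[i]) : S t0 -> rational_value phi a ->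
  spectrum (a : A) z -> exists2 t, S t & z = phi t.
Proof.
move=> St0 [N [D [ND ac aD]]] az; apply: contrapT => H.
have Hz t : S t -> (z *: D - N).[t] != 0.
  move=> St; have [Dt phiE] := ND t St; rewrite hornerD hornerN hornerZ subr_eq0.
  by apply/eqP => E; apply: H; exists t => //; rewrite phiE -E mulfK.
apply: az; apply: (@invertible_factor _ _ nz _ (horner_alg c D)).
  apply: horner_alg_comm; apply/commr_sym/commrB.
    by rewrite /GRing.comm -scalerAl -scalerAr mulr1 mul1r.
  exact/commr_sym.
have -> : (z *: 1 - a) * horner_alg c D = horner_alg c (z *: D - N).
  by rewrite rmorphB /= horner_algZ mulrBl aD -scalerAl mul1r.
apply: horner_alg_invertible => //; apply: contra_neq (Hz t0 St0) => ->.
by rewrite horner0.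
Qed.

Lemma rational_valueD phi1 phi2 a1 a2 : rational_value phi1 a1 -> rational_value phi2 a2 ->
  rational_value (fun t => phi1 t + phi2 t) (a1 + a2).
Proof.
move=> [N1 [D1 [H1 c1 E1]]] [N2 [D2 [H2 c2 E2]]]; exists (N1 * D2 + N2 * D1), (D1 * D2); split.
- move=> t St; have [d1 e1] := H1 t St; have [d2 e2] := H2 t St.
  split; first by rewrite hornerM mulf_neq0.
  by rewrite e1 e2 hornerD !hornerM addf_div.
- exact/commr_sym/commrD/commr_sym.
- rewrite mulrDl rmorphD !rmorphM /= mulrA E1; congr (_ + _).
  by rewrite horner_alg_commute mulrA E2.
Qed.

Lemma rational_valueZ (k : R[i]) phi a : rational_value phi a ->
  rational_value (fun t => k * phi t) (k *: a).
Proof.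
move=> [N [D [H ac E]]]; exists (k *: N), D; split.
- by move=> t St; have [d e] := H t St; split => //; rewrite e hornerZ mulrA.
- by rewrite /GRing.comm -scalerAl -scalerAr ac.
- by rewrite -scalerAl E horner_algZ.
Qed.

Lemma rational_value1 : rational_value (fun _ => 1) 1.
Proof.
exists 1, 1; split; last by rewrite mul1r.
  by move=> t _; rewrite hornerC oner_neq0 divr1.
exact/commr_sym/commr1.
Qed.

Lemma rational_valueX : rational_value id c.
Proof.
exists 'X, 1; split; last by rewrite rmorph1 mulr1 horner_algX.
  by move=> t _; rewrite hornerC oner_neq0 divr1 hornerX.
by [].
Qed.

Lemma rational_valueV (z : R[i]) : ~ S z ->
  rational_value (fun t => (z - t)^-1) (inverse (z *: 1 - c)).
Proof.
move=> Sz; have [i1 i2] := inverseP (notin_spectrum Sz).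
exists 1, (z%:P - 'X); split.
- move=> t St; rewrite hornerD hornerN !hornerC hornerX mul1r subr_eq0; split => //.
  by apply/eqP => E; apply: Sz; rewrite E.
- apply/commr_sym; apply: inverse_comm i1 i2 _; apply: commrB => //.
  by rewrite /GRing.comm -scalerAl -scalerAr mulr1 mul1r.
- by rewrite rmorphB rmorph1 /= horner_algX horner_algC i2.
Qed.

Lemma rational_value_ext phi phi' a : (forall t, S t -> phi t = phi' t) ->
  rational_value phi a -> rational_value phi' a.
Proof.
move=> E [N [D [H ac aD]]]; exists N, D; split => // t St.
by rewrite -E //; apply: H.
Qed.

Lemma rational_value_sum n (phi : nat -> R[i] -> R[i]) (a : nat -> B) :
  (forall k, (k < n)%N -> rational_value (phi k) (a k)) ->
  rational_value (fun t => \sum_(0 <= k < n) phi k t) (\sum_(0 <= k < n) a k).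
Proof.
elim: n => [|n IH] H.
  rewrite big_geq // -(scale0r (1 : B)); apply: rational_value_ext (rational_valueZ 0 rational_value1).
  by move=> t _; rewrite big_geq // mul0r.
rewrite big_nat_recr //=; apply: rational_value_ext (rational_valueD (IH _) (H n (leqnn _))).
  by move=> t _; rewrite big_nat_recr.
by move=> k kn; apply: H; apply: ltnW.
Qed.

Hypothesis c_sa : involution c = c.
Hypothesis c_real : forall t, S t -> t \is Num.real.

Lemma involution_horner_alg (p : {poly R[i]}) :
  involution (horner_alg c p) = horner_alg c (map_poly Num.conj p).
Proof.
elim/poly_ind: p => [|p k IH]; first by rewrite !rmorph0 -(scale0r (1 : B)) involutionZ rmorph0 !scale0r.
rewrite !rmorphD !rmorphM /= map_polyX map_polyC !horner_algX !horner_algC /=.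
rewrite involutionD involutionM IH c_sa involutionZ involution1; congr (_ + _).
by rewrite -{1 4}(horner_algX c) horner_alg_commute.
Qed.

(** The involute of a is the value of the rational function with conjugate
    coefficients, whose values on the real spectrum are conjugate. *)
Lemma rational_value_involution phi a : rational_value phi a ->
  rational_value (fun t => Num.conj (phi t)) (involution a).
Proof.
move=> [N [D [H ac E]]]; exists (map_poly Num.conj N), (map_poly Num.conj D).
have ac' : GRing.comm (involution a) c.
  by rewrite /GRing.comm -[in LHS]c_sa -[in RHS]c_sa -!involutionM ac.
split=> //; last first.
  by rewrite horner_alg_comm // -!involution_horner_alg -involutionM E.
move=> t St; have /CrealP tr := c_real St; have [d e] := H t St.
by rewrite -tr !horner_map /= tr fmorph_eq0 e fmorph_div.
Qed.

Hypothesis hermA : hermitian_algebra A.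
Variable psi : {scalar A}.
Hypotheses (psi_pos : positive_functional psi) (psi1 : psi bone = 1).
Variable t0 : R[i].
Hypothesis St0 : S t0.

Lemma rational_real_part_lower phi a (e : R) : rational_value phi a ->
  (forall t, S t -> - e <= complex.Re (phi t)) -> (- e)%:C <= psi (real_part a : A).
Proof.
move=> h1 phie; have h2 := rational_value_involution h1.
have rv : rational_value (fun t => 2^-1 * (phi t + Num.conj (phi t)) + e%:C * 1) (real_part a + e%:C *: 1).
  by apply: rational_valueD; [apply: rational_valueZ; apply: rational_valueD | apply: rational_valueZ; exact: rational_value1].
have H : nonnegative (real_part a + e%:C *: 1 : A).
  split.
    rewrite /selfadjoint; have : involution (real_part a + e%:C *: 1) = real_part a + e%:C *: 1; last by [].
    rewrite involutionD real_part_selfadjoint involutionZ involution1.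
    by congr (_ + _ *: _); apply/CrealP/complex_realP; exists e.
  move=> z zs; have [t St ->] := rational_spectrum St0 rv zs.
  have := phie t St; rewrite mulr1 /=.
  have -> : phi t + Num.conj (phi t) = 2 * (complex.Re (phi t))%:C by exact: addcJ.
  rewrite mulrA mulVf ?two_neq0 // mul1r -rmorphD /= => h.
  by rewrite lecR; lra.
have := psi_pos H.
have -> : psi (real_part a + e%:C *: 1 : B) = psi (real_part a) + e%:C.
  by rewrite linearD; congr (_ + _); rewrite linearZ /= psi1 mulr1.
by rewrite -lerBlDr sub0r rmorphN.
Qed.

(** The real part of psi a is psi of the real part of a; its imaginary part is
    treated in the same way after multiplication of a by i and by -i. *)
Lemma rational_lower phi a (e : R) : rational_value phi a ->
  (forall t, S t -> - e <= complex.Re (phi t) /\ `|complex.Im (phi t)| <= e) ->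
  - e <= complex.Re (psi (a : A)) /\ `|complex.Im (psi (a : A))| <= e.
Proof.
move=> rp H.
have h1 := rational_real_part_lower rp (fun t St => (H t St).1).
have h2 : (- e)%:C <= psi (real_part ('i%C *: a) : A).
  apply: (rational_real_part_lower (rational_valueZ 'i%C rp)) => t St.
  by have := (H t St).2; rewrite ler_norml; case: (phi t) => u w /=; lra.
have h3 : (- e)%:C <= psi (real_part ((-1)%:C *: ('i%C *: a)) : A).
  apply: (rational_real_part_lower (rational_valueZ (-1)%:C (rational_valueZ 'i%C rp))) => t St.
  by have := (H t St).2; rewrite ler_norml; case: (phi t) => u w /=; lra.
have psiN : psi (real_part ((-1)%:C *: ('i%C *: a)) : A) = (-1)%:C * psi (real_part ('i%C *: a) : A).
  by rewrite real_part_scale; exact: linearZ.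
have -> : psi (a : A) = psi (real_part a : A) - 'i%C * psi (real_part ('i%C *: a) : A).
  transitivity (psi (real_part a - 'i%C *: real_part ('i%C *: a) : B)); first by rewrite -real_part_decomp.
  by rewrite linearB; congr (_ - _); exact: linearZ.
move: h1 h2 h3; rewrite psiN.
case: (psi _) => u1 w1; case: (psi _) => u2 w2; rewrite !lecE /= !(mul0r, mul1r, subr0, sub0r, add0r, addr0, opprK).
move=> /andP[/eqP -> a1] /andP[/eqP -> a2] /andP[_ a3].
by split; [lra | rewrite ler_norml; lra].
Qed.

End rational_calculus.

(** * Positivity of the functional calculus *)

Section functional_calculus.
Context {R : realType} {A : banachStarAlgType R[i]} {nz : (bone : A) != 0}.
Local Notation B := (unital_ring nz).
Variable c : B.
Local Notation S := (spectrum (c : A)).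
Context (g : R -> R[i]) (v : R -> R).
Hypotheses (gv : dominates_variation v g) (gc : icont g).
Hypothesis gS : forall s, 0 <= s <= 1 -> ~ S (g s).
Variable f : R[i] -> R[i].
Hypothesis fg : icont (fun s => f (g s)).

Definition resolvent (z : R[i]) : B := inverse (z *: 1 - c).

Lemma resolvent_diff (w z : R[i]) : ~ S w -> ~ S z ->
  resolvent w - resolvent z = (z - w) *: (resolvent w * resolvent z).
Proof.
move=> Sw Sz; rewrite /resolvent resolvent_identity; try exact: notin_spectrum.
have -> : z *: 1 - c - (w *: 1 - c) = (z - w) *: (1 : B).
  by rewrite opprB addrA subrK scalerBl.
by rewrite -scalerAr -scalerAl mulr1.
Qed.

Lemma resolvent_icont : icont (fun s => resolvent (g s)).
Proof.
move=> s ss e e0; set r0 := nr (resolvent (g s)).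
have r00 : 0 <= r0 := nr_ge0 _.
pose d1 := Num.min ((r0 + 1)^-1 / 2) (e / (2 * (r0 + 1) * (r0 + 1))).
have d10 : 0 < d1 by rewrite lt_min !divr_gt0 ?invr_gt0 ?mulr_gt0 //; lra.
have [da db] : d1 * (r0 + 1) <= 1 / 2 /\ d1 * (2 * (r0 + 1) * (r0 + 1)) <= e.
  split.
    apply: (@le_trans _ _ ((r0 + 1)^-1 / 2 * (r0 + 1))).
      by rewrite ler_wpM2r /d1 ?ge_min ?lexx //; lra.
    by rewrite mulrAC mulVf ?gt_eqF //; lra.
  rewrite -ler_pdivlMr ?mulr_gt0 //; try lra.
  by rewrite /d1 ge_min lexx orbT.
have [d d0 Hd] := gc ss d10; exists d => // t tt ts.
have D := resolvent_diff (gS tt) (gS ss).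
have h := Hd t tt ts; rewrite nr_sym in h.
set N := nr (g s - g t) in h.
have N0 : 0 <= N := nr_ge0 _.
have h1 : nr (resolvent (g t) - resolvent (g s)) <= N * (nr (resolvent (g t)) * r0).
  by rewrite D nrZ -/N ler_wpM2l // nr_mul.
have h2 : nr (resolvent (g t)) <= nr (resolvent (g t) - resolvent (g s)) + r0.
  by have := nr_triangle (resolvent (g t) - resolvent (g s)) (resolvent (g s)); rewrite subrK.
have q0 := nr_ge0 (resolvent (g t)).
have aux (q u N' d' r : R) : 0 <= q -> 0 <= N' -> N' <= d' -> 0 <= r -> d' * (r + 1) <= 1 / 2 ->
    d' * (2 * (r + 1) * (r + 1)) <= e -> u <= N' * (q * r) -> q <= u + r -> u <= e.
  move=> q0' N'0 Nd r0' h3 h4 h5 h6.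
  have h7 : N' * r <= 1 / 2.
    apply: le_trans h3; apply: ler_pM => //; lra.
  have h8 : q <= 2 * r.
    have : N' * (q * r) <= q * (1 / 2) by rewrite mulrCA ler_wpM2l.
    lra.
  apply: (le_trans h5); apply: le_trans h4; apply: ler_pM => //; first by rewrite mulr_ge0.
  by apply: ler_pM => //; lra.
exact: (aux _ _ _ _ _ q0 N0 h r00 da db h1 h2).
Qed.

Lemma icontZ (V : normedModType R[i]) (k : R -> R[i]) (H : R -> V) : icont k -> icont H ->
  icont (fun s => k s *: H s).
Proof.
move=> ck cH s ss e e0.
have [K K0 HK] := icont_bounded cH; have [M M0 HM] := icont_bounded ck.
have e1 : 0 < e / 2 / K by rewrite !divr_gt0. have e2 : 0 < e / 2 / M by rewrite !divr_gt0.
have [d1 d10 H1] := ck s ss _ e1; have [d2 d20 H2] := cH s ss _ e2.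
exists (Num.min d1 d2); first by rewrite lt_min d10.
move=> t tt; rewrite lt_min => /andP[/(H1 t tt) h1 /(H2 t tt) h2].
have -> : k t *: H t - k s *: H s = (k t - k s) *: H t + k s *: (H t - H s).
  by rewrite scalerBl scalerBr addrA subrK.
apply: (le_trans (nr_triangle _ _)); rewrite !nrZ.
have -> : e = e / 2 / K * K + M * (e / 2 / M) by field; rewrite !gt_eqF.
by apply: lerD; apply: ler_pM; rewrite ?nr_ge0 ?HK ?HM.
Qed.

(** If t were closer to z than the inverse of the norm of the resolvent, t - c
    would be invertible by the Neumann series.  This bounds the kernel uniformly
    over the spectrum. *)
Lemma kernel_le_resolvent (z t : R[i]) : ~ S z -> S t -> nr (z - t)^-1 <= nr (resolvent z).
Proof.
move=> Sz St; have [i1 i2] := inverseP (notin_spectrum Sz).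
have zt : z - t != 0 by rewrite subr_eq0; apply/eqP => E; apply: Sz; rewrite E.
rewrite nrV leNgt; apply/negP => H; apply: St.
have -> : t *: (bone : A) - c = (z *: 1 - c) * (1 - (z - t) *: resolvent z) :> B.
  by rewrite mulrBr mulr1 -scalerAr i1 scalerBl opprB [RHS]addrC addrA subrK.
apply: (@invertibleM _ _ nz); first exact: notin_spectrum.
apply: neumann; rewrite nrZ.
move: H; set r := nr (resolvent z); rewrite -(ltr_pM2l (_ : 0 < nr (z - t))) ?nr_gt0 //.
by rewrite mulfV // gt_eqF // nr_gt0.
Qed.

Lemma kernel_uniform (e : R) : 0 < e -> exists2 d : R, 0 < d &
  forall t, S t -> forall s s', 0 <= s <= 1 -> 0 <= s' <= 1 -> `|s - s'| < d ->
  nr (f (g s) *: cauchy_kernel t (g s) - f (g s') *: cauchy_kernel t (g s')) <= e.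
Proof.
move=> e0.
have [K K0 HK] := icont_bounded resolvent_icont; have [M M0 HM] := icont_bounded fg.
have HKt t s : S t -> 0 <= s <= 1 -> nr (cauchy_kernel t (g s)) <= K.
  by move=> St ss; apply: le_trans (HK s ss); apply: kernel_le_resolvent => //; apply: gS.
have e1 : 0 < e / 2 / K by rewrite !divr_gt0.
have e2 : 0 < e / 2 / (M * (K * K)) by rewrite !divr_gt0 ?mulr_gt0.
have [d1 d10 H1] := icont_unif fg e1; have [d2 d20 H2] := icont_unif gc e2.
exists (Num.min d1 d2); first by rewrite lt_min d10.
move=> t St s s' ss ss'; rewrite lt_min => /andP[/(H1 s s' ss ss') h1 /(H2 s s' ss ss') h2].
have st : g s - t != 0 by rewrite subr_eq0; apply/eqP => E; apply: (gS ss); rewrite E.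
have st' : g s' - t != 0 by rewrite subr_eq0; apply/eqP => E; apply: (gS ss'); rewrite E.
have -> : f (g s) *: cauchy_kernel t (g s) - f (g s') *: cauchy_kernel t (g s') =
  (f (g s) - f (g s')) * cauchy_kernel t (g s) -
  f (g s') * (cauchy_kernel t (g s) * cauchy_kernel t (g s') * (g s - g s')).
  rewrite -[f (g s) *: _]/(_ * _) -[f (g s') *: _]/(_ * _) /cauchy_kernel.
  by field; rewrite st st'.
apply: (le_trans (nrB _ _)); rewrite !nrM.
have -> : e = e / 2 / K * K + M * (K * K * (e / 2 / (M * (K * K)))) by field; rewrite !gt_eqF.
apply: lerD; first by apply: ler_pM; rewrite ?nr_ge0 // HKt.
apply: ler_pM; rewrite ?mulr_ge0 ?nr_ge0 ?HM //.
apply: ler_pM; rewrite ?mulr_ge0 ?nr_ge0 //.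
by apply: ler_pM; rewrite ?nr_ge0 ?HKt.
Qed.

Definition calculus_integral : B :=
  contour_integral g (fun z => f z *: binv (z *: (bone : A) - c)).

Definition calculus_sum n : B :=
  \sum_(0 <= k < n.+1) (g (unif n k.+1) - g (unif n k)) *: (f (g (unif n k)) *: resolvent (g (unif n k))).

Lemma calculus_cvg (e : R) : 0 < e ->
  exists N, forall n, (N <= n)%N -> nr (calculus_sum n - calculus_integral) <= e.
Proof.
have H := icontZ fg resolvent_icont.
exact: (@contour_integral_cvg _ g v gv A (@seq_complete_banach _ A)
  (fun z => f z *: binv (z *: (bone : A) - c)) H).
Qed.

Lemma unif_itv n k : (k <= n.+1)%N -> 0 <= @unif R n k <= 1.
Proof. exact: (tagged_bounds (unif_tagged1 n)). Qed.

Lemma calculus_sum_comm n (a : B) : GRing.comm a c -> GRing.comm a (calculus_sum n).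
Proof.
move=> ac; rewrite /calculus_sum big_nat; apply: commr_sum => k /andP[_ kn].
have [i1 i2] := inverseP (notin_spectrum (gS (unif_itv (ltnW kn)))).
have h : GRing.comm a (resolvent (g (unif n k))).
  apply: (inverse_comm i1 i2); apply: commrB => //.
  by rewrite /GRing.comm -scalerAl -scalerAr mulr1 mul1r.
by rewrite /GRing.comm -!scalerAr -!scalerAl h.
Qed.

Lemma calculus_integral_comm (a : B) : GRing.comm a c -> GRing.comm a calculus_integral.
Proof.
move=> ac; apply: nr_sub_eq0 => e e0.
have a0 : 0 < nr a + 1 by rewrite ltr_wpDl ?nr_ge0.
have e1 : 0 < e / 2 / (nr a + 1) by rewrite !divr_gt0.
have [N HN] := calculus_cvg e1; have := HN N (leqnn N).
set I := calculus_integral; set T := calculus_sum N => h.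
have -> : a * I - I * a = (T - I) * a - a * (T - I).
  by rewrite mulrBl mulrBr (calculus_sum_comm N ac) opprB [RHS]addrC addrA subrK.
apply: (le_trans (nrB _ _)).
have h1 := nr_mul (T - I) a; have h2 := nr_mul a (T - I).
have h3 : nr (T - I) * nr a <= e / 2.
  apply: (@le_trans _ _ (e / 2 / (nr a + 1) * (nr a + 1))); last by rewrite divfK // gt_eqF.
  by apply: ler_pM; rewrite ?nr_ge0 // lerDl.
rewrite mulrC in h3; rewrite mulrC in h1; lra.
Qed.

Hypothesis c_sa : involution c = c.
Hypothesis c_real : forall t, S t -> t \is Num.real.
Hypothesis hermA : hermitian_algebra A.
Variable psi : {scalar A}.
Hypotheses (psi_pos : positive_functional psi) (psi1 : psi bone = 1).
Variable t0 : R[i].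
Hypothesis St0 : S t0.
Variable tau : R[i].
Hypothesis tau0 : tau != 0.
Hypothesis cauchy : forall t, S t ->
  contour_integral g (fun z => f z *: cauchy_kernel t z) = tau * f t.

(** The Riemann sums y of the integral are values at c of rational functions
    which, by the Cauchy formula, converge uniformly on the spectrum to
    a + b t + k f(t), so rational_lower bounds psi y from below up to a small
    error.  What remains is small in norm and, as a limit of functions of c,
    commutes with its involute, so functional_bound applies to it. *)
Theorem calculus_positive (a b k : R) :
  (forall t, S t -> 0 <= a%:C + b%:C * t + k%:C * f t) ->
  0 <= a%:C + b%:C * psi (c : A) + k%:C * psi (tau^-1 *: calculus_integral : A).
Proof.
move=> pos.
set X := a%:C + _ + _.
suff H e : 0 < e -> - e <= complex.Re X /\ `|complex.Im X| <= e.
  rewrite lecE /=; apply/andP; split.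
    rewrite -normr_eq0 eq_le normr_ge0 andbT; apply/ler_addgt0Pr => e e0; rewrite add0r.
    by have [] := H e e0.
  by apply/ler_addgt0Pr => e e0; have [h _] := H e e0; lra.
move=> e0.
have L0 := variation_ge0 gv; set L := v 1 - v 0 in L0.
set q := nr (k%:C / tau); have q0 : 0 <= q := nr_ge0 _.
have qL : 0 <= q * L by rewrite mulr_ge0.
pose e1 := e / 2 / (q * L + 1).
have e10 : 0 < e1 by rewrite !divr_gt0 //; lra.
pose e2 := e / 4 / (q + 1).
have e20 : 0 < e2 by rewrite !divr_gt0 //; lra.
have qe1 : q * (e1 * L) <= e / 2.
  rewrite mulrCA /e1 mulrAC ler_pdivrMr; last by lra.
  by rewrite ler_pM2l ?divr_gt0 //; lra.
have qe2 : q * e2 <= e / 4.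
  rewrite /e2 mulrCA -[leRHS]mulr1 ler_wpM2l //; first by lra.
  by rewrite ler_pdivrMr; lra.
clearbody e1 e2.
have [N1 HN1] := calculus_cvg e20; have [d d0 Hd] := kernel_uniform e10.
have [N2 HN2] := @inv_lt R (d / 2) ltac:(by rewrite divr_gt0).
pose n := maxn N1 N2.
have {}HN1 := HN1 n (leq_maxl _ _); have {}HN2 := HN2 n (leq_maxr _ _).
pose y : B := a%:C *: 1 + b%:C *: c + (k%:C / tau) *: calculus_sum n.
pose phi (t : R[i]) : R[i] := a%:C * 1 + b%:C * t + (k%:C / tau) *
  \sum_(0 <= j < n.+1) (g (unif n j.+1) - g (unif n j)) * (f (g (unif n j)) * (g (unif n j) - t)^-1).
have yphi : rational_value c phi y.
  apply: rational_valueD; first apply: rational_valueD; apply: rational_valueZ.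
  - exact: rational_value1.
  - exact: rational_valueX.
  - apply: rational_value_sum => j jn; do 2 apply: rational_valueZ.
    by apply: rational_valueV => //; apply/gS/unif_itv/ltnW.
have close t : S t -> nr (phi t - (a%:C + b%:C * t + k%:C * f t)) <= e / 2.
  move=> St.
  have gt s : 0 <= s <= 1 -> g s <> t by move=> ss E; apply: (gS ss); rewrite E.
  have ck : icont (fun s => f (g s) *: cauchy_kernel t (g s)).
    by apply: icontZ => //; apply: (icont_kernel gc).
  have := @contour_integral_spec R g v gv _ (@seq_complete_complex R) (fun z => f z *: cauchy_kernel t z) ck
    e1 d (ltW e10) d0 (fun s s' => Hd t St s s') n.+1 (unif n) (unif n) (unif_tagged HN2).
  rewrite (cauchy St); set Sg := rsum _ _ _ _ _ => h.
  have -> : phi t - (a%:C + b%:C * t + k%:C * f t) = k%:C / tau * (Sg - tau * f t).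
    rewrite /phi -[\sum_(_ <= _ < _) _]/Sg; field; exact: tau0.
  by rewrite nrM -/q; apply: le_trans qe1; rewrite ler_wpM2l.
have [y1 y2] : - (e / 2) <= complex.Re (psi (y : A)) /\ `|complex.Im (psi (y : A))| <= e / 2.
  apply: (rational_lower c_sa c_real psi_pos psi1 St0 yphi) => t St.
  have h := close t St; have := pos t St; have := nr_Re (phi t - (a%:C + b%:C * t + k%:C * f t)).
  have := nr_Im (phi t - (a%:C + b%:C * t + k%:C * f t)).
  move=> h1 h2; have := le_trans h1 h; have := le_trans h2 h; clear h h1 h2.
  move: (a%:C + b%:C * t + k%:C * f t) => w; case: w => w1 w2; case: (phi t) => p1 p2.
  rewrite lecE /= => h1 h2 /andP[/eqP w20 w10]; rewrite w20 subr0 in h2.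
  by split=> //; move: h1; rewrite ler_norml; lra.
pose D : B := calculus_integral - calculus_sum n.
have cD : GRing.comm c D by apply: commrB; [apply: calculus_integral_comm | apply: calculus_sum_comm].
have cD' : GRing.comm (involution D) c.
  by rewrite /GRing.comm -[in LHS]c_sa -[in RHS]c_sa -!involutionM cD.
have DD : GRing.comm ((k%:C / tau) *: D) (involution ((k%:C / tau) *: D)).
  rewrite involutionZ /GRing.comm -!scalerAl -!scalerAr !scalerA mulrC; congr (_ *: _).
  by apply/esym; apply: commrB; [apply: calculus_integral_comm | apply: calculus_sum_comm].
have XE : X = psi (y : A) + psi ((k%:C / tau) *: D : A).
  rewrite -linearD /y /D -addrA -scalerDr [calculus_sum n + _]addrC subrK -scalerA.
  rewrite linearD; congr (_ + _); last by apply/esym; exact: linearZ.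
  rewrite linearD; congr (_ + _); last by apply/esym; exact: linearZ.
  by rewrite linearZ /= psi1 mulr1.
have hD : nr (psi ((k%:C / tau) *: D : A)) <= e / 2.
  apply: (le_trans (functional_bound hermA psi_pos psi1 DD)); rewrite nrZ -/q.
  have : q * nr D <= q * e2 by rewrite ler_wpM2l // nr_sym.
  lra.
have := le_trans (nr_Re _) hD; have := le_trans (nr_Im _) hD.
move: y1 y2; rewrite XE; case: (psi (y : A)) => p1 p2; case: (psi _) => r1 r2 /=.
by rewrite !ler_norml => h1 h2 h3 h4; split; lra.
Qed.

End functional_calculus.

(** * Convex functions and the comparison of the bounds *)

Section convexity.
Context {R : realType}.
Variables (phi : R -> R) (m M : R).
Hypothesis mM : m < M.
Hypothesis phi_convex : forall x y l : R, m <= x <= M -> m <= y <= M -> 0 <= l <= 1 ->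
  phi (x + l * (y - x)) <= phi x + l * (phi y - phi x).

(** Only points of [m, M] are tested: at m and M this is a one-sided
    derivative. *)
Definition eps_deriv (a d : R) : Prop := forall e : R, 0 < e -> exists2 r : R, 0 < r &
  forall t, m <= t <= M -> `|t - a| < r -> `|phi t - phi a - d * (t - a)| <= e * `|t - a|.

(** Convexity bounds phi from above on the segment from a to t; near a this is
    compatible with the derivative d only if phi t lies above the tangent. *)
Lemma convex_tangent a d t : m <= a <= M -> m <= t <= M -> eps_deriv a d ->
  phi a + d * (t - a) <= phi t.
Proof.
move=> aM tM H; have [->|ta] := eqVneq t a; first by rewrite subrr mulr0 addr0.
have ta0 : 0 < `|t - a| by rewrite normr_gt0 subr_eq0.
apply/ler_addgt0Pr => e0 e0_gt0.
have e1 : 0 < e0 / `|t - a| by rewrite divr_gt0.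
have [r r0 Hr] := H _ e1.
pose l := Num.min 1 (r / (2 * `|t - a|)).
have l0 : 0 < l by rewrite lt_min ltr01 divr_gt0 // mulr_gt0.
have l1 : l <= 1 by rewrite ge_min lexx.
have lr : l * `|t - a| < r.
  apply: (@le_lt_trans _ _ (r / 2)); last by lra.
  have -> : r / 2 = r / (2 * `|t - a|) * `|t - a| by field; rewrite gt_eqF.
  by rewrite ler_wpM2r // ge_min lexx orbT.
clearbody l.
have l01 : 0 <= l <= 1 by rewrite (ltW l0).
set u := a + l * (t - a).
have ua : u - a = l * (t - a) by rewrite /u; ring.
have un : `|u - a| = l * `|t - a| by rewrite ua normrM ger0_norm // ltW.
have uM : m <= u <= M.
  by rewrite /u; case/andP: aM => a1 a2; case/andP: tM => t1 t2; apply/andP; split; nra.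
have := Hr u uM; rewrite un => /(_ lr).
have -> : e0 / `|t - a| * (l * `|t - a|) = l * e0 by field; rewrite gt_eqF.
rewrite ua ler_norml => /andP[h _].
have h2 := phi_convex aM tM l01; rewrite -/u in h2.
rewrite -(ler_pM2l l0); lra.
Qed.

Lemma convex_chord t : m <= t <= M ->
  phi t <= (phi m * (M - t) + phi M * (t - m)) / (M - m).
Proof.
move=> tM; have hmM := mM; have Mm : 0 < M - m by rewrite subr_gt0.
have l01 : 0 <= (t - m) / (M - m) <= 1.
  by rewrite divr_ge0 ?ler_pdivrMr //; lra.
have := @phi_convex m M _ ltac:(lra) ltac:(lra) l01.
rewrite divfK ?gt_eqF // subrKC => h; apply: (le_trans h).
by apply: eq_leW; field; rewrite gt_eqF.
Qed.

Definition slope_gap t := (phi M - phi t) / (M - t) - (phi t - phi m) / (t - m).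

Lemma chord_gap t : m < t < M ->
  (phi m * (M - t) + phi M * (t - m)) / (M - m) - phi t =
  (M - t) * (t - m) / (M - m) * slope_gap t.
Proof.
move=> /andP[mt tM]; rewrite /slope_gap; field.
by rewrite !subr_eq0 (gt_eqF mM) (gt_eqF mt) (gt_eqF tM).
Qed.

Lemma slope_gap_ge0 t : m < t < M -> 0 <= slope_gap t.
Proof.
move=> tM; have /andP[t1 t2] := tM.
have tI : m <= t <= M by rewrite !ltW.
have := convex_chord tI; rewrite -subr_ge0 chord_gap //.
have k0 : 0 < (M - t) * (t - m) / (M - m) by rewrite divr_gt0 ?mulr_gt0 ?subr_gt0.
by rewrite pmulr_rge0.
Qed.

Variables (dm dM : R).
Hypotheses (Dm : eps_deriv m dm) (DM : eps_deriv M dM).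

Lemma slope_gap_le t : m < t < M -> slope_gap t <= dM - dm.
Proof.
move=> /andP[mt tM]; have tI : m <= t <= M by rewrite !ltW.
have mI : m <= m <= M by rewrite lexx ltW.
have MI : m <= M <= M by rewrite lexx ltW.
have h1 := convex_tangent MI tI DM; have h2 := convex_tangent mI tI Dm.
rewrite /slope_gap; apply: lerB.
  by rewrite ler_pdivrMr ?subr_gt0 //; lra.
by rewrite ler_pdivlMr ?subr_gt0 //; lra.
Qed.

Definition sup_gap := sup [set slope_gap t | t in `]m, M[%classic].

Lemma sup_gap_bounds p : m < p < M -> slope_gap p <= sup_gap <= dM - dm.
Proof.
move=> pM; apply/andP; split.
  apply: ub_le_sup; last by exists p => //; rewrite /= in_itv.
  by exists (dM - dm) => z [t]; rewrite /= in_itv /= => tM <-; apply: slope_gap_le.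
apply: ge_sup; first by exists (slope_gap p), p => //; rewrite /= in_itv.
by move=> z [t]; rewrite /= in_itv /= => tM <-; apply: slope_gap_le.
Qed.

(** The distance from phi p to the chord is exactly (M-p)(p-m)/(M-m) times the
    slope gap at p.  The comparisons follow because (M-p)(p-m) is at most a
    quarter of (M-m)^2 and slope gaps lie between 0 and dM - dm. *)
Lemma gap_chain p y : m < p < M -> phi p <= y ->
  y <= (phi m * (M - p) + phi M * (p - m)) / (M - m) ->
  let D := dM - dm in
  let B := (M - p) * (p - m) / (M - m) * sup_gap in
  let Q1 := 4^-1 * (M - m) * sup_gap in
  let Q2 := (M - p) * (p - m) * (D / (M - m)) in
  let Q := 4^-1 * (M - m) * D in
  let T := 4^-1 * (M - m) * slope_gap p in
  [/\ 0 <= y - phi p <= B, B <= Q1 /\ B <= Q2, Q1 <= Q /\ Q2 <= Q &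
      y - phi p <= T /\ T <= Q1].
Proof.
move=> pM py yc D B Q1 Q2 Q T; have /andP[p1 p2] := pM.
have g0 := slope_gap_ge0 pM; have /andP[gs sD] := sup_gap_bounds pM.
rewrite -/D in sD.
have Mm : 0 < M - m by rewrite subr_gt0.
set w := (M - p) * (p - m) / (M - m) in B *.
have w0 : 0 <= w by rewrite divr_ge0 ?mulr_ge0 ?subr_ge0 ?ltW.
have w4 : w <= 4^-1 * (M - m).
  rewrite ler_pdivrMr //; have := sqr_ge0 ((M - p) - (p - m)); lra.
have yw : y - phi p <= w * slope_gap p by rewrite /w -chord_gap //; lra.
have s0 : 0 <= sup_gap := le_trans g0 gs.
have Q2E : Q2 = w * D by rewrite /Q2 /w; ring.
have b1 : w * slope_gap p <= B by rewrite ler_wpM2l.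
have b2 : B <= Q1 by rewrite ler_wpM2r.
have b3 : B <= w * D by rewrite ler_wpM2l.
have c0 : 0 <= 4^-1 * (M - m) by rewrite mulr_ge0 ?invr_ge0 // ltW.
have b4 : Q1 <= Q by rewrite ler_wpM2l.
have b5 : w * D <= Q by rewrite ler_wpM2r // (le_trans s0).
have b6 : w * slope_gap p <= T by rewrite ler_wpM2r.
have b7 : T <= Q1 by rewrite ler_wpM2l.
rewrite Q2E; split; [apply/andP; split; [by rewrite subr_ge0 | exact: le_trans b1] | by [] | by [] |].
by split => //; exact: le_trans b6.
Qed.

End convexity.

Theorem theorem3 (R : realType) (A : banachStarAlgType R[i])
  (hermA : hermitian_algebra A)
  (psi : {scalar A}) (psi_pos : positive_functional psi) (psi1 : psi bone = 1)
  (G : set R[i]) (openG : open G)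
  (f : R[i] -> R[i]) (f_an : analytic_on G f)
  (I : set R) (itvI : is_interval I) (IG : forall t, I t -> G t%:C)
  (f_real : forall t, I t -> f t%:C \is Num.real)
  (f_convex : convex_function (E := R^o) I (fun t => complex.Re (f t%:C)))
  (m M : R) (ltmM : m < M) (mMI : `[m, M] `<=` I)
  (c : A) (c_sa : selfadjoint c)
  (c_spec : spectrum c `<=` [set z | m%:C <= z <= M%:C])
  (g : R -> R[i]) (g_contour : contour_around G (spectrum c) g)
  (psi_c : m%:C < psi c < M%:C) :
  let fc := holomorphic_calculus f g c in
  let S := (sup_Theta f m M)%:C in
  let df := derive1 f M%:C - derive1 f m%:C in
  let B := (M%:C - psi c) * (psi c - m%:C) / (M - m)%:C * S in
  let Q1 := 4^-1 * (M - m)%:C * S in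
  let Q2 := (M%:C - psi c) * (psi c - m%:C) * (df / (M - m)%:C) in
  let Q := 4^-1 * (M - m)%:C * df in
  (0 <= psi fc - f (psi c) <= B /\ (B <= Q1 /\ B <= Q2) /\ (Q1 <= Q /\ Q2 <= Q))
  /\
  (0 <= psi fc - f (psi c) /\
   psi fc - f (psi c) <= 4^-1 * (M - m)%:C * Theta f (psi c) m%:C M%:C /\
   4^-1 * (M - m)%:C * Theta f (psi c) m%:C M%:C <= Q1 /\
   Q1 <= Q).
Proof.
move=> fc S df B Q1 Q2 Q.
have nz : (bone : A) != 0.
  by apply/eqP => E; move: psi1; rewrite E linear0 => /esym/eqP; rewrite oner_eq0.
pose cB : unital_ring nz := c.
have [p pE pmM] : exists2 p : R, psi c = p%:C & m < p < M.
  move: psi_c; case: (psi c) => p q; rewrite !ltcE /= => /andP[/andP[/eqP -> mp] /andP[_ pM]].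
  by exists p => //; rewrite mp.
have /andP[mp pM] := pmM.
have inI t : m <= t <= M -> I t by move=> tM; apply: mMI; rewrite /= in_itv.
pose phi t := complex.Re (f t%:C).
have fphi t : m <= t <= M -> f t%:C = (phi t)%:C.
  by move=> /inI/f_real tr; rewrite /phi RRe_real.
have phi_conv x y l : m <= x <= M -> m <= y <= M -> 0 <= l <= 1 ->
    phi (x + l * (y - x)) <= phi x + l * (phi y - phi x).
  move=> xM yM /andP[l0 l1].
  have := f_convex (Itv01 l0 l1) y x (mem_set (inI y yM)) (mem_set (inI x xM)).
  rewrite !convRE /= /unstable.onem => h.
  have -> : x + l * (y - x) = l * y + (1 - l) * x by ring.
  by apply: (le_trans h); apply: eq_leW; rewrite /phi; ring.
have c_itv t : spectrum c t -> exists2 x : R, t = x%:C & m <= x <= M.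
  move=> /c_spec; case: t => x y; rewrite /= !lecE /= => /andP[/andP[/eqP -> h1] /andP[_ h2]].
  by exists x => //; rewrite h1.
have c_real t : spectrum c t -> t \is Num.real by move=> /c_itv[x -> _]; apply/complex_realP; exists x.
have df_cderiv t : m <= t <= M -> cderiv f t%:C (derive1 f t%:C).
  by move=> /inI/IG/f_an; exact: cderiv_derivable.
(* f is real on [m, M], hence so is its derivative *)
have der t : m <= t <= M -> exists2 d : R, derive1 f t%:C = d%:C & eps_deriv phi m M t d.
  move=> tM; have := df_cderiv t tM; case: (derive1 f t%:C) => d d' H.
  have key (e : R) : 0 < e -> exists2 r : R, 0 < r & forall u, m <= u <= M -> `|u - t| < r ->
      `|phi u - phi t - d * (u - t)| <= e * `|u - t| /\ `|d'| * `|u - t| <= e * `|u - t|.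
    move=> e0; have [r r0 Hr] := H e e0; exists r => // u uM ut.
    have nut : nr (u%:C - t%:C : R[i]) = `|u - t| by rewrite -rmorphB nrR.
    have := Hr u%:C; rewrite nut => /(_ ut); rewrite (fphi u uM) (fphi t tM) => h.
    have := le_trans (nr_Re _) h; have := le_trans (nr_Im _) h.
    rewrite /= !(subrr, mulr0, subr0, add0r, addr0, sub0r) normrN normrM => h1 h2; split => //.
  exists d; last by move=> e e0; have [r r0 Hr] := key e e0; exists r => // u uM ut; have [] := Hr u uM ut.
  suff -> : d' = 0 by [].
  apply/eqP; rewrite -normr_le0; apply/ler_addgt0Pr => e e0; rewrite add0r.
  have [r r0 Hr] := key e e0; have /andP[t1 t2] := tM.
  have [u uM [ut un]] : exists2 u, m <= u <= M & `|u - t| < r /\ 0 < `|u - t|.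
    have [tM'|Mt] := ltP t M.
      exists (t + Num.min (r / 2) (M - t)).
        by rewrite -lerBrDl ge_min lexx orbT andbT ler_wpDr // le_min divr_ge0 ?(ltW r0) ?subr_ge0.
      have -> : t + Num.min (r / 2) (M - t) - t = Num.min (r / 2) (M - t) by ring.
      rewrite ger0_norm; last by rewrite le_min divr_ge0 ?(ltW r0) ?subr_ge0.
      rewrite gt_min lt_min subr_gt0 tM' divr_gt0 //; split => //; apply/orP; left; lra.
    exists (t - Num.min (r / 2) (M - m)).
      have tE : t = M by apply/eqP; rewrite eq_le t2.
      rewrite lerBrDl -lerBrDr tE ge_min lexx orbT /= gerBl le_min divr_ge0 ?(ltW r0) ?subr_ge0 ?(ltW ltmM) //.
    have -> : t - Num.min (r / 2) (M - m) - t = - Num.min (r / 2) (M - m) by ring.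
    rewrite normrN ger0_norm; last by rewrite le_min divr_ge0 ?(ltW r0) ?subr_ge0 ?(ltW ltmM).
    rewrite gt_min lt_min subr_gt0 ltmM divr_gt0 //; split => //; apply/orP; left; lra.
  by have [_] := Hr u uM ut; rewrite ler_pM2r.
(* if the spectrum were empty, c - (M + 1) would be nonnegative, contrary to
   psi c < M *)
have [t0 St0] : exists t0, spectrum c t0.
  apply: contrapT => nS.
  have NS z : ~ spectrum c z by move=> H; apply: nS; exists z.
  have : nonnegative (cB - (M + 1)%:C *: 1 : A).
    split.
      rewrite /selfadjoint; have : involution (cB - (M + 1)%:C *: 1) = cB - (M + 1)%:C *: 1; last by [].
      rewrite -scaleNr involutionD involutionZ involution1; congr (_ + _ *: _); first exact: c_sa.
      by apply/CrealP; rewrite rpredN; apply/complex_realP; exists (M + 1).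
    move=> z; case; have := @notin_spectrum _ _ nz cB _ (NS (z + (M + 1)%:C)).
    by rewrite scalerDl opprB addrA addrAC.
  move=> /psi_pos.
  have -> : psi (cB - (M + 1)%:C *: 1 : unital_ring nz) = (p - (M + 1))%:C.
    by rewrite linearB linearZ /= psi1 mulr1 pE rmorphB.
  by rewrite lecR; lra.
have [[gc g01 rg] gG gS gO] := g_contour.
have [v gv] := rectifiable_variation rg.
have ic := icont_within gc.
have intr s : 0 <= s <= 1 -> trace_of g (g s) by move=> ss; exists s => //; rewrite /= in_itv.
have gnS s : 0 <= s <= 1 -> ~ spectrum c (g s).
  by move=> ss /gS [+ _]; apply; exact: intr.
have fg : icont (fun s => f (g s)).
  apply: (icont_comp ic) => s ss; apply: ccont_cderiv (cderiv_derivable (f_an _ _)).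
  exact/gG/intr.
have [tau0 _ _ _] := cauchy_formula openG f_an g_contour gv St0.
have cf t : spectrum c t -> contour_integral g (fun z => f z *: cauchy_kernel t z) = two_pi_i * f t.
  by move=> St; have [] := cauchy_formula openG f_an g_contour gv St.
have pos := @calculus_positive R A nz cB g v gv ic gnS f fg c_sa c_real hermA psi psi_pos psi1 t0 St0
  two_pi_i tau0 cf.
have {}pos (a b k : R) : (forall x, m <= x <= M -> 0 <= a + b * x + k * phi x) ->
    0 <= (a + b * p)%:C + k%:C * psi fc.
  move=> H; have := pos a b k; rewrite -/fc pE !rmorphD !rmorphM /=; apply => t /c_itv[x -> xM].
  by rewrite (fphi x xM) -!rmorphM -!rmorphD /= lecR H.
have pI : m <= p <= M by rewrite !ltW.
have mI : m <= m <= M by rewrite lexx ltW.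
have MI : m <= M <= M by rewrite lexx ltW.
have [d dE Dp] := der p pI; have [dm dmE Dm] := der m mI; have [dM dME DM] := der M MI.
(* f lies above its tangent at p and below its chord on the spectrum *)
have [y yE py] : exists2 y, psi fc = y%:C & phi p <= y.
  have := pos (- phi p + d * p) (- d) 1 _; case: (psi fc) => y y' H.
  have {}H : 0 <= (- phi p + d * p + - d * p)%:C + 1%:C * Complex y y'.
    by apply: H => x xM; have := convex_tangent phi_conv pI xM Dp; lra.
  move: H; rewrite lecE /= => /andP[/eqP h1 h2]; exists y; last by lra.
  by congr Complex; move: h1; lra.
have yc : y <= (phi m * (M - p) + phi M * (p - m)) / (M - m).
  pose b := (phi M - phi m) / (M - m); pose a := phi m - b * m.
  have chord x : (phi m * (M - x) + phi M * (x - m)) / (M - m) = a + b * x.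
    by rewrite /a /b; field; rewrite subr_eq0 gt_eqF.
  have := pos a b (-1) _; rewrite yE -rmorphM -rmorphD lecR chord => H.
  have := H _; rewrite mulN1r subr_ge0; apply => x xM.
  by rewrite mulN1r subr_ge0 -chord; apply: convex_chord.
have TE t : m < t < M -> Theta f t%:C m%:C M%:C = (slope_gap phi m M t)%:C.
  move=> tM; have tI : m <= t <= M by case/andP: tM => h1 h2; rewrite !ltW.
  by rewrite /Theta (fphi t tI) (fphi m mI) (fphi M MI) /slope_gap !(rmorphB, fmorphV, rmorphM).
have SE : sup_Theta f m M = sup_gap phi m M.
  rewrite /sup_Theta /sup_gap; congr sup; apply/seteqP; split=> z [t].
    by rewrite /= in_itv /= => tM <-; exists t; rewrite /= ?in_itv // TE.
  by rewrite /= in_itv /= => tM <-; exists t; rewrite /= ?in_itv // TE.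
have [/andP[g1 g2] [g3 g4] [g5 g6] [g7 g8]] := gap_chain ltmM phi_conv Dm DM pmM py yc.
have E4 : 4^-1 = (4^-1)%:C :> R[i] by rewrite fmorphV rmorph_nat.
rewrite /B /Q1 /Q2 /Q /df /S yE pE (fphi p pI) TE // SE dmE dME E4.
rewrite -!(rmorphB, fmorphV, rmorphM) /= !lecR.
by rewrite g1 g2 g3 g4 g5 g6 g7 g8.
Qed.
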